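(* Let $M$ be a smooth manifold and let $(C,\mathcal S)$ be a stratified subset of $M$, with $C$ closed in $M$. Assume there is a collection of tubular neighbourhoods for $\mathcal S$ that is adjusted, tangential, pre-commutative and commutative (commutative tangential control data). Let $\mathcal S'\subset\mathcal S$ be a subset such that $C'=\bigsqcup_{X\in\mathcal S'}X$ is closed in $C$. Then there is a neighbourhood of $C'$ in $C$ admitting a smooth weak deformation retraction to $C'$. Moreover, if $G$ is a compact Lie group acting smoothly on $M$, every stratum is $G$-invariant and the collection is $G$-equivariant, then this weak deformation retraction can be taken $G$-equivariant.
   Context: **Weak deformation retraction.** For $C'\subset U$, a weak deformation retraction from $U$ to $C'$ is a homotopy $F:U\times[0,1]\to U$ with $F(\cdot,0)=\mathrm{id}_U$, $F(C'\times\{t\})\subset C'$ for all $t$, and $F(U\times\{1\})\subset C'$. Smoothness of maps on open subsets of $C$ (times $[0,1]$) is with respect to the smooth structure induced by $C\subset M$: a map is smooth if it is locally the restriction of a smooth map defined on an open subset of $M$ (times $[0,1]$). **Stratifications.** A stratification $\mathcal S$ of a Hausdorff, second countable, paracompact space $C$ is a locally finite decomposition of $C$ into pairwise disjoint locally closed subsets (strata), each carrying the structure of a smooth manifold (with a well-defined dimension), such that the closure of each stratum is a union of strata. Write $X\le Y$ if $X\subset\overline Y$, and $X<Y$ if $X\le Y$ and $X\ne Y$; $X,Y$ are comparable if $X\le Y$ or $Y\le X$. A stratified subset of $M$ is a subset $C\subset M$ with a stratification whose strata are embedded submanifolds of $M$. **Euler-like vector fields.** Let $N$ be a closed embedded submanifold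 of a manifold $M'$, $\nu_N$ its normal bundle, $m^t:\nu_N\to\nu_N$ fiberwise multiplication by $t\ge0$, $\mathcal E$ the Euler vector field on $\nu_N$ (flow $m^{\exp t}$). A vector field $V$ on $M'$ tangent to $N$ is Euler-like along $N$ if its linear approximation $\nu(V)$ on $\nu_N$ is $\mathcal E$; equivalently, for every $f\in C^\infty(M')$ vanishing on $N$, $f-\mathcal L_Vf$ vanishes to order 2 on $N$ (the function and its differential vanish on $N$). A complete Euler-like $V$ induces a unique open embedding $\Phi:\nu_N\to M'$, the identity on $N$, with $\nu(\Phi)=\mathrm{id}$ and $\mathcal E\sim_\Phi V$; its image is the set of points $p$ for which $\lim_{t\to-\infty}\Psi_V^t(p)$ exists and lies in $N$ ($\Psi_V^t$ the flow). A complete Euler-like $V$ is convenient if (i) $m^0\circ\Phi^{-1}:\Phi(\nu_N)\to N$ extends smoothly to an open neighbourhood of $\overline{\Phi(\nu_N)}$ in $M'$; (ii) $\{V\ne0\}=\{p\in M'\setminus N:\lim_{t\to-\infty}\Psi_V^t(p)\text{ exists and is in }N\}$. A distance function on $\nu_N$ is a smooth $\rho:\nu_N\to\mathbb R_{\ge0}$ with $\rho^{-1}(0)=N$ and $\rho\circ m^t=t^2\rho$. **Collections of tubular neighbourhoods.** Put $C_{<d}=\bigsqcup_{\dim X<d}X$ and $M_d=M\setminus C_{<d}$; it is part of the setting that $M_d$ is open in $M$ and each stratum of dimension $d$ is closed in $M_d$. A collection of tubular neighbourhoods for $\mathcal S$ assigns to each $X\in\mathcal S$, $d=\dim X$: a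 convenient Euler-like vector field $V_X$ on $M_d$ along $X$, inducing $\Phi_X:\nu_X\to M_d$; $T_X=\Phi_X(\nu_X)$; $m_X^t=\Phi_X\circ m^t\circ\Phi_X^{-1}:T_X\to T_X$ ($t\ge0$); and $\rho_X:T_X\to\mathbb R_{\ge0}$, the pullback by $\Phi_X^{-1}$ of a distance function on $\nu_X$. - Adjusted: $T_X\cap T_Y\neq\emptyset$ iff $X,Y$ are comparable; $T_X\cap Y\ne\emptyset$ iff $X\le Y$; for distinct $X,Y$ of the same dimension $d$, $\overline{T_X}\cap\overline{T_Y}\cap M_d=\emptyset$; for $\dim X=d$ and $a\ge 0$, $\rho_X^{-1}([0,a])$ is closed in $M_d$. - Tangential: for $X<Y$ and $y\in Y\cap T_X$, $V_X(y)\in T_yY$. - Pre-commutative: for $X<Y$ and $t\ge0$, wherever both sides are defined, $m_X^0\circ m_Y^t=m_X^0$ and $\rho_X\circ m_Y^t=\rho_X$ (equivalently $Dm_X^0\cdot V_Y=0$ and $\mathcal L_{V_Y}\rho_X=0$ on $T_X\cap T_Y$). - Commutative: for $X<Y$, $s>0$, $t\ge0$, wherever both sides are defined, $m_X^s\circ m_Y^t=m_Y^t\circ m_X^s$ and $\rho_Y\circ m_X^s=\rho_Y$ (equivalently $[V_X,V_Y]=0$ and $\mathcal L_{V_X}\rho_Y=0$ on $T_X\cap T_Y$). - $G$-equivariant (when all strata are $G$-invariant): every $V_X$ and every $\rho_X$ is $G$-invariant. *)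

(* Defs.v *)
From HB Require Import structures.
From mathcomp Require Import all_boot all_order all_algebra.
From mathcomp Require Import all_classical all_reals all_analysis.

Set Implicit Arguments.
Unset Strict Implicit.
Unset Printing Implicit Defensive.

Import Order.TTheory GRing.Theory Num.Theory.
Import numFieldNormedType.Exports.

Local Open Scope classical_set_scope.
Local Open Scope ring_scope.

(* Geometric objects (manifolds, submanifolds, total spaces of normal bundles)
   are sets in an ambient type; maps are total functions whose values are
   meaningful only on the stated domain. *)

(* On a finite-dimensional E and an open set U, this is the usual C^k: the
   map is differentiable and all its directional derivatives are C^(k-1). *)
Fixpoint Ck (R : realType) (E F : normedModType R) (k : nat) (U : set E)
    (f : E -> F) : Prop :=
  if k is k'.+1 then
    (forall x, U x -> differentiable f x) /\ (forall v, Ck k' U ('D_v f))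
  else forall x, U x -> {for x, continuous f}.

Definition smooth_on (R : realType) (E F : normedModType R) (U : set E)
    (f : E -> F) : Prop :=
  forall k, Ck k U f.

(* [cinv] is the inverse of the restriction of [cmap] to [cdom]. *)
Record chart (T E : Type) := Chart {
  cdom : set T;
  cmap : T -> E;
  cinv : E -> T }.

Definition is_chart (R : realType) (T : topologicalType) (E : normedModType R)
    (c : chart T E) : Prop :=
  [/\ open (cdom c),
      open (cmap c @` cdom c),
      (forall p, cdom c p -> cinv c (cmap c p) = p),
      (forall p, cdom c p -> {for p, continuous (cmap c)}) &
      (forall p, cdom c p -> {for cmap c p, continuous (cinv c)})].

Definition compatible (R : realType) (T : Type) (E : normedModType R)
    (c d : chart T E) : Prop :=
  smooth_on (cmap c @` (cdom c `&` cdom d)) (cmap d \o cinv c) /\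
  smooth_on (cmap d @` (cdom c `&` cdom d)) (cmap c \o cinv d).

(* A is a maximal smooth atlas of dimension n. *)
Record smooth_manifold (R : realType) (n : nat) (T : topologicalType)
    (A : set (chart T 'rV[R]_n)) : Prop := SmoothManifold {
  sm_hausdorff : hausdorff_space T;
  sm_second_countable : @second_countable T;
  sm_chart : forall c, A c -> is_chart c;
  sm_cover : forall p, exists2 c, A c & cdom c p;
  sm_compatible : forall c d, A c -> A d -> compatible c d;
  sm_maximal : forall c, is_chart c ->
    (forall d, A d -> compatible c d) -> A c }.

Definition id_chart (T : Type) : chart T T := Chart setT id id.

Definition real_atlas (R : realType) : set (chart R R^o) :=
  [set id_chart R].
Arguments real_atlas : clear implicits.

Definition prod_chart (T T' E E' : Type) (c : chart T E) (d : chart T' E') :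
    chart (T * T') (E * E') :=
  Chart (cdom c `*` cdom d)
        (fun p => (cmap c p.1, cmap d p.2))
        (fun y => (cinv c y.1, cinv d y.2)).

Definition prod_atlas (T T' E E' : Type) (A : set (chart T E))
    (B : set (chart T' E')) : set (chart (T * T') (E * E')) :=
  [set e | exists c d, [/\ A c, B d & e = prod_chart c d]].

(* f is smooth on the set D, which is forced to be open: around every point of
   D, the map f read in a pair of charts is smooth. *)
Definition smooth_map (R : realType) (T T' : Type) (E F : normedModType R)
    (A : set (chart T E)) (B : set (chart T' F)) (D : set T) (f : T -> T') :
    Prop :=
  forall p, D p -> exists c d (W : set E),
    [/\ A c /\ B d, cdom c p, open W /\ W (cmap c p),
        W `<=` cmap c @` (cdom c `&` D `&` f @^-1` cdom d) &
        smooth_on W (cmap d \o f \o cinv c)].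

(* Smoothness on an arbitrary subset D: f is locally the restriction of a
   smooth map defined on an open set. *)
Definition smooth_on_subset (R : realType) (T : topologicalType) (T' : Type)
    (E F : normedModType R) (A : set (chart T E)) (B : set (chart T' F))
    (D : set T) (f : T -> T') : Prop :=
  forall x, D x -> exists (W : set T) (g : T -> T'),
    [/\ open W, W x, smooth_map A B W g &
        forall y, W y -> D y -> g y = f y].

Section Tangent.
Variables (R : realType) (n : nat) (T : topologicalType).
Variable A : set (chart T 'rV[R]_n).

(* A tangent vector at p is the family of its coordinates in the charts at p
   (with the value 0 for all other charts), subject to the usual
   transformation law. *)
Definition tvec := chart T 'rV[R]_n -> 'rV[R]_n.

(* The differential of f at p maps v to w. *)
Definition differential_at (f : T -> T) (p : T) (v w : tvec) : Prop :=
  forall c d, A c -> A d -> cdom c p -> cdom d (f p) ->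
    w d = 'D_(v c) (cmap d \o f \o cinv c) (cmap c p).

Definition tangent (p : T) : set tvec :=
  [set v | (forall c, ~ (A c /\ cdom c p) -> v c = 0) /\
           differential_at id p v v].

Definition tvec_of (c : chart T 'rV[R]_n) (p : T) (a : 'rV[R]_n) : tvec :=
  fun d => if `[< A d /\ cdom d p >]
           then 'D_a (cmap d \o cinv c) (cmap c p) else 0.

Definition velocity (gam : R -> T) (t : R) (v : tvec) : Prop :=
  {for t, continuous gam} /\
  forall c, A c -> cdom c (gam t) ->
    is_derive (t : R^o) (1 : R^o) (cmap c \o gam : R^o -> 'rV[R]_n) (v c).

(* The derivative of f : T -> R at p in the direction v. *)
Definition dirder (f : T -> R) (p : T) (v : tvec) : R :=
  xget 0 [set r | exists c, [/\ A c, cdom c p &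
    r = 'D_(v c) (f \o cinv c : 'rV[R]_n -> R^o) (cmap c p)]].

Definition vector_field (O : set T) (V : T -> tvec) : Prop :=
  (forall p, O p -> tangent p (V p)) /\
  (forall c, A c ->
     smooth_on (cmap c @` (cdom c `&` O)) (fun y => V (cinv c y) c)).

Definition integral_curve (O : set T) (V : T -> tvec) (gam : R -> T) : Prop :=
  forall t, O (gam t) /\ velocity gam t (V (gam t)).

Definition complete_field (O : set T) (V : T -> tvec) : Prop :=
  forall p, O p -> exists2 gam, integral_curve O V gam & gam 0 = p.

(* The points p of O such that the limit of Psi_V^t(p) as t -> -oo exists and
   lies in N; for complete V, t |-> Psi_V^t(p) is the integral curve from p. *)
Definition flows_back_to (O : set T) (V : T -> tvec) (N : set T) : set T :=
  [set p | exists gam, [/\ integral_curve O V gam, gam 0 = p &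
     exists2 q, N q & gam t @[t --> -oo%R] --> q]].

End Tangent.

Section Normal.
Variables (R : realType) (n : nat) (T : topologicalType).
Variable A : set (chart T 'rV[R]_n).
(* the submanifold and its dimension *)
Variables (N : set T) (k : nat).

Definition slice_chart (c : chart T 'rV[R]_n) : Prop :=
  A c /\ forall q, cdom c q ->
    (N q <-> forall j : 'I_n, (k <= j)%N -> cmap c q 0 j = 0).

Definition embedded_submanifold : Prop :=
  (k <= n)%N /\ forall p, N p -> exists2 c, slice_chart c & cdom c p.

Definition tangent_sub (p : T) : set (tvec R n T) :=
  [set v | tangent A p v /\
     forall c, slice_chart c -> cdom c p ->
       forall j : 'I_n, (k <= j)%N -> v c 0 j = 0].

(* The class of v in T_p M / T_p N. *)
Definition ncoset (p : T) (v : tvec R n T) : set (tvec R n T) :=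
  [set v + u | u in tangent_sub p].

Definition nu : set (T * set (tvec R n T)) :=
  [set z | N z.1 /\ exists2 v, tangent A z.1 v & z.2 = ncoset z.1 v].

Definition nzero (p : T) : T * set (tvec R n T) := (p, tangent_sub p).

(* Fiberwise multiplication by t. Adding [tangent_sub] only matters for
   t = 0, where t K is not a coset. *)
Definition nscale (t : R) (z : T * set (tvec R n T)) :
    T * set (tvec R n T) :=
  (z.1, [set w | exists v u, [/\ z.2 v, tangent_sub z.1 u & w = t *: v + u]]).

(* The chart of nu induced by a slice chart c: the first k coordinates are those
   of the base point (its last n - k ones vanish), the last n - k are the
   normal coordinates of the vector. *)
Definition nu_chart (c : chart T 'rV[R]_n) :
    chart (T * set (tvec R n T)) 'rV[R]_n :=
  Chart (nu `&` [set z | cdom c z.1])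
    (fun z => \row_(j < n)
       if (j < k)%N then cmap c z.1 0 j else xget 0 z.2 c 0 j)
    (fun y =>
       let x := cinv c (\row_(j < n) if (j < k)%N then y 0 j else 0) in
       let a := \row_(j < n) if (j < k)%N then 0 else y 0 j in
       (x, ncoset x (tvec_of A c x a))).

Definition nu_atlas : set (chart (T * set (tvec R n T)) 'rV[R]_n) :=
  [set nu_chart c | c in slice_chart].

(* The ambient manifold M' is the open subset O. *)
Variable O : set T.

Definition vanishes_to_order2 (h : T -> R) : Prop :=
  forall p, N p -> h p = 0 /\ forall v, tangent A p v -> dirder A h p v = 0.

Definition euler_like (V : T -> tvec R n T) : Prop :=
  [/\ vector_field A O V,
      (forall p, N p -> tangent_sub p (V p)) &
      forall f : T -> R, smooth_map A (real_atlas R) O f ->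
        (forall p, N p -> f p = 0) ->
        vanishes_to_order2 (fun p => f p - dirder A f p (V p))].

(* T_X = Phi(nu) *)
Definition tube (Phi : T * set (tvec R n T) -> T) : set T := Phi @` nu.

(* m_X^t = Phi o m^t o Phi^-1, on the tube *)
Definition tube_scale (Phi : T * set (tvec R n T) -> T) (t : R) (p : T) : T :=
  xget p [set q | exists z, [/\ nu z, Phi z = p & q = Phi (nscale t z)]].

(* rho o Phi^-1, on the tube *)
Definition tube_pullback (Phi : T * set (tvec R n T) -> T)
    (rho : T * set (tvec R n T) -> R) (p : T) : R :=
  xget 0 [set r | exists z, [/\ nu z, Phi z = p & r = rho z]].

(* a diffeomorphism of nu onto an open subset of O *)
Definition open_embedding (Phi : T * set (tvec R n T) -> T) : Prop :=
  [/\ smooth_map nu_atlas A nu Phi,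
      open (tube Phi), tube Phi `<=` O &
      exists2 Psi, smooth_map A nu_atlas (tube Phi) Psi &
        forall z, nu z -> Psi (Phi z) = z].

(* Phi is the open embedding induced by V. The last two clauses are
   nu(Phi) = id, where a class [v] in the fiber of nu over x is identified with
   the normal class of the velocity at s = 0 of the curve s |-> s [v] in nu,
   and E ~_Phi V, E being the generator of t |-> m^(exp t). *)
Definition induced_embedding (V : T -> tvec R n T)
    (Phi : T * set (tvec R n T) -> T) : Prop :=
  [/\ open_embedding Phi,
      (forall x, N x -> Phi (nzero x) = x),
      (forall x v, N x -> tangent A x v ->
         exists w, [/\ tangent A x w,
           velocity A (fun s => Phi (nscale s (x, ncoset x v))) 0 w &
           ncoset x w = ncoset x v]) &
      (forall z, nu z ->
         velocity A (fun s => Phi (nscale (expR s) z)) 0 (V (Phi z)))].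

Definition convenient (V : T -> tvec R n T)
    (Phi : T * set (tvec R n T) -> T) : Prop :=
  (exists (W : set T) (g : T -> T),
     [/\ open W, closure (tube Phi) `&` O `<=` W, W `<=` O,
         smooth_map A A W g /\ (forall p, W p -> N (g p)) &
         forall p, tube Phi p -> g p = tube_scale Phi 0 p]) /\
  (forall p, O p -> (V p <> 0 <-> ~ N p /\ flows_back_to A O V N p)).

Definition distance_function (rho : T * set (tvec R n T) -> R) : Prop :=
  [/\ smooth_map nu_atlas (real_atlas R) nu rho,
      (forall z, nu z -> 0 <= rho z),
      (forall z, nu z -> (rho z = 0 <-> exists2 x, N x & z = nzero x)) &
      forall t z, 0 <= t -> nu z -> rho (nscale t z) = t ^+ 2 * rho z].

End Normal.

Section Strata.
Variables (R : realType) (n : nat) (T : topologicalType).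
Variable A : set (chart T 'rV[R]_n).
Variables (C : set T) (S : set (set T)) (dim : set T -> nat).

Definition closed_in (D B : set T) : Prop := B `<=` D /\ closure B `&` D `<=` B.

Definition strat_le (X Y : set T) : Prop := X `<=` closure Y.
Definition strat_lt (X Y : set T) : Prop := strat_le X Y /\ X <> Y.
Definition strat_comparable (X Y : set T) : Prop := strat_le X Y \/ strat_le Y X.

(* C is Hausdorff, second countable and paracompact as a subspace of a
   manifold. [dim] is only meaningful on S. *)
Record stratified_subset : Prop := StratifiedSubset {
  ss_cover : C = \bigcup_(X in S) X;
  ss_disjoint : trivIset S id;
  ss_nonempty : forall X, S X -> X !=set0;
  ss_locally_closed : forall X, S X ->
    exists O F : set T, [/\ open O, closed F & X = C `&` O `&` F];
  ss_locally_finite : forall p, C p -> exists W : set T,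
    [/\ open W, W p & finite_set [set X | S X /\ X `&` W !=set0]];
  ss_frontier : forall X, S X -> exists2 S1 : set (set T), S1 `<=` S &
    closure X `&` C = \bigcup_(Y in S1) Y;
  ss_submanifold : forall X, S X -> embedded_submanifold A X (dim X) }.

(* M_d *)
Definition above (d : nat) : set T :=
  ~` \bigcup_(X in [set X | S X /\ (dim X < d)%N]) X.

Definition dimension_setting : Prop :=
  (forall d, open (above d)) /\
  (forall X, S X -> closed_in (above (dim X)) X).

Record tub_data := TubData {
  tub_V : T -> tvec R n T;
  tub_Phi : T * set (tvec R n T) -> T;
  tub_dist : T * set (tvec R n T) -> R }.

Variable tub : set T -> tub_data.

Definition V_ (X : set T) : T -> tvec R n T := tub_V (tub X).
Definition T_ (X : set T) : set T := tube A X (dim X) (tub_Phi (tub X)).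
Definition m_ (X : set T) : R -> T -> T :=
  tube_scale A X (dim X) (tub_Phi (tub X)).
Definition rho_ (X : set T) : T -> R :=
  tube_pullback A X (dim X) (tub_Phi (tub X)) (tub_dist (tub X)).

Definition tub_collection : Prop :=
  forall X, S X ->
    [/\ complete_field A (above (dim X)) (V_ X),
        euler_like A X (dim X) (above (dim X)) (V_ X),
        induced_embedding A X (dim X) (above (dim X)) (V_ X) (tub_Phi (tub X)),
        convenient A X (dim X) (above (dim X)) (V_ X) (tub_Phi (tub X)) &
        distance_function A X (dim X) (tub_dist (tub X))].

Definition tub_adjusted : Prop :=
  [/\ (forall X Y, S X -> S Y -> (T_ X `&` T_ Y !=set0 <-> strat_comparable X Y)),
      (forall X Y, S X -> S Y -> (T_ X `&` Y !=set0 <-> strat_le X Y)),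
      (forall X Y, S X -> S Y -> X <> Y -> dim X = dim Y ->
         closure (T_ X) `&` closure (T_ Y) `&` above (dim X) = set0) &
      (forall X a, S X -> 0 <= a ->
         closed_in (above (dim X)) [set p | T_ X p /\ rho_ X p <= a])].

Definition tub_tangential : Prop :=
  forall X Y, S X -> S Y -> strat_lt X Y ->
    forall y, Y y -> T_ X y -> tangent_sub A Y (dim Y) y (V_ X y).

(* In the next two definitions, the membership hypotheses express that both
   sides of the equations are defined at p. *)
Definition tub_pre_commutative : Prop :=
  forall X Y, S X -> S Y -> strat_lt X Y ->
    forall t p, 0 <= t -> T_ Y p -> T_ X p -> T_ X (m_ Y t p) ->
      m_ X 0 (m_ Y t p) = m_ X 0 p /\ rho_ X (m_ Y t p) = rho_ X p.

Definition tub_commutative : Prop :=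
  forall X Y, S X -> S Y -> strat_lt X Y ->
    (forall s t p, 0 < s -> 0 <= t -> T_ Y p -> T_ X p ->
       T_ X (m_ Y t p) -> T_ Y (m_ X s p) ->
       m_ X s (m_ Y t p) = m_ Y t (m_ X s p)) /\
    (forall s p, 0 < s -> T_ X p -> T_ Y p -> T_ Y (m_ X s p) ->
       rho_ Y (m_ X s p) = rho_ Y p).

Definition strata_invariant (G : Type) (act : G -> T -> T) : Prop :=
  forall X, S X -> forall g p, X p -> X (act g p).

Definition tub_equivariant (G : Type) (act : G -> T -> T) : Prop :=
  forall X, S X -> forall g,
    (forall p, above (dim X) p ->
       differential_at A (act g) p (V_ X p) (V_ X (act g p))) /\
    (forall p, T_ X p -> T_ X (act g p) /\ rho_ X (act g p) = rho_ X p).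

End Strata.

Definition weak_deformation_retraction (R : realType) (T : topologicalType)
    (U C' : set T) (F : T * R -> T) : Prop :=
  [/\ {within U `*` `[0%R, 1%R], continuous F},
      (forall p t, U p -> 0 <= t <= 1 -> U (F (p, t))),
      (forall p, U p -> F (p, 0) = p),
      (forall p t, C' p -> 0 <= t <= 1 -> C' (F (p, t))) &
      (forall p, U p -> C' (F (p, 1)))].

(* U is an open neighbourhood of C' in the subspace C and F is a smooth weak
   deformation retraction from U to C'. *)
Definition smooth_retraction_near (R : realType) (n : nat)
    (T : topologicalType) (A : set (chart T 'rV[R]_n)) (C C' U : set T)
    (F : T * R -> T) : Prop :=
  [/\ exists2 O : set T, open O & U = O `&` C,
      C' `<=` U,
      weak_deformation_retraction U C' F &
      smooth_on_subset (prod_atlas A (real_atlas R)) A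
        (U `*` `[0%R, 1%R]) F].

(* Types with both a group law and a topology; their compatibility is part of
   [lie_group]. *)
#[short(type="topGroupCarrierType")]
HB.structure Definition TopGroupCarrier := {G of Group G & Topological G}.

Record lie_group (R : realType) (k : nat) (G : topGroupCarrierType)
    (B : set (chart G 'rV[R]_k)) : Prop := LieGroup {
  lg_manifold : smooth_manifold B;
  lg_mul : smooth_map (prod_atlas B B) B setT (fun gh => (gh.1 * gh.2)%g);
  lg_inv : smooth_map B B setT (fun g : G => (g^-1)%g) }.

Definition smooth_action (R : realType) (k n : nat) (G : topGroupCarrierType)
    (T : topologicalType) (B : set (chart G 'rV[R]_k))
    (A : set (chart T 'rV[R]_n)) (act : G -> T -> T) : Prop :=
  [/\ (forall p, act 1%g p = p),
      (forall g h p, act (g * h)%g p = act g (act h p)) &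
      smooth_map (prod_atlas B A) A setT (fun gp => act gp.1 gp.2)].

(* Main.v *)
(* Let X range over the strata of S', and let phi be a smooth step with phi(r) = 0 for
   r <= 1 and phi(r) = 1 for r >= 2. On the tube of X, the map
   G_X^a = m_X^(1 - a + a phi(rho_X / eps_X)), a in [0, 1], deforms the identity into a
   map that sends {rho_X <= eps_X} to X, and it is the identity on {rho_X >= 2 eps_X}.
   If the radii eps_X are chosen so that the sets {rho_X <= 2 eps_X} are locally
   finite, then the G_X of all strata of dimension d glue to a G_d^a, which is smooth
   away from the strata of dimension < d. The retraction is
   F^s = G_0^(a_0(s)) o ... o G_n^(a_n(s)), where a_0, a_1, ... climb from 0 to 1 one
   after the other. G_d is not smooth along a stratum X of dimension < d, but when the
   stage d starts, G_X^1 = m_X^0 near X, and m_X^0 o m_Y^t = m_X^0 with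
   rho_X o m_Y^t = rho_X, so the stage d is invisible near X. The neighbourhood
   {rho_X < eps_X for some X} is preserved because also rho_Y o m_X^t = rho_Y for
   X < Y and t > 0. Strata are preserved by m_X^t, t > 0, because V_X is tangent to
   them; this and the equivariance of m_X^t come from Gronwall's lemma. *)

Require Import Defs.
From HB Require Import structures.
From mathcomp Require Import all_boot all_order all_algebra.
From mathcomp Require Import ring.
From mathcomp Require Import all_classical all_reals all_analysis.

Import Order.TTheory GRing.Theory Num.Theory.
Import numFieldNormedType.Exports.

Local Open Scope classical_set_scope.
Local Open Scope ring_scope.

Set Implicit Arguments.
Unset Strict Implicit.
Unset Printing Implicit Defensive.


(** * Calculus of C^k maps *)

Section Calculus.
Variable R : realType.
Implicit Types E F H : normedModType R.

(** The obstacle is that the relations between two tubes are only assumed where both sides are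
    defined, so a point moved by [m Y t] might leave the tube of [X]. Each such claim is settled by
    the connectedness of the line: the times at which the point is still in the tube form an open
    set, and as [rho X] is constant there and its sublevel sets are closed in [above (dim X)], this
    set is closed too. When the lower stratum does the moving, the curve must also be kept in
    [above] of the higher dimension; this follows from the preservation of strata, where the
    closedness of [C] puts a limit point of the curve into some stratum. Tubes of equal dimension
    are disjoint, but infinitely many may accumulate at a point outside all of them, where the glued
    map need not be continuous; hence radii that shrink along an enumeration of the strata. Normal
    bundles are sets of cosets on which no topology is used, so the calculus of smooth maps is set
    up for families of charts that are only required to have open overlaps and smooth transitions in
    the model space. *)

Lemma near_open (T : topologicalType) (U : set T) (P : T -> Prop) x :
  open U -> U x -> (forall y, U y -> P y) -> \forall y \near x, P y.
Proof. by move=> oU Ux UP; apply: (filterS UP); exact: open_nbhs_nbhs. Qed.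

Lemma continuous_near_eq (T T' : topologicalType) (f g : T -> T') x :
  (\forall y \near x, f y = g y) -> {for x, continuous f} -> {for x, continuous g}.
Proof.
move=> fg cf; rewrite /prop_for /continuous_at -(nbhs_singleton fg).
by apply: cvg_trans cf; exact: near_eq_cvg.
Qed.

Lemma differentiable_near_eq E F (f g : E -> F) (x : E) :
  (\forall y \near x, f y = g y) -> differentiable f x -> differentiable g x.
Proof.
move=> fg df.
have /diff_locallyP [dc fE] := df.
have gE : g \o shift x = cst (g x) + 'd f x +o_ 0 id.
  apply/eqaddoP => e e0; move: fE => /eqaddoP /(_ e e0) fE.
  have fg' : \forall y \near (0 : E), f (y + x) = g (y + x).
    by move: fg; rewrite (near_shift 0 x)/= subr0.
  near=> y.
  have gy : f (y + x) = g (y + x) by near: y.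
  have : `|(f \o shift x - (cst (f x) + 'd f x)) y| <= e * `|id y| by near: y.
  rewrite /= -![(_ - _ : E -> F) _]/(_ - _) -![(_ + _ : E -> F) _]/(_ + _)/=.
  by rewrite gy (nbhs_singleton fg).
by apply/diff_locallyP; rewrite (diff_unique dc gE).
Unshelve. all: by end_near. Qed.

(** Openness matters: a directional derivative at a point of [U] sees the values of the function on
    a whole neighbourhood of that point. *)
Lemma Ck_ext k E F (U : set E) (f g : E -> F) : open U ->
  (forall x, U x -> f x = g x) -> Ck k U f -> Ck k U g.
Proof.
move=> oU; elim: k f g => [|k IH] f g fg /=.
  move=> cf x Ux; apply: continuous_near_eq (cf x Ux).
  exact: near_open fg.
move=> [df cf]; split=> [x Ux|v].
  by apply: differentiable_near_eq (df x Ux); exact: near_open fg.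
apply: IH (cf v) => x Ux; apply: near_eq_derive.
exact: near_open fg.
Qed.

Lemma Ck_sub k E F (U V : set E) (f : E -> F) :
  V `<=` U -> Ck k U f -> Ck k V f.
Proof.
move=> VU; elim: k f => [|k IH] f /=; first by move=> cf x /VU; exact: cf.
by move=> [df cf]; split=> [x /VU /df //|v]; exact: IH.
Qed.

Lemma CkW k E F (U : set E) (f : E -> F) : Ck k.+1 U f -> Ck k U f.
Proof.
elim: k f => [|k IH] f; last by move=> [df cf]; split=> // v; exact: IH.
by move=> [df _] x Ux; exact/differentiable_continuous/df.
Qed.

Lemma Ck_continuous k E F (U : set E) (f : E -> F) :
  Ck k U f -> forall x, U x -> {for x, continuous f}.
Proof. by elim: k f => [//|k IH] f /CkW; exact: IH. Qed.

Lemma Ck_cst k E F (U : set E) (a : F) : Ck k U (fun=> a).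
Proof.
elim: k a => [|k IH] a; first by move=> x _; exact: cst_continuous.
split=> [x _|v]; first exact: differentiable_cst.
rewrite (_ : 'D_v _ = fun=> 0) ?funeqE//= => x; exact: derive_cst.
Qed.

Lemma Ck_linear k E F (U : set E) (f : {linear E -> F}) :
  continuous f -> Ck k U f.
Proof.
move=> cf; case: k => [|k]; first by move=> x _; exact: cf.
split=> [x _|v]; first exact: linear_differentiable.
rewrite (_ : 'D_v _ = fun=> f v); first exact: Ck_cst.
by apply/funext => x; rewrite deriveE; [rewrite diff_lin|exact: linear_differentiable].
Qed.

Lemma derive_linear_comp E F H (L : {linear F -> H}) (f : E -> F) x v :
  continuous L -> differentiable f x ->
  'D_v (L \o f) x = L ('D_v f x).
Proof.
move=> cL df; have dL y : differentiable L y by exact: linear_differentiable.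
by rewrite !deriveE//; [rewrite diff_comp//= diff_lin|exact: differentiable_comp].
Qed.

Lemma Ck_linear_comp k E F H (U : set E) (L : {linear F -> H}) (f : E -> F) :
  open U -> continuous L -> Ck k U f -> Ck k U (L \o f).
Proof.
move=> oU cL; elim: k f => [|k IH] f /=.
  by move=> cf x Ux; apply: continuous_comp; [exact: cf|exact: cL].
move=> [df cf]; split=> [x Ux|v].
  by apply: differentiable_comp; [exact: df|exact: linear_differentiable].
apply: (@Ck_ext _ _ _ _ (L \o 'D_v f)) => //; last exact: IH.
by move=> x Ux /=; rewrite derive_linear_comp//; exact: df.
Qed.

Lemma Ck_add k E F (U : set E) (f g : E -> F) : open U ->
  Ck k U f -> Ck k U g -> Ck k U (f \+ g).
Proof.
move=> oU; elim: k f g => [|k IH] f g /=.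
  by move=> cf cg x Ux; apply: continuousD; [exact: cf|exact: cg].
move=> [df cf] [dg cg]; split=> [x Ux|v].
  by apply: differentiableD; [exact: df|exact: dg].
apply: (@Ck_ext _ _ _ _ ('D_v f \+ 'D_v g)) => //; last exact: IH.
move=> x Ux /=; rewrite deriveD//; apply: diff_derivable; [exact: df|exact: dg].
Qed.

Lemma Ck_sum k E F (U : set E) m (f : 'I_m -> E -> F) : open U ->
  (forall i, Ck k U (f i)) -> Ck k U (fun x => \sum_i f i x).
Proof.
move=> oU; elim: m f => [|m IH] f cf.
  under eq_fun do rewrite big_ord0; exact: Ck_cst.
under eq_fun do rewrite big_ord_recl.
by apply: Ck_add => //; apply: IH => i; exact: cf.
Qed.

(** The product rule, obtained as the differential of the continuous bilinear map [a *: w] composed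
    with the pair of [f] and [g]. *)
Lemma is_diff_scale E H (f : E -> R^o) (g : E -> H) x :
  differentiable f x -> differentiable g x ->
  differentiable (fun y => f y *: g y) x /\
  forall v, 'D_v (fun y => f y *: g y) x = 'D_v f x *: g x + f x *: 'D_v g x.
Proof.
move=> df dg.
have sbil : bilinear_for (GRing.Scale.Law.clone _ _ *:%R _)
    (GRing.Scale.Law.clone _ _ *:%R _) (fun (a : R^o) (w : H) => a *: w).
  by split=> [u'|u] a y z /=; rewrite ?scalerDl ?scalerDr ?scalerA// mulrC.
pose sb : {bilinear R^o -> H -> H} :=
  HB.pack (fun (a : R^o) (w : H) => a *: w) (bilinear_isBilinear.Build R _ _ _ _ _ _ sbil).
have sbc : continuous (fun p : R^o * H => sb p.1 p.2).
  move=> p; apply: (@scale_continuous _ _).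
have dp : differentiable (fun y => (f y, g y)) x by exact: differentiable_pair.
have ds := @differentiable_bilin _ _ _ _ sb (f x, g x) sbc.
have dsE := @diff_bilin _ _ _ _ sb (f x, g x) sbc.
have dcE := diff_comp dp ds.
have dc := differentiable_comp dp ds.
split=> [|v]; first exact: dc.
rewrite [LHS](deriveE v dc) dcE /= dsE /= diff_pair//= !deriveE//.
by rewrite addrC.
Qed.

Lemma Ck_scale k E H (U : set E) (f : E -> R^o) (g : E -> H) : open U ->
  Ck k U f -> Ck k U g -> Ck k U (fun x => f x *: g x).
Proof.
move=> oU; elim: k f g => [|k IH] f g /=.
  by move=> cf cg x Ux; apply: continuousZ; [exact: cf|exact: cg].
move=> cf cg; have [df dcf] := cf; have [dg dcg] := cg.
split=> [x Ux|v]; first by have [] := is_diff_scale (df _ Ux) (dg _ Ux).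
apply: (@Ck_ext _ _ _ _ ((fun x => 'D_v f x *: g x) \+ (fun x => f x *: 'D_v g x))) => //.
  by move=> x Ux /=; rewrite (is_diff_scale (df _ Ux) (dg _ Ux)).2.
by apply: Ck_add => //; apply: IH => //; exact: CkW.
Qed.

(** Finite dimension in the form that the chain rule needs. [Ck] only speaks of derivatives in
    constant directions, whereas the derivative of [g \o f] takes that of [g] in the moving
    direction ['D_v f x]; this direction is expanded along the fixed vectors [e i]. *)
Definition finite_coordinates F := exists m (e : 'I_m -> F)
  (c : 'I_m -> {linear F -> R^o}),
  (forall i, continuous (c i)) /\ forall v, v = \sum_i c i v *: e i.

Lemma derive_comp E F H (g : F -> H) (f : E -> F) x v :
  differentiable f x -> differentiable g (f x) ->
  'D_v (g \o f) x = 'D_('D_v f x) g (f x).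
Proof.
move=> df dg; rewrite !deriveE//; first by rewrite diff_comp.
exact: differentiable_comp.
Qed.

Lemma Ck_comp k E F H (U : set E) (V : set F) (g : F -> H) (f : E -> F) :
  finite_coordinates F -> open U -> (forall x, U x -> V (f x)) ->
  Ck k U f -> Ck k V g -> Ck k U (g \o f).
Proof.
move=> [m [e [c [cc ce]]]] oU UV; elim: k f g UV => [|k IH] f g UV /=.
  move=> cf cg x Ux; apply: continuous_comp; [exact: cf|by apply: cg; exact: UV].
move=> cf cg; have [df dcf] := cf; have [dg dcg] := cg.
split=> [x Ux|v].
  by apply: differentiable_comp; [exact: df|apply: dg; exact: UV].
apply: (@Ck_ext _ _ _ _ (fun x => \sum_i c i ('D_v f x) *: ('D_(e i) g \o f) x)) => //.
  move=> x Ux; rewrite derive_comp; [|exact: df|by apply: dg; exact: UV].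
  rewrite [in RHS]deriveE; last by apply: dg; exact: UV.
  rewrite [in RHS](ce ('D_v f x)) linear_sum; apply: eq_bigr => i _ /=.
  by rewrite linearZ/= (deriveE (e i) (dg _ (UV _ Ux))).
apply: Ck_sum => // i; apply: Ck_scale => //.
  exact: (@Ck_linear_comp k E F R^o).
by apply: IH => //; exact: CkW.
Qed.

Lemma Ck_pair k E F H (U : set E) (f : E -> F) (g : E -> H) :
  open U -> Ck k U f -> Ck k U g -> Ck k U (fun x => (f x, g x)).
Proof.
move=> oU; elim: k f g => [|k IH] f g /=.
  by move=> cf cg x Ux; apply: cvg_pair; [exact: cf|exact: cg].
move=> [df dcf] [dg dcg]; split=> [x Ux|v].
  by apply: differentiable_pair; [exact: df|exact: dg].
apply: (@Ck_ext _ _ _ _ (fun x => ('D_v f x, 'D_v g x))) => //; last exact: IH.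
move=> x Ux; rewrite (deriveE v (df _ Ux)) (deriveE v (dg _ Ux)) deriveE.
  by rewrite diff_pair; [|exact: df|exact: dg].
by apply: differentiable_pair; [exact: df|exact: dg].
Qed.

Lemma finite_coordinates_real : finite_coordinates R^o.
Proof.
exists 1%N, (fun=> 1), (fun=> idfun); split=> [i x|v]; first exact: cvg_id.
by rewrite big_ord1 /= /GRing.scale/= mulr1.
Qed.

Lemma finite_coordinates_prod F H :
  finite_coordinates F -> finite_coordinates H -> finite_coordinates (F * H)%type.
Proof.
move=> [m [e [c [cc ce]]]] [m' [e' [c' [cc' ce']]]].
exists (m + m')%N, (fun i : 'I_(m + m') => match fintype.split i with inl a => (e a, 0) | inr b => (0, e' b) end).
pose d (i : 'I_(m + m')) : F * H -> R^o := match fintype.split i with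
  inl a => c a \o fst | inr b => c' b \o snd end.
have dl i : linear (d i).
  by move=> a x y; rewrite /d; case: splitP => k _ /=; rewrite linearP.
pose dL i : {linear (F * H)%type -> R^o} := HB.pack (d i) (GRing.isLinear.Build _ _ _ _ _ (dl i)).
exists dL; split=> [i|v].
  rewrite /dL /= /d => x; case: splitP => k _ /=; apply: continuous_comp.
  - exact: cvg_fst.
  - exact: cc.
  - exact: cvg_snd.
  - exact: cc'.
rewrite /dL /= /d big_split_ord/=.
under eq_bigr do rewrite -[lshift _ _]/(unsplit (inl _)) unsplitK/=.
under [X in _ + X]eq_bigr do rewrite -[rshift _ _]/(unsplit (inr _)) unsplitK/=.
rewrite [LHS]surjective_pairing [in LHS](ce v.1) [in LHS](ce' v.2).
have -> : \sum_(i < m) c i v.1 *: (e i, 0 : H) = (\sum_(i < m) c i v.1 *: e i, 0).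
  elim/big_rec2: _ => // i y1 y2 _ ->.
  by rewrite -[_ *: (_, _)]/(_ *: _, _ *: _) -[_ + (_, _)]/(_ + _, _ + _) scaler0 addr0.
have -> : \sum_(i < m') c' i v.2 *: (0 : F, e' i) = (0, \sum_(i < m') c' i v.2 *: e' i).
  elim/big_rec2: _ => // i y1 y2 _ ->.
  by rewrite -[_ *: (_, _)]/(_ *: _, _ *: _) -[_ + (_, _)]/(_ + _, _ + _) scaler0 addr0.
by rewrite -[(_, _) + _]/(_ + _, _ + _) addr0 add0r.
Qed.

Definition rV_coord n (i : 'I_n) (v : 'rV[R]_n) : R^o := v 0 i.

Lemma rV_coord_linear n i : linear (@rV_coord n i).
Proof. by move=> a x y; rewrite /rV_coord !mxE. Qed.
HB.instance Definition _ n i :=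
  GRing.isLinear.Build R 'rV[R]_n R^o _ (@rV_coord n i) (@rV_coord_linear n i).

Lemma rV_coord_continuous n i : continuous (@rV_coord n i).
Proof. exact: coord_continuous. Qed.

Lemma finite_coordinates_rV n : finite_coordinates 'rV[R]_n.
Proof.
exists n, (fun i => delta_mx 0 i), (fun i => @rV_coord n i).
by split=> [i|v]; [exact: rV_coord_continuous|exact: row_sum_delta].
Qed.

Lemma Ck_rV k E n (U : set E) (f : E -> 'rV[R]_n) : open U ->
  (forall i, Ck k U (fun x => f x 0 i : R^o)) -> Ck k U f.
Proof.
move=> oU cf.
apply: (@Ck_ext _ _ _ _ (fun x => \sum_i (f x 0 i : R^o) *: (delta_mx 0 i : 'rV[R]_n))) => //.
  by move=> x _; rewrite [RHS]row_sum_delta.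
by apply: Ck_sum => // i; apply: Ck_scale => //; exact: Ck_cst.
Qed.

End Calculus.


(** * Smooth maps between charted spaces *)

Section SmoothMaps.
Variable R : realType.
Implicit Types E F H : normedModType R.

Lemma open_preimage_in (T T' : topologicalType) (f : T -> T') (U : set T) (V : set T') :
  open U -> open V -> (forall x, U x -> {for x, continuous f}) ->
  open (U `&` f @^-1` V).
Proof.
move=> oU oV cf; rewrite openE => x [Ux Vfx]; apply: filterI.
  exact: open_nbhs_nbhs.
by apply: cf => //; exact: open_nbhs_nbhs.
Qed.

(** What composition of smooth maps uses of an atlas, with all openness expressed in the model
    space. It therefore also applies to the charts of a normal bundle. *)
Record weak_atlas (T : Type) E (A : set (chart T E)) : Prop := WeakAtlas {
  wa_cancel : forall c p, A c -> cdom c p -> cinv c (cmap c p) = p;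
  wa_open : forall c d, A c -> A d -> open (cmap c @` (cdom c `&` cdom d));
  wa_compatible : forall c d, A c -> A d -> compatible c d }.

Lemma smooth_on_continuous E F (U : set E) (f : E -> F) x :
  smooth_on U f -> U x -> {for x, continuous f}.
Proof. by move=> sf; exact: (Ck_continuous (sf 0%N)). Qed.

Lemma smooth_on_sub E F (U V : set E) (f : E -> F) :
  V `<=` U -> smooth_on U f -> smooth_on V f.
Proof. by move=> VU sf k; exact: Ck_sub (sf k). Qed.

Lemma smooth_on_ext E F (U : set E) (f g : E -> F) : open U ->
  (forall x, U x -> f x = g x) -> smooth_on U f -> smooth_on U g.
Proof. by move=> oU fg sf k; exact: Ck_ext (sf k). Qed.

Lemma smooth_on_comp E F H (U : set E) (V : set F) (g : F -> H) (f : E -> F) :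
  finite_coordinates F -> open U -> (forall x, U x -> V (f x)) ->
  smooth_on U f -> smooth_on V g -> smooth_on U (g \o f).
Proof. by move=> cF oU UV sf sg k; exact: Ck_comp (sf k) (sg k). Qed.

(** Smoothness provides one pair of charts at [p]; composing with a transition map on either side
    carries it to any other pair. *)
Lemma smooth_map_in_charts (T T' : Type) E F (A : set (chart T E))
  (B : set (chart T' F)) D f p c d : finite_coordinates E -> finite_coordinates F ->
  weak_atlas A -> weak_atlas B -> smooth_map A B D f -> D p ->
  A c -> cdom c p -> B d -> cdom d (f p) -> exists W,
  [/\ open W, W (cmap c p), W `<=` cmap c @` (cdom c `&` D `&` f @^-1` cdom d) &
        smooth_on W (cmap d \o f \o cinv c)].
Proof.
move=> cE cF wA wB /[apply] -[c0 [d0 [W0 [[Ac0 Bd0] c0p [oW0 W0p] sW0 sf]]]].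
move=> Ac cp Bd dfp.
have [s1 _] := wa_compatible wA Ac Ac0.
have [s2 _] := wa_compatible wB Bd0 Bd.
have oO1 := wa_open wA Ac Ac0; have oO2 := wa_open wB Bd0 Bd.
set O1 := cmap c @` _ in s1 oO1; set O2 := cmap d0 @` _ in s2 oO2.
set tau := cmap c0 \o cinv c in s1; set sig := cmap d \o cinv d0 in s2.
set g0 := cmap d0 \o f \o cinv c0 in sf.
pose W1 := O1 `&` tau @^-1` W0.
have oW1 : open W1.
  by apply: open_preimage_in => // x O1x; exact: smooth_on_continuous s1 O1x.
have sgt : smooth_on W1 (g0 \o tau).
  apply: (smooth_on_comp cE oW1 _ _ sf); first by move=> x [].
  by apply: smooth_on_sub s1 => x [].
pose W2 := W1 `&` (g0 \o tau) @^-1` O2.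
have oW2 : open W2.
  by apply: open_preimage_in => // x W1x; exact: smooth_on_continuous sgt W1x.
have ccK q : cdom c q -> cinv c (cmap c q) = q by move=> cq; exact: (wa_cancel wA Ac).
have c0K q : cdom c0 q -> cinv c0 (cmap c0 q) = q by move=> cq; exact: (wa_cancel wA Ac0).
have d0K q : cdom d0 q -> cinv d0 (cmap d0 q) = q by move=> cq; exact: (wa_cancel wB Bd0).
(* The conditions defining [W2] each hand back a point with given coordinates; the cancellation in
   the charts shows that these are one point [q] and its image [f q]. *)
have W2P y : W2 y -> exists q, [/\ y = cmap c q, cdom c q, cdom c0 q, D q &
    cdom d0 (f q) /\ cdom d (f q)].
  move=> [[[q [cq c0q] <-]]]; rewrite /tau /preimage /= ccK// => W0q.
  have [q' [[c0q' Dq'] d0q'] qq'] := sW0 _ W0q.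
  have e : q = q' by rewrite -(c0K q)// -qq' c0K.
  subst q'; rewrite /g0 /tau /preimage /= c0K// => -[r [d0r dr] rE].
  have e : f q = r by rewrite -(d0K (f q))// -rE d0K.
  by exists q; split => //; split=> //; rewrite e.
exists W2; split => //.
- split.
    split; first by exists p.
    by rewrite /tau /preimage/= ccK.
  rewrite /g0 /tau /preimage/= ccK// c0K//; exists (f p) => //; split=> //.
  have [q [[c0q Dq] d0q] /(congr1 (cinv c0))] := sW0 _ W0p.
  by rewrite !c0K// => <-.
- by move=> y /W2P[q [-> cq c0q Dq [_ dq]]]; exists q.
- apply: (@smooth_on_ext _ _ _ (sig \o (g0 \o tau))) => //.
    move=> y /W2P[q [-> cq c0q Dq [d0q dq]]].
    by rewrite /sig /g0 /tau /= ccK// c0K// d0K.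
  apply: (smooth_on_comp cF oW2 _ _ s2); first by move=> x [].
  by apply: smooth_on_sub sgt => x [].
Qed.

Lemma smooth_map_comp (T T' T'' : Type) E F H (A : set (chart T E))
  (B : set (chart T' F)) (C : set (chart T'' H)) D D' f g :
  finite_coordinates F -> finite_coordinates H -> weak_atlas A ->
  weak_atlas B -> weak_atlas C -> smooth_map A B D f -> smooth_map B C D' g ->
  (forall p, D p -> D' (f p)) -> smooth_map A C D (g \o f).
Proof.
move=> cF cH wA wB wC sf sg DD' p Dp.
have [c [d [W [[Ac Bd] cp [oW Wp] sW sfW]]]] := sf p Dp.
have [d' [e [W' [[Bd' Ce] d'p [oW' Wp'] sW' sfW']]]] := sg _ (DD' _ Dp).
have cK q : cdom c q -> cinv c (cmap c q) = q by move=> cq; exact: (wa_cancel wA Ac).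
have dK q : cdom d q -> cinv d (cmap d q) = q by move=> cq; exact: (wa_cancel wB Bd).
have dfp : cdom d (f p).
  by have [q [[cq Dq] dq] /(congr1 (cinv c))] := sW _ Wp; rewrite !cK// => <-.
have efp : cdom e (g (f p)).
  have [q [[cq Dq] dq] /(congr1 (cinv d'))] := sW' _ Wp'.
  by rewrite !(wa_cancel wB Bd')// => <-.
have [V [oV Vp sV sgV]] := smooth_map_in_charts cF cH wB wC sg (DD' _ Dp) Bd dfp Ce efp.
pose W3 := W `&` (cmap d \o f \o cinv c) @^-1` V.
have oW3 : open W3.
  by apply: open_preimage_in => // x Wx; exact: smooth_on_continuous sfW Wx.
have W3P y : W3 y -> exists q, [/\ y = cmap c q, cdom c q, D q, cdom d (f q) & cdom e (g (f q))].
  move=> [/sW[q [[cq Dq] dq] <-]]; rewrite /preimage/= cK// => /sV[r [[dr _] er] /(congr1 (cinv d))].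
  by rewrite !dK// => rE; exists q; split => //; rewrite -rE.
exists c, e, W3; split => //.
- by split=> //; split=> //; rewrite /preimage/= cK.
- by move=> y /W3P[q [-> cq Dq dq eq]]; exists q.
- apply: (@smooth_on_ext _ _ _ ((cmap e \o g \o cinv d) \o (cmap d \o f \o cinv c))) => //.
    by move=> y /W3P[q [-> cq Dq dq eq]] /=; rewrite cK// dK.
  apply: (smooth_on_comp cF oW3 _ _ sgV); first by move=> x [].
  by apply: smooth_on_sub sfW => x [].
Qed.

(** The gluing principle for maps defined by cases. The openness of [D'] around [p] is contained in
    [smooth_map A B D' g]. *)
Lemma smooth_map_local (T T' : Type) E F (A : set (chart T E))
  (B : set (chart T' F)) (D : set T) f : weak_atlas A ->
  (forall p, D p -> exists D' g, [/\ D' p, D' `<=` D, smooth_map A B D' g &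
     forall q, D' q -> f q = g q]) ->
  smooth_map A B D f.
Proof.
move=> wA h p Dp; have [D' [g [D'p D'D sg fg]]] := h p Dp.
have [c [d [W [[Ac Bd] cp [oW Wp] sW sgW]]]] := sg p D'p.
have cK q : cdom c q -> cinv c (cmap c q) = q by move=> cq; exact: (wa_cancel wA Ac).
exists c, d, W; split=> //.
  by move=> y /sW[q [[cq D'q] dq] <-]; exists q => //; split; [split=> //; exact: D'D|rewrite /preimage/= fg].
apply: smooth_on_ext sgW => // y /sW[q [[cq D'q] dq] <-] /=.
by rewrite cK// fg.
Qed.

Lemma smooth_map_ext (T T' : Type) E F (A : set (chart T E))
  (B : set (chart T' F)) (D : set T) f g : weak_atlas A ->
  (forall q, D q -> f q = g q) -> smooth_map A B D f -> smooth_map A B D g.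
Proof.
move=> wA fg sf; apply: smooth_map_local => // p Dp.
by exists D, f; split=> // q Dq; rewrite fg.
Qed.

Lemma smooth_map_pair (T T' T'' : Type) E F H (A : set (chart T E))
  (B : set (chart T' F)) (C : set (chart T'' H)) D f g :
  finite_coordinates E -> finite_coordinates F -> finite_coordinates H ->
  weak_atlas A -> weak_atlas B -> weak_atlas C -> 
  smooth_map A B D f -> smooth_map A C D g ->
  smooth_map A (prod_atlas B C) D (fun p => (f p, g p)).
Proof.
move=> cE cF cH wA wB wC sf sg p Dp.
have [c [d [W [[Ac Bd] cp [oW Wp] sW sfW]]]] := sf p Dp.
have [c' [e [W' [[Bc' Ce] c'p [oW' Wp'] sW' sfW']]]] := sg p Dp.
have cK q : cdom c q -> cinv c (cmap c q) = q by move=> cq; exact: (wa_cancel wA Ac).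
have egp : cdom e (g p).
  have [q [[cq Dq] dq] /(congr1 (cinv c'))] := sW' _ Wp'.
  by rewrite !(wa_cancel wA Bc')// => <-.
have [V [oV Vp sV sgV]] := smooth_map_in_charts cE cH wA wC sg Dp Ac cp Ce egp.
exists c, (prod_chart d e), (W `&` V); split=> //.
- by split=> //; exists d, e.
- by split; [exact: openI|].
- move=> y [/sW[q [[cq Dq] dq] <-] /sV[q' [[cq' Dq'] eq'] /(congr1 (cinv c))]].
  by rewrite !cK// => e'; subst q'; exists q.
- move=> k; apply: (@Ck_pair _ k _ _ _ _ (cmap d \o f \o cinv c) (cmap e \o g \o cinv c)).
  + exact: openI.
  + by apply: Ck_sub (sfW k) => x [].
  + by apply: Ck_sub (sgV k) => x [].
Qed.

Lemma smooth_on_linear E F (U : set E) (f : {linear E -> F}) :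
  continuous f -> smooth_on U f.
Proof. by move=> cf k; exact: Ck_linear. Qed.

Lemma smooth_on_pair E F H (U : set E) (f : E -> F) (g : E -> H) :
  open U -> smooth_on U f -> smooth_on U g -> smooth_on U (fun x => (f x, g x)).
Proof. by move=> oU sf sg k; exact: Ck_pair. Qed.

Lemma smooth_on_fst E F (U : set (E * F)) : smooth_on U (@fst E F).
Proof.
have l : linear (@fst E F) by move=> a x y.
pose L : {linear (E * F)%type -> E} := HB.pack (@fst E F) (GRing.isLinear.Build _ _ _ _ _ l).
by apply: (@smooth_on_linear _ _ U L) => x; exact: cvg_fst.
Qed.

Lemma smooth_on_snd E F (U : set (E * F)) : smooth_on U (@snd E F).
Proof.
have l : linear (@snd E F) by move=> a x y.
pose L : {linear (E * F)%type -> F} := HB.pack (@snd E F) (GRing.isLinear.Build _ _ _ _ _ l).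
by apply: (@smooth_on_linear _ _ U L) => x; exact: cvg_snd.
Qed.

Lemma open_setX (T T' : topologicalType) (U : set T) (V : set T') :
  open U -> open V -> open (U `*` V).
Proof.
move=> oU oV; rewrite openE => -[x y] [/= Ux Vy]; exists (U, V) => //=.
by split; exact: open_nbhs_nbhs.
Qed.

Lemma prod_chart_image (T T' : Type) E F (c : chart T E) (d : chart T' F) X Y :
  cmap (prod_chart c d) @` (X `*` Y) = (cmap c @` X) `*` (cmap d @` Y).
Proof.
apply/seteqP; split => [_ [[x y] [/= Xx Yy] <-]|[_ _] [/= [x Xx <-] [y Yy <-]]].
  by split; [exists x|exists y].
by exists (x, y).
Qed.

Lemma compatible_prod (T T' : Type) E F (c c' : chart T E) (d d' : chart T' F) :
  finite_coordinates E -> finite_coordinates F ->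
  open (cmap c @` (cdom c `&` cdom c')) -> open (cmap d @` (cdom d `&` cdom d')) ->
  smooth_on (cmap c @` (cdom c `&` cdom c')) (cmap c' \o cinv c) ->
  smooth_on (cmap d @` (cdom d `&` cdom d')) (cmap d' \o cinv d) ->
  smooth_on (cmap (prod_chart c d) @` (cdom (prod_chart c d) `&` cdom (prod_chart c' d')))
    (cmap (prod_chart c' d') \o cinv (prod_chart c d)).
Proof.
move=> cE cF oc od sc sd; rewrite /= -setXI prod_chart_image.
have o := open_setX oc od.
apply: (@smooth_on_pair _ _ _ _ ((cmap c' \o cinv c) \o fst) ((cmap d' \o cinv d) \o snd)) => //.
  by apply: (smooth_on_comp cE o _ _ sc); [move=> x []|exact: smooth_on_fst].
by apply: (smooth_on_comp cF o _ _ sd); [move=> x []|exact: smooth_on_snd].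
Qed.

Lemma weak_atlas_prod (T T' : Type) E F (A : set (chart T E)) (B : set (chart T' F)) :
  finite_coordinates E -> finite_coordinates F ->
  weak_atlas A -> weak_atlas B -> weak_atlas (prod_atlas A B).
Proof.
move=> cE cF wA wB; split.
- move=> _ [p q] [c [d [Ac Bd ->]]] [/= cp dq].
  by rewrite (wa_cancel wA)// (wa_cancel wB).
- move=> _ _ [c [d [Ac Bd ->]]] [c' [d' [Ac' Bd' ->]]].
  rewrite /= -setXI prod_chart_image.
  by apply: open_setX; [exact: wa_open wA _ _ _ _|exact: wa_open wB _ _ _ _].
- move=> _ _ [c [d [Ac Bd ->]]] [c' [d' [Ac' Bd' ->]]].
  have [s1 s2] := wa_compatible wA Ac Ac'; have [s3 s4] := wa_compatible wB Bd Bd'.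
  split; [apply: compatible_prod => //|rewrite setIC; apply: compatible_prod => //; rewrite setIC//].
  + exact: wa_open wA _ _ _ _.
  + exact: wa_open wB _ _ _ _.
  + by rewrite setIC; exact: wa_open wA _ _ _ _.
  + by rewrite setIC; exact: wa_open wB _ _ _ _.
Qed.

(** The part of a manifold structure that passes to products: a product of maximal atlases is not
    maximal. *)
Definition charted (T : topologicalType) E (A : set (chart T E)) : Prop :=
  [/\ (forall c, A c -> is_chart c),
      (forall p, exists2 c, A c & cdom c p) &
      (forall c d, A c -> A d -> compatible c d)].

Lemma chart_open_image (T : topologicalType) E (c : chart T E) (O : set T) :
  is_chart c -> open O -> open (cmap c @` (cdom c `&` O)).
Proof.
move=> [oc oi cK cc ci] oO.
rewrite (_ : _ @` _ = (cmap c @` cdom c) `&` cinv c @^-1` O).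
  by apply: open_preimage_in => // _ [p cp <-]; exact: ci.
apply/seteqP; split=> [_ [p [cp Op] <-]|_ [[p cp <-]]].
  by split; [exists p|rewrite /preimage/= cK].
by rewrite /preimage/= cK// => Op; exists p.
Qed.

Lemma charted_weak (T : topologicalType) E (A : set (chart T E)) :
  charted A -> weak_atlas A.
Proof.
move=> [h _ hc]; split=> [c p /h[_ _ cK _ _]|c d Ac Ad|//]; first exact: cK.
by apply: chart_open_image; [exact: h|have [] := h _ Ad].
Qed.

Lemma smooth_map_restrict (T : topologicalType) (T' : Type) E F (A : set (chart T E))
  (B : set (chart T' F)) (D D' : set T) f : charted A -> open D' -> D' `<=` D ->
  smooth_map A B D f -> smooth_map A B D' f.
Proof.
move=> chA oD' sD sf p D'p; have wA := charted_weak chA.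
have [c [d [W [[Ac Bd] cp [oW Wp] sW sfW]]]] := sf p (sD _ D'p).
have ic : is_chart c by have [h _ _] := chA; exact: h.
exists c, d, (W `&` cmap c @` (cdom c `&` D')); split=> //.
- split; last by split=> //; exists p.
  by apply: openI => //; exact: chart_open_image.
- move=> _ [/sW[q [[cq Dq] dq] <-] [q' [cq' D'q'] /(congr1 (cinv c))]].
  by rewrite !(wa_cancel wA Ac)// => e; subst q'; exists q.
- by apply: smooth_on_sub sfW => x [].
Qed.

Lemma smooth_map_continuous (T T' : topologicalType) E F (A : set (chart T E))
  (B : set (chart T' F)) D f p : charted A -> charted B ->
  smooth_map A B D f -> D p -> {for p, continuous f}.
Proof.
move=> chA chB sf Dp; have wA := charted_weak chA; have wB := charted_weak chB.
have [c [d [W [[Ac Bd] cp [oW Wp] sW sfW]]]] := sf p Dp.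
have [icd _ cK cc _] : is_chart c by have [h _ _] := chA; exact: h.
have [_ _ dK _ di] : is_chart d by have [h _ _] := chB; exact: h.
have WP q : cdom c q -> W (cmap c q) -> cdom d (f q).
  by move=> cq /sW[r [[cr _] dr] /(congr1 (cinv c))]; rewrite !cK// => <-.
have dfp := WP _ cp Wp.
apply: (@continuous_near_eq _ _ (cinv d \o ((cmap d \o f \o cinv c) \o cmap c))).
  apply: (@near_open _ (cdom c `&` cmap c @^-1` W)).
  - exact: open_preimage_in.
  - by [].
  - by move=> q [cq Wq] /=; rewrite cK// dK//; exact: WP.
apply: continuous_comp.
  by apply: continuous_comp; [exact: cc|exact: smooth_on_continuous sfW Wp].
by rewrite /= cK//; exact: di.
Qed.

Lemma is_chart_prod (T T' : topologicalType) E F (c : chart T E) (d : chart T' F) :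
  is_chart c -> is_chart d -> is_chart (prod_chart c d).
Proof.
move=> [oc oic cK cc ci] [od oid dK dc di]; split.
- exact: open_setX.
- by rewrite prod_chart_image; exact: open_setX.
- by move=> [p q] [/= cp dq]; rewrite cK// dK.
- move=> [p q] [/= cp dq].
  have h1 : {for (p, q), continuous (cmap c \o @fst T T')}.
    by apply: continuous_comp; [exact: cvg_fst|exact: cc].
  have h2 : {for (p, q), continuous (cmap d \o @snd T T')}.
    by apply: continuous_comp; [exact: cvg_snd|exact: dc].
  exact: (cvg_pair h1 h2).
- move=> [p q] [/= cp dq].
  have h1 : {for (cmap c p, cmap d q), continuous (cinv c \o @fst E F)}.
    by apply: continuous_comp; [exact: cvg_fst|exact: ci].
  have h2 : {for (cmap c p, cmap d q), continuous (cinv d \o @snd E F)}.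
    by apply: continuous_comp; [exact: cvg_snd|exact: di].
  exact: (cvg_pair h1 h2).
Qed.

Lemma charted_prod (T T' : topologicalType) E F (A : set (chart T E)) (B : set (chart T' F)) :
  finite_coordinates E -> finite_coordinates F ->
  charted A -> charted B -> charted (prod_atlas A B).
Proof.
move=> cE cF chA chB.
have [_ _ wAB] := weak_atlas_prod cE cF (charted_weak chA) (charted_weak chB).
have [hA kA _] := chA; have [hB kB _] := chB; split=> //.
  by move=> _ [c [d [Ac Bd ->]]]; apply: is_chart_prod; [exact: hA|exact: hB].
move=> [p q]; have [c Ac cp] := kA p; have [d Bd dq] := kB q.
by exists (prod_chart c d) => //; exists c, d.
Qed.

Lemma charted_real : charted (real_atlas R).
Proof.
split.
- move=> _ ->; split=> //=; [exact: openT| |by move=> *; exact: cvg_id|by move=> *; exact: cvg_id].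
  by rewrite image_id; exact: openT.
- by move=> p; exists (id_chart R).
- by move=> _ _ -> ->; split=> k; apply: (@Ck_linear _ _ R^o R^o _ idfun) => x; exact: cvg_id.
Qed.

Lemma smooth_manifold_charted n (T : topologicalType) (A : set (chart T 'rV[R]_n)) :
  smooth_manifold A -> charted A.
Proof.
by move=> hM; split; [exact: sm_chart hM|exact: sm_cover hM|exact: sm_compatible hM].
Qed.

Lemma smooth_map_fst (T T' : topologicalType) E F (A : set (chart T E))
  (B : set (chart T' F)) : finite_coordinates E -> finite_coordinates F ->
  charted A -> charted B -> smooth_map (prod_atlas A B) A setT fst.
Proof.
move=> cE cF chA chB [p q] _; have [hA kA _] := chA; have [hB kB _] := chB.
have [c Ac cp] := kA p; have [d Bd dq] := kB q.
have [oc oic cK _ _] := hA _ Ac; have [od oid dK _ _] := hB _ Bd.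
exists (prod_chart c d), c, (cmap (prod_chart c d) @` cdom (prod_chart c d)).
have oo : open (cmap (prod_chart c d) @` cdom (prod_chart c d)).
  by rewrite prod_chart_image; exact: open_setX.
split=> //.
- by split=> //; exists c, d.
- by split=> //; exists (p, q).
- by move=> _ [[x y] [/= cx dy] <-]; exists (x, y).
- apply: smooth_on_ext (smooth_on_fst _) => //.
  by move=> _ [[x y] [/= cx dy] <-] /=; rewrite cK.
Qed.

Lemma smooth_map_snd (T T' : topologicalType) E F (A : set (chart T E))
  (B : set (chart T' F)) : finite_coordinates E -> finite_coordinates F ->
  charted A -> charted B -> smooth_map (prod_atlas A B) B setT snd.
Proof.
move=> cE cF chA chB [p q] _; have [hA kA _] := chA; have [hB kB _] := chB.
have [c Ac cp] := kA p; have [d Bd dq] := kB q.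
have [oc oic cK _ _] := hA _ Ac; have [od oid dK _ _] := hB _ Bd.
exists (prod_chart c d), d, (cmap (prod_chart c d) @` cdom (prod_chart c d)).
have oo : open (cmap (prod_chart c d) @` cdom (prod_chart c d)).
  by rewrite prod_chart_image; exact: open_setX.
split=> //.
- by split=> //; exists c, d.
- by split=> //; exists (p, q).
- by move=> _ [[x y] [/= cx dy] <-]; exists (x, y).
- apply: smooth_on_ext (smooth_on_snd _) => //.
  by move=> _ [[x y] [/= cx dy] <-] /=; rewrite dK.
Qed.

Lemma smooth_map_id (T : topologicalType) E (A : set (chart T E)) :
  charted A -> smooth_map A A setT id.
Proof.
move=> [hA kA hc] p _; have [c Ac cp] := kA p; have [oc oic cK _ _] := hA _ Ac.
exists c, c, (cmap c @` cdom c); split=> //.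
- by move=> _ [q cq <-]; exists q.
- by have [s _] := hc _ _ Ac Ac; rewrite setIid in s.
Qed.

Lemma smooth_map_cst (T T' : topologicalType) E F (A : set (chart T E))
  (B : set (chart T' F)) (q : T') : 
  charted A -> charted B -> smooth_map A B setT (fun=> q).
Proof.
move=> [hA kA _] [hB kB _] p _; have [c Ac cp] := kA p; have [d Bd dq] := kB q.
have [oc oic cK _ _] := hA _ Ac.
exists c, d, (cmap c @` cdom c); split=> //.
- by move=> _ [x cx <-]; exists x.
- by move=> k; exact: Ck_cst.
Qed.

Lemma smooth_map_real_fun (f : R^o -> R^o) :
  smooth_on setT f -> smooth_map (real_atlas R) (real_atlas R) setT f.
Proof.
move=> sf p _; exists (id_chart R), (id_chart R), setT; split=> //.
- by split=> //; exact: openT.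
- by move=> y _; exists y.
Qed.

Lemma smooth_map_real_fun2 (f : R^o * R^o -> R^o) : smooth_on setT f ->
  smooth_map (prod_atlas (real_atlas R) (real_atlas R)) (real_atlas R) setT f.
Proof.
move=> sf [p q] _; exists (prod_chart (id_chart R) (id_chart R)), (id_chart R), setT; split=> //.
- by split=> //; exists (id_chart R), (id_chart R).
- by split=> //; exact: openT.
- by move=> [x y] _; exists (x, y).
- apply: smooth_on_ext sf; first exact: openT.
  by move=> [x y].
Qed.

End SmoothMaps.


(** * A smooth step function *)

Section SmoothStep.
Variable R : realType.

Lemma Ck_real k (U : set R^o) (f df : R^o -> R^o) : open U ->
  (forall x, U x -> is_derive x (1 : R^o) f (df x)) -> Ck k U df -> Ck k.+1 U f.
Proof.
move=> oU fd cd.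
have dfx x : U x -> differentiable f x.
  by move=> /fd[? _]; exact/derivable1_diffP.
split=> // v.
apply: (@Ck_ext _ _ _ _ _ (fun x => (v : R^o) *: df x)) => //.
  move=> x Ux; rewrite (deriveE _ (dfx _ Ux)) -[v in RHS]mulr1.
  rewrite -[v * 1]/((v : R) *: (1 : R^o)) linearZ /= -(deriveE _ (dfx _ Ux)).
  by have [_ ->] := fd _ Ux.
by apply: Ck_scale => //; exact: Ck_cst.
Qed.

(** The parameter [m] makes the family stable under differentiation: the derivative of the [m]-th
    function is a combination of those of index [m.+1] and [m.+2], so a single induction on [k]
    reaches all derivatives. *)
Definition flat_fun (m : nat) (x : R) : R :=
  if 0 < x then x^-1 ^+ m * expR (- x^-1) else 0.

Lemma flat_fun_le0 m x : x <= 0 -> flat_fun m x = 0.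
Proof. by rewrite /flat_fun ltNge => ->. Qed.

Lemma flat_fun_ge0 m x : 0 <= flat_fun m x.
Proof.
rewrite /flat_fun; case: ifP => // x0.
by rewrite mulr_ge0 ?expR_ge0// exprn_ge0// invr_ge0 ltW.
Qed.

(** With [y = x^-1] this is the inequality between [expR y] and the term of degree [m.+2] of its
    series. The square makes the difference quotient at 0 tend to 0. *)
Lemma flat_fun_bound m x : 0 <= flat_fun m x <= m.+2`!%:R * x ^+ 2.
Proof.
rewrite flat_fun_ge0 /=; have [x0|x0] := ltP 0 x; last first.
  by rewrite flat_fun_le0// mulr_ge0// sqr_ge0.
rewrite /flat_fun x0; set y := x^-1; have y0 : 0 < y by rewrite invr_gt0.
have -> : x = y^-1 by rewrite invrK.
rewrite expRN ler_pdivrMr ?expR_gt0//.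
rewrite -(@ler_pM2l _ (y ^+ 2)); last by rewrite exprn_gt0.
have -> : y ^+ 2 * (m.+2`!%:R * y^-1 ^+ 2 * expR y) = m.+2`!%:R * expR y.
  by field; rewrite gt_eqF.
rewrite -exprD add2n -ler_pdivrMl ?ltr0n ?fact_gt0// mulrC.
by apply: le_trans (expR_ge1Dxn m.+1 (ltW y0)); rewrite lerDr.
Qed.

Lemma is_derive_flat_fun m (x : R^o) :
  is_derive x (1 : R^o) (flat_fun m : R^o -> R^o)
    (flat_fun m.+2 x - m%:R * flat_fun m.+1 x).
Proof.
have [x0|x0|x0] := ltgtP 0 x; last rewrite -{}x0.
- pose f : R -> R := (fun x : R => x^-1 ^+ m) * (expR \o (fun x : R => - x^-1)).
  apply: (@near_eq_is_derive _ _ _ f).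
    apply: near_open (@open_gt R 0) _ _ => //= y y0.
    by rewrite /flat_fun y0.
  have xn0 : x != 0 by rewrite gt_eqF.
  have d0 : is_derive (x : R) 1 (fun x : R => x^-1) (- x^-1 ^+ 2).
    apply: is_derive_eq (is_deriveV (f := id) xn0 (is_derive_id (x : R) 1)) _.
    by rewrite exprVn /GRing.scale/= mulr1.
  have d1 : is_derive (x : R) 1 (fun x : R => - x^-1) (x^-1 ^+ 2).
    by apply: is_derive_eq (is_deriveN d0) _; rewrite opprK.
  have d2 : is_derive (x : R) 1 (expR \o (fun x : R => - x^-1)) (expR (- x^-1) * x^-1 ^+ 2).
    exact: is_derive1_comp.
  have d3 : is_derive (x : R) 1 (fun x : R => x^-1 ^+ m) (- m%:R * x^-1 ^+ m.+1).
    have -> : (fun x : R => x^-1 ^+ m) = (fun x : R => x^-1) ^+ m.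
      by rewrite exprfctE.
    apply: is_derive_eq (is_deriveX m d0) _.
    case: m {f} => [|m]; first by rewrite mul0r scale0r oppr0 mul0r.
    by rewrite /GRing.scale/= mulNr mulrN -mulrA -exprD addn2.
  apply: is_derive_eq (is_deriveM d3 d2) _.
  rewrite /flat_fun x0 /GRing.scale/= !exprS.
  ring.
- apply: (@near_eq_is_derive _ _ _ (cst 0)).
    apply: near_open (@open_lt R 0) _ _ => //= y y0.
    by rewrite flat_fun_le0// ltW.
  apply: is_derive_eq.
  by rewrite !flat_fun_le0 ?ltW// mulr0 subr0.
- rewrite !flat_fun_le0// mulr0 subr0.
  have l : (h^-1 *: (flat_fun m (h *: (1 : R^o) + 0) - flat_fun m 0)) @[h --> (0 : R^o)^'] --> (0 : R^o).
    apply/cvgrPdist_le => /= e e0; near=> h.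
    have h0 : h != 0 by near: h; exact: nbhs_dnbhs_neq.
    rewrite sub0r normrN (flat_fun_le0 m (lexx 0)) subr0 addr0 normrZ [_%:A]mulr1 normfV ler_pdivrMl ?normr_gt0//.
    have /andP[b0 b1] := flat_fun_bound m h.
    rewrite ger0_norm//; apply: (le_trans b1).
    have -> : h ^+ 2 = `|h| * `|h| by rewrite -normrM -expr2 ger0_norm ?sqr_ge0.
    rewrite mulrCA ler_pM2l ?normr_gt0// -ler_pdivlMl ?ltr0n ?fact_gt0//.
    by near: h; apply: dnbhs0_le; rewrite mulr_gt0// invr_gt0 ltr0n fact_gt0.
  apply: DeriveDef; first by apply/cvg_ex; exists 0.
  exact: cvg_lim.
Unshelve. all: by end_near. Qed.

Lemma Ck_flat_fun k m : Ck k setT (flat_fun m : R^o -> R^o).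
Proof.
elim: k m => [|k IH] m.
  move=> x _; apply/differentiable_continuous/derivable1_diffP.
  by have [] := is_derive_flat_fun m x.
apply: (@Ck_real _ _ _ (fun x : R^o => flat_fun m.+2 x - m%:R * flat_fun m.+1 x)); first exact: openT.
  by move=> x _; exact: is_derive_flat_fun.
apply: (@Ck_ext _ _ _ _ _ ((flat_fun m.+2 : R^o -> R^o) \+
    (fun x : R^o => (- m%:R : R^o) *: (flat_fun m.+1 x : R^o)))); first exact: openT.
  by move=> x _ /=; rewrite /GRing.scale/= mulNr.
apply: Ck_add; [exact: openT|exact: IH|].
by apply: Ck_scale; [exact: openT|exact: Ck_cst|exact: IH].
Qed.

Lemma Ck_inv k : Ck k [set x : R^o | x != 0] (fun x : R^o => x^-1 : R^o).
Proof.
have oU : open [set x : R^o | x != 0].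
  rewrite (_ : mkset _ = ~` [set 0]).
    by apply: closed_openC; exact: closed_eq.
  by apply/seteqP; split=> x /eqP.
have d (x : R) : x != 0 -> is_derive x 1 (fun x : R => x^-1) (- x^-1 * x^-1).
  move=> x0; apply: is_derive_eq (is_deriveV (f := id) x0 (is_derive_id x 1)) _.
  by rewrite /GRing.scale/= mulr1 expr2 invfM mulNr.
elim: k => [|k IH].
  move=> x x0; apply/differentiable_continuous/derivable1_diffP.
  by have [] := d x x0.
apply: (@Ck_real _ _ _ (fun x : R^o => - x^-1 * x^-1)) => //.
apply: (@Ck_ext _ _ _ _ _ (fun x : R^o => (-1 : R^o) *: ((x^-1 : R^o) *: (x^-1 : R^o)))) => //.
  by move=> x _; rewrite /GRing.scale/= mulN1r mulNr.
by apply: Ck_scale => //; [exact: Ck_cst|exact: Ck_scale].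
Qed.

(** The step rises between 0 and 1; the phi of the overview is its translate [smooth_step (r - 1)].
    The denominator is positive because [x] and [1 - x] are never both nonpositive. *)
Definition smooth_step (x : R) : R :=
  flat_fun 0 x * (flat_fun 0 x + flat_fun 0 (1 - x))^-1.

Lemma flat_fun_gt0 x : 0 < x -> 0 < flat_fun 0 x.
Proof. by move=> x0; rewrite /flat_fun x0 expr0 mul1r expR_gt0. Qed.

Lemma smooth_step_den x : 0 < flat_fun 0 x + flat_fun 0 (1 - x).
Proof.
have [x0|x0] := ltP 0 x; first by rewrite ltr_wpDr ?flat_fun_ge0// flat_fun_gt0.
by rewrite ltr_wpDl ?flat_fun_ge0// flat_fun_gt0// subr_gt0 (le_lt_trans x0).
Qed.

Lemma smooth_step0 x : x <= 0 -> smooth_step x = 0.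
Proof. by move=> x0; rewrite /smooth_step flat_fun_le0// mul0r. Qed.

Lemma smooth_step1 x : 1 <= x -> smooth_step x = 1.
Proof.
move=> x1; rewrite /smooth_step [flat_fun 0 (1 - x)]flat_fun_le0 ?subr_le0// addr0 divff//.
by rewrite gt_eqF// flat_fun_gt0// (lt_le_trans ltr01).
Qed.

Lemma smooth_step_itv x : 0 <= smooth_step x <= 1.
Proof.
have d := smooth_step_den x; rewrite /smooth_step; apply/andP; split.
  by rewrite mulr_ge0 ?flat_fun_ge0// invr_ge0 ltW.
by rewrite ler_pdivrMr// mul1r lerDl flat_fun_ge0.
Qed.

Lemma smooth_on_real_id U : smooth_on U (fun x : R^o => x).
Proof. by apply: (@smooth_on_linear R R^o R^o U idfun) => x; exact: cvg_id. Qed.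

Lemma smooth_on_smooth_step : smooth_on setT (smooth_step : R^o -> R^o).
Proof.
move=> k; have cR := finite_coordinates_real R.
have c1 : Ck k setT (fun x : R^o => flat_fun 0 (1 - x) : R^o).
  apply: (@Ck_comp _ _ _ _ _ setT setT (flat_fun 0 : R^o -> R^o)) => //; [exact: openT| |exact: Ck_flat_fun].
  apply: (@Ck_ext _ _ _ _ _ ((fun=> 1 : R^o) \+ (fun x : R^o => (-1 : R^o) *: x))); first exact: openT.
    by move=> x _; rewrite /= scaleN1r.
  apply: Ck_add; [exact: openT|exact: Ck_cst|].
  apply: Ck_scale; [exact: openT|exact: Ck_cst|exact: smooth_on_real_id].
apply: (@Ck_scale R k R^o R^o setT); [exact: openT|exact: Ck_flat_fun|].
apply: (@Ck_comp _ _ R^o R^o R^o setT [set x : R^o | x != 0] (fun x : R^o => x^-1 : R^o)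
  (fun x : R^o => flat_fun 0 x + flat_fun 0 (1 - x))) => //.
- exact: openT.
- by move=> x _; rewrite /= gt_eqF// smooth_step_den.
- by apply: Ck_add; [exact: openT|exact: Ck_flat_fun|exact: c1].
- exact: Ck_inv.
Qed.

End SmoothStep.

(** * Gronwall's lemma *)

Section Gronwall.
Variables (R : realType) (n : nat).
Local Notation E := 'rV[R]_n.

Lemma coord_le_norm (v : E) j : `|v 0 j| <= `|v|.
Proof.
rewrite [leRHS]/Num.Def.normr/= mx_normrE.
by apply: le_trans; last exact: (le_bigmax _ _ (ord0, j)).
Qed.

Lemma norm_le_coord (v : E) (b : R) : 0 <= b -> (forall j, `|v 0 j| <= b) -> `|v| <= b.
Proof.
move=> b0 h; rewrite /Num.Def.normr/= mx_normrE.
by apply: bigmax_le => // -[i j] _; rewrite (ord1 i) h.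
Qed.

(** By continuity the partial derivatives exceed their absolute values at [x0] by at most 1 on a
    small ball. The ball is convex, so the mean value theorem applies along the segment from [y] to
    [x], and the derivative in the direction [x - y] is expanded in partial derivatives. *)
Lemma C1_locally_lipschitz (U : set E) (f : E -> R^o) x0 : open U -> U x0 -> Ck 1 U f ->
  exists r L : R, [/\ 0 < r, 0 <= L & forall x y, ball x0 r x -> ball x0 r y ->
    `|f x - f y| <= L * `|x - y|].
Proof.
move=> oU Ux0 [df cf].
pose K (i : 'I_n) : R := `|'D_(delta_mx 0 i) f x0| + 1.
have nearK : \forall x \near x0, U x /\ forall i : 'I_n, `|'D_(delta_mx 0 i) f x| <= K i.
  apply: filterI; first exact: open_nbhs_nbhs.
  have h (i : 'I_n) : \forall x \near x0, `|'D_(delta_mx 0 i) f x| <= K i.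
    have : {for x0, continuous ('D_(delta_mx 0 i) f)} by exact: cf.
    move=> /cvgrPdist_le /(_ 1 ltr01); apply: filterS => x h.
    rewrite /K -lerBlDl; apply: le_trans (lerB_dist _ _) _.
    by rewrite distrC.
  exact: (@filter_forall _ 'I_n _ (nbhs x0) _ h).
have /nbhs_ballP[r /= r0 rK] := nearK.
exists r, (\sum_i K i); split=> //.
  by apply: sumr_ge0 => i _; rewrite addr_ge0.
move=> x y bx bby.
pose g (t : R) : E := t *: (x - y) + y.
have gb t : t \in `[0, 1] -> ball x0 r (g t).
  rewrite in_itv/= => /andP[t0 t1].
  move: bx bby; rewrite -!ball_normE /= => bx bby.
  have -> : x0 - g t = t *: (x0 - x) + (1 - t) *: (x0 - y).
    by apply/rowP => j; rewrite !mxE; ring.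
  apply: (le_lt_trans (ler_normD _ _)); rewrite !normrZ ger0_norm// (ger0_norm (x := 1 - t)) ?subr_ge0//.
  have [->|tn0] := eqVneq t 0; first by rewrite mul0r add0r subr0 mul1r.
  have tgt : 0 < t by rewrite lt_neqAle eq_sym tn0.
  apply: (@lt_le_trans _ _ (t * r + (1 - t) * r)).
    apply: ltr_leD; first by rewrite ltr_pM2l.
    by rewrite ler_wpM2l ?subr_ge0// ltW.
  by rewrite -mulrDl addrC subrK mul1r.
have gdiffD (t : R^o) : differentiable (g : R^o -> E) t /\ 'D_1 (g : R^o -> E) t = x - y.
  have [d1 d2] := @is_diff_scale R R^o E (fun s => s) (cst (x - y)) t
    (@ex_diff _ _ _ _ _ _ _ (is_diff_id t)) (differentiable_cst _ _).
  have dy : differentiable (cst y : R^o -> E) t by exact: differentiable_cst.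
  split; first exact: (differentiableD d1 dy).
  have := deriveD (@diff_derivable _ _ _ _ _ (1 : R^o) d1) (@diff_derivable _ _ _ _ _ (1 : R^o) dy).
  rewrite d2 derive_id !derive_cst scaler0 !addr0 => e.
  by rewrite -[RHS]scale1r; exact: e.
have gdiff t := (gdiffD t).1.
have gd (t : R) : t \in `[0, 1] ->
    is_derive (t : R^o) (1 : R^o) (f \o g : R^o -> R^o) ('D_(x - y) f (g t)).
  move=> t01; have dfg := df _ (rK _ (gb _ t01)).1.
  apply: DeriveDef; first exact/derivable1_diffP/differentiable_comp.
  by rewrite (derive_comp _ (gdiff t) dfg) (gdiffD t).2.
have d1 t : t \in `]0, 1[%R -> is_derive (t : R) 1 (f \o g : R -> R) ('D_(x - y) f (g t)).
  by move=> t01; apply: gd; exact: subset_itv_oo_cc t01.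
have c1 : {within `[0, 1], continuous (f \o g : R -> R)}.
  apply: continuous_in_subspaceT => t; rewrite inE => t01.
  by apply/differentiable_continuous/derivable1_diffP; have [] := gd t t01.
have [c c01] := MVT_segment ler01 d1 c1.
rewrite subr0 mulr1 /= /g scale1r scale0r add0r subrK => ->.
rewrite -/(g c); have [Uz Kz] := rK _ (gb _ c01).
rewrite (deriveE _ (df _ Uz)) [in 'd _ _ _](row_sum_delta (x - y)) linear_sum.
rewrite mulr_suml; apply: le_trans (ler_norm_sum _ _ _) _; apply: ler_sum => i _.
rewrite linearZ /= normrM mulrC -(deriveE _ (df _ Uz)).
by apply: ler_pM => //; exact: coord_le_norm.
Qed.

(** On a short interval around [t0] the maximum of the norm of [h] is at most half of itself: the
    mean value theorem bounds each coordinate of [h] by [L] times this maximum times the half-length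
    [d], and [L * d <= 1/2]. *)
Lemma gronwall_vanishing (h dh : R -> E) (t0 L : R) : 0 <= L ->
  (\forall t \near t0, is_derive (t : R^o) (1 : R^o) (h : R^o -> E) (dh t)) ->
  (\forall t \near t0, forall j, `|dh t 0 j| <= L * `|h t|) ->
  h t0 = 0 -> \forall t \near t0, h t = 0.
Proof.
move=> L0 hd hb h0.
have /nbhs_ballP[r /= r0 rP] : \forall t \near t0,
    is_derive (t : R^o) (1 : R^o) (h : R^o -> E) (dh t) /\
    forall j, `|dh t 0 j| <= L * `|h t| by exact: filterI.
(* [r / 2] keeps the closed interval inside the open ball of radius [r]; the other bound gives
   [L * d <= 1/2], with [L + 1] in place of [L] to allow [L = 0]. *)
pose d := Num.min (r / 2) (2 * (L + 1))^-1.
have L1 : 0 < L + 1 by rewrite ltr_wpDl.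
have d0 : 0 < d by rewrite lt_min divr_gt0//= invr_gt0 mulr_gt0.
have Ld : L * d <= 2^-1.
  apply: (@le_trans _ _ (L * (2 * (L + 1))^-1)).
    by rewrite ler_wpM2l// ge_min lexx orbT.
  by rewrite invfM mulrCA ler_piMr ?invr_ge0// ler_pdivrMr// mul1r lerDl.
have inb t : t \in `[t0 - d, t0 + d] -> ball t0 r t.
  rewrite in_itv/= -ler_distlC => td.
  rewrite -ball_normE /=; apply: (le_lt_trans td).
  by rewrite (@le_lt_trans _ _ (r / 2))// ?ge_min ?lexx// ltr_pdivrMr// ltr_pMr// ltr1n.
have ld : t0 - d <= t0 + d by rewrite lerBlDr -addrA lerDl addr_ge0 ?ltW.
have t0in : t0 \in `[t0 - d, t0 + d].
  by rewrite in_itv/= lerBlDr lerDl !ltW.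
have hc t : ball t0 r t -> {for t, continuous h}.
  by move=> /rP[[/derivable1_diffP dht _] _]; exact: (differentiable_continuous dht).
have [c cin cmax] : exists2 c, c \in `[t0 - d, t0 + d] &
    forall t, t \in `[t0 - d, t0 + d] -> `|h t| <= `|h c|.
  apply: (@EVT_max R (fun t => `|h t|)) => //.
  apply: continuous_in_subspaceT => t; rewrite inE => /inb /hc ct.
  by apply: continuous_comp => //; exact: norm_continuous.
have S0 : `|h c| <= `|h c| / 2.
  apply: norm_le_coord => [|j]; first by rewrite divr_ge0.
  pose hj (t : R) : R := h t 0 j.
  have hjd t : t \in `[t0 - d, t0 + d] -> is_derive (t : R) 1 hj (dh t 0 j).
    move=> /inb/rP[[hdt hdE] _].
    have dht : differentiable (h : R^o -> E) (t : R^o) by exact/derivable1_diffP.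
    apply: DeriveDef.
      apply/derivable1_diffP.
      apply: (@differentiable_comp _ R^o E R^o h (@rV_coord R n j)) => //.
      by apply: linear_differentiable; exact: rV_coord_continuous.
    rewrite -hdE; apply: (@derive_linear_comp R R^o E R^o (@rV_coord R n j) h) => //.
    exact: rV_coord_continuous.
  have mv a b : a \in `[t0 - d, t0 + d] -> b \in `[t0 - d, t0 + d] -> a <= b ->
      `|hj b - hj a| <= L * `|h c| * (b - a).
    move=> ain bin ab.
    have sub t : t \in `[a, b] -> t \in `[t0 - d, t0 + d].
      move: ain bin; rewrite !in_itv /= => /andP[a1 _] /andP[_ b2] /andP[t1 t2].
      by rewrite (le_trans a1)//= (le_trans t2).
    have d1 t : t \in `]a, b[%R -> is_derive (t : R) 1 hj (dh t 0 j).
      by move=> tin; apply: hjd; apply: sub; exact: subset_itv_oo_cc tin.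
    have c1 : {within `[a, b], continuous hj}.
      apply: continuous_in_subspaceT => t; rewrite inE => tin.
      by apply/differentiable_continuous/derivable1_diffP; have [] := hjd t (sub _ tin).
    have [z zin ->] := MVT_segment ab d1 c1.
    rewrite normrM [`|b - a|]ger0_norm ?subr_ge0// ler_wpM2r ?subr_ge0//.
    have [_ hz] := rP _ (inb _ (sub _ zin)).
    by apply: le_trans (hz j) _; rewrite ler_wpM2l// cmax// sub.
  have hj0 : hj t0 = 0 by rewrite /hj h0 mxE.
  have D : `|hj c| <= L * `|h c| * d.
    have := cin; rewrite in_itv /= => /andP[c1 c2].
    have [tc|tc] := leP t0 c.
      have := mv _ _ t0in cin tc; rewrite hj0 subr0 => /le_trans; apply.
      by rewrite ler_wpM2l ?mulr_ge0// lerBlDl.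
    have := mv _ _ cin t0in (ltW tc); rewrite hj0 sub0r normrN => /le_trans; apply.
    by rewrite ler_wpM2l ?mulr_ge0// lerBlDl -lerBlDr.
  apply: le_trans D _; rewrite mulrAC mulrC ler_wpM2l//.
have hc0 : `|h c| = 0.
  apply/eqP; rewrite eq_le normr_ge0 andbT.
  move: S0; rewrite ler_pdivlMr// mulr_natr mulr2n -subr_ge0 opprD addNKr => ?.
  by rewrite -oppr_ge0.
apply/nbhs_ballP; exists d => //= t; rewrite -ball_normE /= => td.
have tin : t \in `[t0 - d, t0 + d] by rewrite in_itv/= -ler_distlC ltW.
by apply/eqP; rewrite -normr_le0 -hc0 cmax.
Qed.

End Gronwall.


(** * The normal bundle and its atlas *)

Section NormalBundle.
Variables (R : realType) (n : nat) (T : topologicalType).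
Variable A : set (chart T 'rV[R]_n).
Hypothesis chA : charted A.
Variables (N : set T) (k : nat).
Local Notation E := 'rV[R]_n.
Local Notation tangent := (tangent A).
Local Notation slice_chart := (slice_chart A N k).
Local Notation tangent_sub := (tangent_sub A N k).
Local Notation ncoset := (ncoset A N k).
Local Notation nu := (nu A N k).
Local Notation nzero := (nzero A N k).
Local Notation nscale := (nscale A N k).
Local Notation nu_chart := (nu_chart A N k).
Local Notation nu_atlas := (nu_atlas A N k).

(** Serves for the transition maps of the normal bundle: their fibre part is the derivative of a
    transition map of [T] in a direction that varies with the point. *)
Lemma smooth_on_directional (E1 F H : normedModType R) (U : set E1) (V : set F)
  (f g : E1 -> F) (tau : F -> H) : finite_coordinates F -> open U ->
  (forall x, U x -> V (f x)) ->
  smooth_on U f -> smooth_on U g -> smooth_on V tau ->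
  smooth_on U (fun y => 'D_(g y) tau (f y)).
Proof.
move=> cF oU UV sf sg st; have [m [e [c [cc ce]]]] := cF.
apply: (@smooth_on_ext _ _ _ _ (fun x => \sum_i c i (g x) *: ('D_(e i) tau \o f) x)) => //.
  move=> x Ux; have [dt _] := st 1%N; have dtx := dt _ (UV _ Ux).
  rewrite (deriveE _ dtx) [in RHS](ce (g x)) linear_sum; apply: eq_bigr => i _ /=.
  by rewrite linearZ/= (deriveE _ dtx).
move=> l; apply: Ck_sum => // i; apply: Ck_scale => //.
  exact: (@Ck_linear_comp _ _ _ _ _ _ (c i)).
apply: Ck_comp (sf l) _ => //; first exact: UV.
by have [_] := st l.+1; exact.
Qed.

Lemma chartK c p : A c -> cdom c p -> cinv c (cmap c p) = p.
Proof. by move=> Ac cp; exact: (wa_cancel (charted_weak chA)). Qed.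

Lemma transition_differentiable c d p : A c -> A d -> cdom c p -> cdom d p ->
  differentiable (cmap d \o cinv c) (cmap c p).
Proof.
move=> Ac Ad cp dp; have [_ _ hc] := chA; have [s _] := hc _ _ Ac Ad.
by have [h _] := s 1%N; apply: h; exists p.
Qed.

Lemma near_overlap c d p : A c -> A d -> cdom c p -> cdom d p ->
  \forall y \near cmap c p, exists q, [/\ y = cmap c q, cdom c q & cdom d q].
Proof.
move=> Ac Ad cp dp.
apply: near_open (wa_open (charted_weak chA) Ac Ad) _ _; first by exists p.
by move=> _ [q [cq dq] <-]; exists q.
Qed.

Lemma tvec_of_tangent c p a : A c -> cdom c p -> tangent p (tvec_of A c p a).
Proof.
move=> Ac cp; split=> [d Nd|d e Ad Ae dp ep].
  by rewrite /tvec_of; case: asboolP.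
rewrite /tvec_of; case: asboolP => [_|[]//]; case: asboolP => [_|[]//].
have := @derive_comp _ _ _ _ (cmap e \o cinv d) (cmap d \o cinv c) (cmap c p) a.
move=> /=; rewrite (chartK Ac cp) => <-.
- apply: near_eq_derive; have := near_overlap Ac Ad cp dp.
  by apply: filterS => _ [q [-> cq dq]] /=; rewrite chartK// chartK.
- exact: transition_differentiable.
- exact: transition_differentiable.
Qed.

Lemma tvec_of_val c d p a : A c -> A d -> cdom c p -> cdom d p ->
  tvec_of A c p a d = 'D_a (cmap d \o cinv c) (cmap c p).
Proof. by move=> Ac Ad cp dp; rewrite /tvec_of; case: asboolP => // -[]. Qed.

Lemma tvec_of_self c p a : A c -> cdom c p -> tvec_of A c p a c = a.
Proof.
move=> Ac cp; rewrite tvec_of_val//.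
rewrite (@near_eq_derive _ _ _ _ id); first by rewrite derive_id.
by have := near_overlap Ac Ac cp cp; apply: filterS => _ [q [-> cq _]] /=; rewrite chartK.
Qed.

Lemma tangent_val p v c d : tangent p v -> A c -> A d -> cdom c p -> cdom d p ->
  v d = 'D_(v c) (cmap d \o cinv c) (cmap c p).
Proof. by move=> [_ h] *; exact: h. Qed.

Lemma tangent_lin p (a : R) v w : tangent p v -> tangent p w -> tangent p (a *: v + w).
Proof.
move=> [v0 tv] [w0 tw]; split=> [c Nc|c d Ac Ad cp dp].
  by rewrite -[LHS]/(a *: v c + w c) v0// w0// scaler0 addr0.
have df := transition_differentiable Ac Ad cp dp.
change (a *: v d + w d = 'D_(a *: v c + w c) (cmap d \o cinv c) (cmap c p)).
rewrite (deriveE _ df) linearP -!(deriveE _ df).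
by rewrite (tangent_val (conj v0 tv) Ac Ad cp dp) (tangent_val (conj w0 tw) Ac Ad cp dp).
Qed.

Lemma tangent0 p : tangent p 0.
Proof.
by split=> // c d *; rewrite -[LHS]/(0 : E) -[X in 'D_X _ _]/(0 : E) derive0.
Qed.

Lemma tangent_sub0 p : tangent_sub p 0.
Proof. by split; [exact: tangent0|move=> c _ _ j _; rewrite -[_ c]/(0 : E) mxE]. Qed.

Lemma tangent_sub_lin p (a : R) v w :
  tangent_sub p v -> tangent_sub p w -> tangent_sub p (a *: v + w).
Proof.
move=> [tv hv] [tw hw]; split=> [|c sc cp j kj]; first exact: tangent_lin.
by rewrite -[_ c]/(a *: v c + w c) !mxE hv// hw// mulr0 addr0.
Qed.

Lemma slice_coord c p : slice_chart c -> N p -> cdom c p ->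
  forall j : 'I_n, (k <= j)%N -> cmap c p 0 j = 0.
Proof. by move=> [_ h] Np cp; exact: (h p cp).1. Qed.

(* A transition between slice charts maps slice to slice, hence so does its derivative. *)
Lemma tangent_sub_chart c p v : slice_chart c -> N p -> cdom c p -> tangent p v ->
  (forall j : 'I_n, (k <= j)%N -> v c 0 j = 0) -> tangent_sub p v.
Proof.
move=> sc Np cp tv v0; split=> // d sd dp j kj.
have [Ac cN] := sc; have [Ad dN] := sd.
have df := transition_differentiable Ac Ad cp dp.
rewrite (tangent_val tv Ac Ad cp dp).
rewrite -[LHS]/(rV_coord j _) -derive_linear_comp//; last exact: rV_coord_continuous.
set f := rV_coord j \o _.
have -> : 'D_(v c) f (cmap c p) = 'D_1 (fun h : R^o => f (h *: v c + cmap c p)) 0.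
  rewrite /derive; set g1 := fun h => h^-1 *: _; set g2 := fun h => h^-1 *: _.
  suff -> : g1 = g2 by [].
  by rewrite funeqE /g1 /g2 => h /=; rewrite addr0 scale0r add0r [_%:A]mulr1.
rewrite (@near_eq_derive _ _ _ _ (cst 0)); first exact: derive_cst.
have cl : (h *: v c + cmap c p) @[h --> (0 : R^o)] --> cmap c p.
  have {2}-> : cmap c p = (0 : R^o) *: v c + cmap c p by rewrite scale0r add0r.
  by apply: cvgD; [exact: scalel_continuous|exact: cvg_cst].
have ov : \forall h \near (0 : R^o), exists q,
    [/\ h *: v c + cmap c p = cmap c q, cdom c q & cdom d q].
  exact: cl (near_overlap Ac Ad cp dp).
apply: filterS ov => h [q [/= hq cq dq]]; rewrite /f /= hq /rV_coord chartK//.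
apply: (dN q dq).1 => //; apply/(cN q cq) => i ki.
by rewrite -hq !mxE v0// (slice_coord sc Np cp ki) mulr0 addr0.
Qed.

Lemma ncoset_eq p v w : tangent_sub p (v - w) -> ncoset p v = ncoset p w.
Proof.
move=> vw; apply/seteqP; split=> [_ [u tu <-]|_ [u tu <-]].
  exists (1 *: (v - w) + u); first exact: tangent_sub_lin.
  by rewrite scale1r addrA addrCA subrr addr0.
exists ((-1) *: (v - w) + u); first exact: tangent_sub_lin.
by rewrite scaleN1r opprB addrA addrCA subrr addr0.
Qed.

Lemma ncoset0 p : ncoset p 0 = tangent_sub p.
Proof.
apply/seteqP; split=> [_ [u tu <-]|u tu]; first by rewrite add0r.
by exists u => //; rewrite add0r.
Qed.

Lemma nscale_ncoset t x v : nscale t (x, ncoset x v) = (x, ncoset x (t *: v)).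
Proof.
congr pair; apply/seteqP; split=> [_ [_ [u [[u' tu' <-] tu ->]]]|_ [u tu <-]].
  exists (t *: u' + u); first exact: tangent_sub_lin.
  by rewrite scalerDr addrA.
exists v, u; split=> //; exists 0; first exact: tangent_sub0.
by rewrite addr0.
Qed.

Lemma nuP z : nu z -> exists x v, [/\ N x, tangent x v & z = (x, ncoset x v)].
Proof. by case: z => x s [/= Nx [v tv ->]]; exists x, v. Qed.

Lemma nu_ncoset x v : N x -> tangent x v -> nu (x, ncoset x v).
Proof. by move=> Nx tv; split=> //; exists v. Qed.

Lemma tangentZ x (t : R) v : tangent x v -> tangent x (t *: v).
Proof. by move=> tv; have := tangent_lin t tv (tangent0 x); rewrite (addr0 (t *: v)). Qed.

Lemma nscale_nu t z : nu z -> nu (nscale t z).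
Proof.
by move=> /nuP[x [v [Nx tv ->]]]; rewrite nscale_ncoset; exact: (nu_ncoset Nx (tangentZ t tv)).
Qed.

Lemma nscaleM s t z : nu z -> nscale s (nscale t z) = nscale (s * t) z.
Proof. by move=> /nuP[x [v [Nx tv ->]]]; rewrite !nscale_ncoset (scalerA s t v). Qed.

Lemma nscale1 z : nu z -> nscale 1 z = z.
Proof. by move=> /nuP[x [v [Nx tv ->]]]; rewrite !nscale_ncoset scale1r. Qed.

Lemma nscale0 z : nu z -> nscale 0 z = nzero z.1.
Proof. by move=> /nuP[x [v [Nx tv ->]]]; rewrite !nscale_ncoset scale0r ncoset0. Qed.

Lemma nu_nzero x : N x -> nu (nzero x).
Proof. by move=> Nx; rewrite /Defs.nzero -ncoset0; apply: nu_ncoset => //; exact: tangent0. Qed.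

Lemma nscale_nzero t x : nscale t (nzero x) = nzero x.
Proof. by rewrite /Defs.nzero -ncoset0 nscale_ncoset scaler0. Qed.

(** * Coordinates on the normal bundle *)

Definition base_part (y : E) : E := \row_(j < n) if (j < k)%N then y 0 j else 0.
Definition normal_part (y : E) : E := \row_(j < n) if (j < k)%N then 0 else y 0 j.

Lemma base_part_linear : linear base_part.
Proof. by move=> a x y; apply/rowP => j; rewrite !mxE; case: ifP => // _; rewrite mulr0 addr0. Qed.
HB.instance Definition _ := GRing.isLinear.Build R E E _ base_part base_part_linear.

Lemma normal_part_linear : linear normal_part.
Proof. by move=> a x y; apply/rowP => j; rewrite !mxE; case: ifP => // _; rewrite mulr0 addr0. Qed.
HB.instance Definition _ := GRing.isLinear.Build R E E _ normal_part normal_part_linear.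

Lemma base_part_continuous : continuous base_part.
Proof.
move=> x; apply: (@Ck_rV R 0%N E n setT base_part openT _ x I) => j.
have -> : (fun y => base_part y 0 j : R^o) = fun y => if (j < k)%N then y 0 j else 0.
  by apply/funext => y; rewrite mxE.
case: (j < k)%N; last exact: Ck_cst.
by move=> y _; exact: coord_continuous.
Qed.

Lemma normal_part_continuous : continuous normal_part.
Proof.
move=> x; apply: (@Ck_rV R 0%N E n setT normal_part openT _ x I) => j.
have -> : (fun y => normal_part y 0 j : R^o) = fun y => if (j < k)%N then 0 else y 0 j.
  by apply/funext => y; rewrite mxE.
case: (j < k)%N; first exact: Ck_cst.
by move=> y _; exact: coord_continuous.
Qed.

Lemma smooth_on_base_part U : smooth_on U base_part.
Proof. by apply: (@smooth_on_linear _ _ _ _ base_part); exact: base_part_continuous. Qed.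

Lemma smooth_on_normal_part U : smooth_on U normal_part.
Proof. by apply: (@smooth_on_linear _ _ _ _ normal_part); exact: normal_part_continuous. Qed.

(** The chart reads the normal coordinates off an arbitrary representative of the coset. Two
    representatives differ by a vector of [tangent_sub x], whose normal coordinates vanish in a
    slice chart. *)
Lemma nu_chart_val c x v : slice_chart c -> cdom c x ->
  cmap (nu_chart c) (x, ncoset x v) = base_part (cmap c x) + normal_part (v c).
Proof.
move=> sc cx; apply/rowP => j; rewrite !mxE /=.
case: ifP => [jk|/negbT]; first by rewrite addr0.
rewrite -leqNgt add0r => kj.
have : ncoset x v (xget 0 (ncoset x v)).
  by apply: xgetI; exists 0; [exact: tangent_sub0|rewrite addr0].
by move=> [u [tu u0] <-]; rewrite -[(v + u) c]/(v c + u c) mxE u0// addr0.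
Qed.

Lemma nu_chart_inv c y : cinv (nu_chart c) y = (cinv c (base_part y),
  ncoset (cinv c (base_part y)) (tvec_of A c (cinv c (base_part y)) (normal_part y))).
Proof. reflexivity. Qed.

Lemma base_part_idem y : base_part (base_part y) = base_part y.
Proof. by apply/rowP => j; rewrite !mxE; case: (j < k)%N. Qed.

Lemma normal_part_idem y : normal_part (normal_part y) = normal_part y.
Proof. by apply/rowP => j; rewrite !mxE; case: (j < k)%N. Qed.

Lemma base_normal_part y : base_part (normal_part y) = 0.
Proof. by apply/rowP => j; rewrite !mxE; case: (j < k)%N. Qed.

Lemma normal_base_part y : normal_part (base_part y) = 0.
Proof. by apply/rowP => j; rewrite !mxE; case: (j < k)%N. Qed.

Lemma base_normalD y : base_part y + normal_part y = y.
Proof. by apply/rowP => j; rewrite !mxE; case: (j < k)%N; rewrite ?addr0 ?add0r. Qed.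

Lemma slice_base_part c x : slice_chart c -> N x -> cdom c x ->
  base_part (cmap c x) = cmap c x.
Proof.
move=> sc Nx cx; apply/rowP => j; rewrite mxE; case: ltnP => // kj.
by rewrite (slice_coord sc Nx cx kj).
Qed.

Lemma slice_mem c x : slice_chart c -> cdom c x -> normal_part (cmap c x) = 0 -> N x.
Proof.
move=> [_ h] cx /rowP h0; apply/(h x cx) => j kj.
by move: (h0 j); rewrite !mxE ltnNge kj.
Qed.

Lemma nu_chart_base c x v : slice_chart c -> N x -> cdom c x ->
  base_part (cmap (nu_chart c) (x, ncoset x v)) = cmap c x.
Proof.
move=> sc Nx cx; rewrite nu_chart_val// linearD/= base_part_idem base_normal_part addr0.
exact: slice_base_part.
Qed.

Lemma nu_chart_normal c x v : slice_chart c -> cdom c x ->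
  normal_part (cmap (nu_chart c) (x, ncoset x v)) = normal_part (v c).
Proof.
by move=> sc cx; rewrite nu_chart_val// linearD/= normal_part_idem normal_base_part add0r.
Qed.

Lemma nu_chartK c z : slice_chart c -> cdom (nu_chart c) z ->
  cinv (nu_chart c) (cmap (nu_chart c) z) = z.
Proof.
move=> sc [/nuP[x [v [Nx tv ->]]]] cx; have [Ac _] := sc.
have {}cx : cdom c x by [].
rewrite nu_chart_inv nu_chart_base// nu_chart_normal// chartK//; congr pair.
apply: ncoset_eq; apply: (tangent_sub_chart sc Nx cx).
  have := tangent_lin (-1) tv (tvec_of_tangent (normal_part (v c)) Ac cx).
  by rewrite (scaleN1r v) (addrC (- v)).
move=> j kj; rewrite -[(_ - _) c]/(tvec_of A c x (normal_part (v c)) c - v c).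
by rewrite tvec_of_self// !mxE ltnNge kj/= subrr.
Qed.

Lemma nu_chart_image c (O : set T) : slice_chart c -> O `<=` cdom c ->
  cmap (nu_chart c) @` (nu `&` [set z | O z.1]) = base_part @^-1` (cmap c @` O).
Proof.
move=> sc Oc; have [Ac _] := sc.
apply/seteqP; split=> [_ [z [/nuP[x [v [Nx tv ->]]] /= Ox] <-]|y [q Oq qE]].
  by rewrite /preimage/= nu_chart_base//; [exists x|exact: Oc].
have cq := Oc _ Oq.
have Nq : N q by apply: (slice_mem sc cq); rewrite qE normal_base_part.
exists (q, ncoset q (tvec_of A c q (normal_part y))).
  by split=> //; apply: nu_ncoset => //; exact: tvec_of_tangent.
by rewrite nu_chart_val// tvec_of_self// qE base_part_idem normal_part_idem base_normalD.
Qed.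

Lemma preim_open (S1 S2 : topologicalType) (f : S1 -> S2) (O : set S2) :
  continuous f -> open O -> open (f @^-1` O).
Proof. by move=> cf oO; apply: open_comp => // x _; exact: cf. Qed.

Lemma nu_overlap c d : cdom (nu_chart c) `&` cdom (nu_chart d) =
  nu `&` [set z | (cdom c `&` cdom d) z.1].
Proof.
apply/seteqP; split=> [z [[nz cz] [_ dz]]|z [nz [cz dz]]]; first exact: (conj nz (conj cz dz)).
exact: (conj (conj nz cz) (conj nz dz)).
Qed.

Lemma nu_overlap_open c d : slice_chart c -> slice_chart d ->
  open (cmap (nu_chart c) @` (cdom (nu_chart c) `&` cdom (nu_chart d))).
Proof.
move=> sc sd; rewrite nu_overlap nu_chart_image//.
apply: preim_open; first exact: base_part_continuous.
by apply: (wa_open (charted_weak chA)); [case: sc|case: sd].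
Qed.

(** If [tau] is the transition map of [T], that of the bundle is the base part of [tau] at
    [base_part y] plus the normal part of the derivative of [tau] there in the direction
    [normal_part y]. *)
Lemma nu_transition_smooth c d : slice_chart c -> slice_chart d ->
  smooth_on (cmap (nu_chart c) @` (cdom (nu_chart c) `&` cdom (nu_chart d)))
    (cmap (nu_chart d) \o cinv (nu_chart c)).
Proof.
move=> sc sd; have oI := nu_overlap_open sc sd.
move: oI; rewrite nu_overlap nu_chart_image//.
set U := _ @^-1` _ => oU; have [Ac _] := sc; have [Ad _] := sd.
have [_ _ hc] := chA; have [s _] := hc _ _ Ac Ad.
have cE := finite_coordinates_rV R n.
apply: (@smooth_on_ext _ _ _ _ ((base_part \o ((cmap d \o cinv c) \o base_part)) \+
   (normal_part \o (fun y => 'D_(normal_part y) (cmap d \o cinv c) (base_part y))))) => //.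
  move=> y [q [cq dq] qE] /=.
  rewrite -[RHS]/(cmap (nu_chart d) (cinv (nu_chart c) y)) nu_chart_inv -qE chartK//.
  by rewrite nu_chart_val// tvec_of_val.
move=> l; apply: Ck_add => //.
  apply: (@Ck_linear_comp _ _ _ _ _ _ base_part) => //; first exact: base_part_continuous.
  by apply: Ck_comp (s l) => //; exact: smooth_on_base_part.
apply: (@Ck_linear_comp _ _ _ _ _ _ normal_part) => //; first exact: normal_part_continuous.
apply: (smooth_on_directional cE oU _ _ _ s) => //.
  exact: smooth_on_base_part.
exact: smooth_on_normal_part.
Qed.

Lemma weak_atlas_nu : weak_atlas nu_atlas.
Proof.
split.
- by move=> _ z [c sc <-]; exact: nu_chartK.
- by move=> _ _ [c sc <-] [d sd <-]; exact: nu_overlap_open.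
- move=> _ _ [c sc <-] [d sd <-]; split; first exact: nu_transition_smooth.
  by rewrite setIC; exact: nu_transition_smooth.
Qed.

Hypothesis embN : embedded_submanifold A N k.

Lemma nu_chart_nscale c z t : slice_chart c -> cdom (nu_chart c) z ->
  cmap (nu_chart c) (nscale t (cinv (nu_chart c) (cmap (nu_chart c) z))) =
  base_part (cmap (nu_chart c) z) + t *: normal_part (cmap (nu_chart c) z).
Proof.
move=> sc cz; rewrite nu_chartK//.
have [nz cx] := cz; have [x [v [Nx tv zE]]] := nuP nz; rewrite {}zE in cx *.
have {}cx : cdom c x by [].
rewrite nscale_ncoset nu_chart_val// nu_chart_base// nu_chart_normal//.
by rewrite slice_base_part// -[(t *: v) c]/(t *: v c) linearZ.
Qed.

(** In a bundle chart this is [base_part y + t *: normal_part y], hence jointly smooth in [y] and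
    [t], including [t = 0], where the scaling becomes the projection to [N]. *)
Lemma smooth_map_nscale :
  smooth_map (prod_atlas nu_atlas (real_atlas R)) nu_atlas
    [set zt | nu zt.1] (fun zt => nscale zt.2 zt.1).
Proof.
move=> [z t] /= nz; have [x [v [Nx tv zE]]] := nuP nz.
have [c sc cx] := embN.2 _ Nx; have [Ac _] := sc.
have [hA _ _] := chA; have [oc oic _ _ _] := hA _ Ac.
pose W := (base_part @^-1` (cmap c @` cdom c)) `*` (setT : set R^o).
have WE : W = cmap (prod_chart (nu_chart c) (id_chart R)) @`
     cdom (prod_chart (nu_chart c) (id_chart R)).
  by rewrite prod_chart_image nu_chart_image//= image_id.
have oW : open W.
  apply: open_setX openT; apply: preim_open => //; exact: base_part_continuous.
have cz : cdom (nu_chart c) z by split; rewrite //= zE.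
exists (prod_chart (nu_chart c) (id_chart R)), (nu_chart c), W; split=> //.
- by split; [exists (nu_chart c), (id_chart R); split=> //; exists c|exists c].
- by split=> //; rewrite WE; exists (z, t).
- rewrite WE => _ [[y s] [[ny cy] _] <-]; exists (y, s) => //.
  by split; [split|split => //; exact: nscale_nu].
- apply: (@smooth_on_ext _ _ _ _
    ((base_part \o fst) \+ (fun y => y.2 *: (normal_part \o fst) y))) => //.
    by rewrite WE => _ [[y s] [cy _] <-]; apply/esym; exact: nu_chart_nscale.
  move=> l; apply: Ck_add => //; last apply: Ck_scale => //.
  + by apply: (@Ck_linear_comp _ _ _ _ _ _ base_part) => //;
      [exact: base_part_continuous|exact: smooth_on_fst].
  + exact: (@smooth_on_snd _ E R^o).
  + by apply: (@Ck_linear_comp _ _ _ _ _ _ normal_part) => //;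
      [exact: normal_part_continuous|exact: smooth_on_fst].
Qed.

End NormalBundle.


Lemma is_derive_translate (R : realType) (F : normedModType R) (g : R^o -> F)
  (t t0 u : R) (d : F) : t - u = t0 ->
  is_derive (t0 : R^o) (1 : R^o) g d ->
  is_derive (t : R^o) (1 : R^o) (g \o (fun s : R^o => s - u : R^o)) d.
Proof.
move=> <- [/derivable1_diffP dg <-].
have dsh : differentiable (fun s : R^o => s - u : R^o) (t : R^o) by [].
have e : 'D_1 (fun s : R^o => s - u : R^o) (t : R^o) = 1.
  by rewrite deriveE// diff_val subr0.
apply: DeriveDef; first exact/derivable1_diffP/differentiable_comp.
by rewrite (derive_comp (1 : R^o) dsh dg) e.
Qed.

(** * Tubular neighbourhoods *)

Section Tube.
Variables (R : realType) (n : nat) (T : topologicalType).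
Variable A : set (chart T 'rV[R]_n).
Hypothesis chA : charted A.
Variables (N : set T) (k : nat).
Hypothesis embN : embedded_submanifold A N k.
Variables (O : set T) (V : T -> tvec R n T) (Phi : T * set (tvec R n T) -> T).
Hypothesis indPhi : induced_embedding A N k O V Phi.
Local Notation nu := (nu A N k).
Local Notation nzero := (nzero A N k).
Local Notation nscale := (nscale A N k).
Local Notation nu_atlas := (nu_atlas A N k).
Local Notation tube := (tube A N k Phi).
Local Notation m_ := (tube_scale A N k Phi).

Let cE := finite_coordinates_rV R n.
Let cR := finite_coordinates_real R.

Lemma Phi_inj z z' : nu z -> nu z' -> Phi z = Phi z' -> z = z'.
Proof.
have [[_ _ _ [Psi _ K]] _ _ _] := indPhi.
by move=> nz nz' e; rewrite -(K z nz) e K.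
Qed.

Lemma tube_scaleE t z : nu z -> m_ t (Phi z) = Phi (nscale t z).
Proof.
move=> nz; apply: xget_subset1; first by exists z.
move=> _ _ [z1 [nz1 e1 ->]] [z2 [nz2 e2 ->]]; congr (Phi (nscale t _)).
by apply: Phi_inj => //; rewrite e1.
Qed.

Lemma tube_open : open tube.
Proof. by have [[]] := indPhi. Qed.

Lemma tube_sub : tube `<=` O.
Proof. by have [[]] := indPhi. Qed.

Lemma tube_scale_tube t p : tube p -> tube (m_ t p).
Proof.
by move=> [z nz <-]; rewrite tube_scaleE//; exists (nscale t z) => //; exact: nscale_nu.
Qed.

Lemma tube_scaleM s t p : tube p -> m_ s (m_ t p) = m_ (s * t) p.
Proof.
move=> [z nz <-]; rewrite !tube_scaleE//; last exact: nscale_nu.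
by rewrite nscaleM.
Qed.

Lemma tube_scale1 p : tube p -> m_ 1 p = p.
Proof. by move=> [z nz <-]; rewrite !tube_scaleE// nscale1. Qed.

Lemma tube_scale0_mem p : tube p -> N (m_ 0 p).
Proof.
move=> [z nz <-]; have [_ h _ _] := indPhi; have [Nz _] := nz.
by rewrite tube_scaleE// nscale0// h.
Qed.

Lemma sub_tube : N `<=` tube.
Proof.
move=> x Nx; have [_ h _ _] := indPhi.
by exists (nzero x); [exact: nu_nzero|exact: h].
Qed.

Lemma tube_scale_fix t p : N p -> m_ t p = p.
Proof.
move=> Np; have [_ h _ _] := indPhi; rewrite -{1}(h p Np).
by rewrite tube_scaleE; [rewrite nscale_nzero//; exact: h|exact: nu_nzero].
Qed.

Lemma tube_scale_mem_inv t p : t != 0 -> tube p -> N (m_ t p) -> N p.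
Proof.
move=> t0 tp Nm; rewrite -(tube_scale1 tp) -(mulVf t0) -tube_scaleM//.
by rewrite tube_scale_fix.
Qed.

Let wnu := weak_atlas_nu chA N k.

Lemma smooth_map_tube_scale : smooth_map (prod_atlas A (real_atlas R)) A
  [set pt | tube pt.1] (fun pt => m_ pt.2 pt.1).
Proof.
have chR := charted_real R.
have chAR := charted_prod cE cR chA chR.
have [[sPhi oT _ [Psi sPsi K]] _ _ _] := indPhi.
have oD : open [set pt : T * R | tube pt.1].
  rewrite (_ : mkset _ = tube `*` setT); first exact: open_setX oT openT.
  by apply/seteqP; split=> [[p t] //|[p t] []].
have PsiP p : tube p -> nu (Psi p) /\ Phi (Psi p) = p.
  by move=> [z nz <-]; rewrite K.
have s1 : smooth_map (prod_atlas A (real_atlas R)) A [set pt | tube pt.1] fst.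
  exact: (smooth_map_restrict chAR oD _ (smooth_map_fst cE cR chA chR)).
have s2 : smooth_map (prod_atlas A (real_atlas R)) (real_atlas R) [set pt | tube pt.1] snd.
  exact: (smooth_map_restrict chAR oD _ (smooth_map_snd cE cR chA chR)).
have wA := charted_weak chA; have wR := charted_weak chR; have wAR := charted_weak chAR.
have wnR := weak_atlas_prod cE cR wnu wR.
have cER := finite_coordinates_prod cE cR.
have s3 := smooth_map_comp cE cE wAR wA wnu s1 sPsi (fun p => id).
have s4 := smooth_map_pair cER cE cR wAR wnu wR s3 s2.
have s5 := smooth_map_comp cER cE wAR wnR wnu s4 (smooth_map_nscale chA embN)
  (fun p tp => (PsiP _ tp).1).
have s6 := smooth_map_comp cE cE wAR wnu wA s5 sPhi
  (fun p tp => nscale_nu chA _ (PsiP _ tp).1).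
apply: (smooth_map_ext wAR _ s6) => -[p t] /= tp.
by have [nz {2}<-] := PsiP _ tp; rewrite tube_scaleE.
Qed.

(** The hypothesis on [Phi] gives the velocity at parameter 0 only. Since scalings multiply, the
    curve near [tau] is a translate of the curve that starts at the point scaled by [expR tau]. *)
Lemma tube_velocity p : tube p -> forall tau,
  velocity A (fun s => m_ (expR s) p) tau (V (m_ (expR tau) p)).
Proof.
move=> [z nz <-] tau; have [_ _ _ h] := indPhi.
have [h1 h2] := h _ (nscale_nu chA (expR tau) nz).
have e : (fun s => m_ (expR s) (Phi z)) =
   (fun s => Phi (nscale (expR s) (nscale (expR tau) z))) \o (fun s => s - tau).
  apply/funext => s /=; rewrite tube_scaleE// nscaleM// -expRD subrK//.
have sh : {for tau, continuous (fun s : R => s - tau)}.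
  by apply: cvgB; [exact: cvg_id|exact: cvg_cst].
split.
  rewrite /prop_for e; apply: continuous_comp => //.
  by rewrite subrr.
move=> c Ac cm.
have := h2 c Ac; rewrite expR0 (nscale1 chA); last exact: nscale_nu.
rewrite tube_scaleE// in cm *; move=> /(_ cm) d0.
rewrite e.
set g := (fun s => Phi _) in d0 *.
exact: (is_derive_translate (g := cmap c \o g) (subrr tau) d0).
Qed.

(** * The distance function transported to the tube *)

Variable rho0 : T * set (tvec R n T) -> R.
Hypothesis distr : distance_function A N k rho0.
Local Notation rho := (tube_pullback A N k Phi rho0).

Lemma tube_pullbackE z : nu z -> rho (Phi z) = rho0 z.
Proof.
move=> nz; apply: xget_subset1; first by exists z.
by move=> _ _ [z1 [nz1 e1 ->]] [z2 [nz2 e2 ->]]; congr rho0; apply: Phi_inj => //; rewrite e1.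
Qed.

Lemma tube_pullback_ge0 p : tube p -> 0 <= rho p.
Proof. by move=> [z nz <-]; rewrite tube_pullbackE//; have [_ h _ _] := distr; exact: h. Qed.

Lemma tube_pullback_eq0 p : tube p -> rho p = 0 <-> N p.
Proof.
have [_ h0 _ _] := indPhi.
move=> [z nz <-]; rewrite tube_pullbackE//; have [_ _ h _] := distr; split.
  by move=> /(h z nz)[x Nx ->]; rewrite h0.
move=> Nz; apply/(h z nz); exists (Phi z) => //.
by apply: Phi_inj => //; [exact: nu_nzero|rewrite h0].
Qed.

Lemma tube_pullback_scale t p : 0 <= t -> tube p -> rho (m_ t p) = t ^+ 2 * rho p.
Proof.
move=> t0 [z nz <-]; rewrite tube_scaleE// !tube_pullbackE//; last exact: nscale_nu.
by have [_ _ _ h] := distr; exact: h.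
Qed.

Lemma smooth_map_tube_pullback : smooth_map A (real_atlas R) tube rho.
Proof.
have [[sPhi oT _ [Psi sPsi K]] _ _ _] := indPhi; have [sr _ _ _] := distr.
have wA := charted_weak chA; have wR := charted_weak (charted_real R).
have PsiP p : tube p -> nu (Psi p) /\ Phi (Psi p) = p.
  by move=> [z nz <-]; rewrite K.
have s := smooth_map_comp cE cR wA wnu wR sPsi sr (fun p tp => (PsiP _ tp).1).
apply: (smooth_map_ext wA _ s) => p tp /=.
by have [nz {2}<-] := PsiP _ tp; rewrite tube_pullbackE.
Qed.

End Tube.


(** * Integral curves *)

Section Flows.
Variables (R : realType) (n : nat) (T : topologicalType).
Variable A : set (chart T 'rV[R]_n).
Hypothesis chA : charted A.
Local Notation E := 'rV[R]_n.

(** The common last step of the arguments that propagate a property along a whole curve: uniqueness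
    of integral curves, preservation of strata and of tubes. *)
Lemma clopen_real (P : set R) : P !=set0 -> open P -> closed P -> P = setT.
Proof.
move=> P0 oP cP.
have cT : connected [set: R] by apply/connected_intervalP => x y _ _ z _.
by apply: cT => //; exists P => //; rewrite setTI.
Qed.

Lemma smooth_locally_lipschitz (U : set E) (v : E -> E) x0 : open U -> U x0 ->
  smooth_on U v -> exists r L : R, [/\ 0 < r, 0 <= L, ball x0 r `<=` U &
    forall x y, ball x0 r x -> ball x0 r y ->
    forall j, `|v x 0 j - v y 0 j| <= L * `|x - y|].
Proof.
move=> oU Ux0 sv.
have h (j : 'I_n) : exists r L : R, [/\ 0 < r, 0 <= L & forall x y, ball x0 r x ->
    ball x0 r y -> `|v x 0 j - v y 0 j| <= L * `|x - y|].
  apply: (@C1_locally_lipschitz R n U (rV_coord j \o v)) => //.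
  by apply: Ck_linear_comp => //; exact: rV_coord_continuous.
have h' (j : 'I_n) : exists rL : R * R, [/\ 0 < rL.1, 0 <= rL.2 & forall x y,
    ball x0 rL.1 x -> ball x0 rL.1 y -> `|v x 0 j - v y 0 j| <= rL.2 * `|x - y|].
  by have [r [L ?]] := h j; exists (r, L).
have [rL hrL] := choice h'.
have /nbhs_ballP[r /= r0 rU] : nbhs x0 U by exact: open_nbhs_nbhs.
pose s := \big[Num.min/r]_j (rL j).1.
have s0 : 0 < s.
  by apply/bigmin_gtP; split=> // j _; have [] := hrL j.
exists s, (\sum_j (rL j).2); split=> //.
- by apply: sumr_ge0 => j _; have [] := hrL j.
- by apply: subset_trans rU; apply: le_ball; exact: bigmin_le_id.
- move=> x y bx bby j; have [_ _ hj] := hrL j.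
  have sj : s <= (rL j).1 by exact: bigmin_le_cond.
  apply: le_trans (hj _ _ (le_ball sj bx) (le_ball sj bby)) _.
  rewrite ler_wpM2r// (bigD1 j)//= lerDl sumr_ge0// => i _.
  by have [] := hrL i.
Qed.

Variables (O : set T) (V : T -> tvec R n T).
Hypothesis oO : open O.
Hypothesis vfV : vector_field A O V.

Lemma velocity_near_chart (gam : R -> T) c t0 : A c -> cdom c (gam t0) ->
  (forall t, velocity A gam t (V (gam t))) ->
  \forall t \near t0, cdom c (gam t) /\
    is_derive (t : R^o) (1 : R^o) (cmap c \o gam : R^o -> E) (V (gam t) c).
Proof.
move=> Ac cg vg; have [hA _ _] := chA; have [oc _ _ _ _] := hA _ Ac.
have [cont _] := vg t0.
have : \forall t \near t0, cdom c (gam t) by apply: cont; exact: open_nbhs_nbhs.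
by apply: filterS => t ct; split=> //; have [_] := vg t; exact.
Qed.

Lemma continuous_in_chart (gam : R -> T) c t0 : A c -> cdom c (gam t0) ->
  {for t0, continuous gam} -> {for t0, continuous (cmap c \o gam)}.
Proof.
move=> Ac cg cont; have [hA _ _] := chA; have [_ _ _ cc _] := hA _ Ac.
by apply: continuous_comp => //; exact: cc.
Qed.

Lemma field_in_chart c : A c ->
  smooth_on (cmap c @` (cdom c `&` O)) (fun y => V (cinv c y) c).
Proof. by move=> Ac; have [_ h] := vfV; exact: h. Qed.

(** In a chart at the common point, the derivative of the difference of the two curves is bounded by
    a Lipschitz constant of the field times that difference, so Gronwall applies. *)
Lemma integral_curve_locally_unique (g1 g2 : R -> T) t0 : 
  (forall t, velocity A g1 t (V (g1 t))) -> (forall t, velocity A g2 t (V (g2 t))) ->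
  O (g1 t0) -> g1 t0 = g2 t0 -> \forall t \near t0, g1 t = g2 t.
Proof.
move=> v1 v2 Og e; have [hA kA _] := chA; have [c Ac cg] := kA (g1 t0).
have cg2 : cdom c (g2 t0) by rewrite -e.
have ic := hA _ Ac; have [oc _ cK cc _] := ic.
have oU := chart_open_image ic oO.
have Ug : (cmap c @` (cdom c `&` O)) (cmap c (g1 t0)) by exists (g1 t0).
have [r [L [r0 L0 _ lip]]] := smooth_locally_lipschitz oU Ug (field_in_chart Ac).
have near_b (g : R -> T) : (forall t, velocity A g t (V (g t))) -> g t0 = g1 t0 ->
    \forall t \near t0, ball (cmap c (g1 t0)) r (cmap c (g t)).
  move=> vg gE; have [cont _] := vg t0.
  have cgg : cdom c (g t0) by rewrite gE.
  have /= h := continuous_in_chart Ac cgg cont.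
  apply: h; rewrite /= gE.
  exact: nbhsx_ballx.
have d1 := velocity_near_chart Ac cg v1.
have d2 := velocity_near_chart Ac cg2 v2.
have b1 := near_b _ v1 erefl; have b2 := near_b _ v2 (esym e).
pose h (t : R) : E := cmap c (g1 t) - cmap c (g2 t).
have : \forall t \near t0, h t = 0.
  apply: (@gronwall_vanishing R n h (fun t => V (g1 t) c - V (g2 t) c) t0 L L0).
  - near=> t.
    have [_ i1] : cdom c (g1 t) /\
      is_derive (t : R^o) (1 : R^o) (cmap c \o g1 : R^o -> E) (V (g1 t) c) by near: t.
    have [_ i2] : cdom c (g2 t) /\
      is_derive (t : R^o) (1 : R^o) (cmap c \o g2 : R^o -> E) (V (g2 t) c) by near: t.
    exact: (is_deriveB i1 i2).
  - near=> t => j.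
    have [c1 _] : cdom c (g1 t) /\
      is_derive (t : R^o) (1 : R^o) (cmap c \o g1 : R^o -> E) (V (g1 t) c) by near: t.
    have [c2 _] : cdom c (g2 t) /\
      is_derive (t : R^o) (1 : R^o) (cmap c \o g2 : R^o -> E) (V (g2 t) c) by near: t.
    have h1 : ball (cmap c (g1 t0)) r (cmap c (g1 t)) by near: t.
    have h2 : ball (cmap c (g1 t0)) r (cmap c (g2 t)) by near: t.
    by have := lip _ _ h1 h2 j; rewrite !cK// !mxE.
  - by rewrite /h e subrr.
move=> h0; near=> t.
have [c1 _] : cdom c (g1 t) /\
  is_derive (t : R^o) (1 : R^o) (cmap c \o g1 : R^o -> E) (V (g1 t) c) by near: t.
have [c2 _] : cdom c (g2 t) /\
  is_derive (t : R^o) (1 : R^o) (cmap c \o g2 : R^o -> E) (V (g2 t) c) by near: t.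
have : h t = 0 by near: t.
by move=> /subr0_eq ee; rewrite -(cK _ c1) ee cK.
Unshelve. all: by end_near. Qed.

Lemma closed_agreement (U : topologicalType) (f g : U -> T) : hausdorff_space T ->
  continuous f -> continuous g -> closed [set x | f x = g x].
Proof.
move=> hT cf cg; rewrite -openC openE => x /= fg.
move: hT; rewrite open_hausdorff => /(_ (f x) (g x)).
move=> /(_ (introN eqP fg))[[P Q] /= [/set_mem Pf /set_mem Qg] [oP oQ PQ]].
have nf : \forall y \near x, P (f y) by apply: cf; exact: open_nbhs_nbhs.
have ng : \forall y \near x, Q (g y) by apply: cg; exact: open_nbhs_nbhs.
near=> y; move=> /= e.
have : (P `&` Q) (f y) by split; [near: y|rewrite e; near: y].
by move/eqP: PQ => ->.
Unshelve. all: by end_near. Qed.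

Lemma integral_curve_unique (g1 g2 : R -> T) : hausdorff_space T ->
  integral_curve A O V g1 -> integral_curve A O V g2 -> g1 0 = g2 0 -> g1 = g2.
Proof.
move=> hT i1 i2 e.
have c1 : continuous g1 by move=> t; have [_ []] := i1 t.
have c2 : continuous g2 by move=> t; have [_ []] := i2 t.
have : [set t | g1 t = g2 t] = setT.
  apply: clopen_real; first by exists 0.
    rewrite openE => t /= et; apply: integral_curve_locally_unique => //.
    + by move=> s; have [] := i1 s.
    + by move=> s; have [] := i2 s.
    + by have [] := i1 t.
  exact: closed_agreement.
by move=> h; apply/funext => t; have : [set: R] t by []; rewrite -h.
Qed.

(** * Integral curves of a field tangent to a submanifold *)

Variables (Y D : set T) (k : nat).
Hypothesis embY : embedded_submanifold A Y k.
Hypothesis oD : open D.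
Hypothesis DO : D `<=` O.
Hypothesis tanY : forall y, Y y -> D y -> tangent_sub A Y k y (V y).

Lemma norm_base_part (y : E) : `|base_part k y| <= `|y|.
Proof.
apply: norm_le_coord => // j; rewrite mxE; case: (j < k)%N; first exact: coord_le_norm.
by rewrite normr0.
Qed.

(** Gronwall is applied to the normal coordinates of the curve in a slice chart. The normal part of
    the field vanishes at the projection of the point to the slice, by tangency, so the Lipschitz
    estimate bounds it at the point itself by the size of the normal coordinates. *)
Lemma tangent_submanifold_locally_invariant (g : R -> T) t0 :
  (forall t, velocity A g t (V (g t))) -> D (g t0) -> Y (g t0) ->
  \forall t \near t0, Y (g t).
Proof.
move=> vg Dg Yg; have [hA kA _] := chA; have [c sc cg] := embY.2 _ Yg.
have [Ac _] := sc; have ic := hA _ Ac; have [oc _ cK cc _] := ic.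
have oU := chart_open_image ic oD.
have Ug : (cmap c @` (cdom c `&` D)) (cmap c (g t0)) by exists (g t0).
have sV : smooth_on (cmap c @` (cdom c `&` D)) (fun y => V (cinv c y) c).
  by apply: smooth_on_sub (field_in_chart Ac) => _ [x [cx Dx] <-]; exists x => //; split=> //; exact: DO.
have [r [L [r0 L0 rU lip]]] := smooth_locally_lipschitz oU Ug sV.
have near_b : \forall t \near t0, ball (cmap c (g t0)) r (cmap c (g t)).
  have [cont _] := vg t0.
  have /= h := continuous_in_chart Ac cg cont.
  by apply: h; exact: nbhsx_ballx.
have d := velocity_near_chart Ac cg vg.
have bg : base_part k (cmap c (g t0)) = cmap c (g t0) by exact: (slice_base_part sc Yg cg).
pose h (t : R) : E := normal_part k (cmap c (g t)).
have : \forall t \near t0, h t = 0.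
  apply: (@gronwall_vanishing R n h (fun t => normal_part k (V (g t) c)) t0 L L0).
  - near=> t.
    have [_ [i1 i2]] : cdom c (g t) /\
      is_derive (t : R^o) (1 : R^o) (cmap c \o g : R^o -> E) (V (g t) c) by near: t.
    have dd : differentiable (cmap c \o g : R^o -> E) (t : R^o) by exact/derivable1_diffP.
    have nc := @normal_part_continuous R n k.
    apply: DeriveDef.
      apply/derivable1_diffP.
      apply: (@differentiable_comp _ R^o E E (cmap c \o g) (normal_part k)) => //.
      exact: linear_differentiable.
    rewrite -i2.
    exact: (@derive_linear_comp R R^o E E (normal_part k) (cmap c \o g) t 1 nc dd).
  - near=> t => j.
    have [ct _] : cdom c (g t) /\
      is_derive (t : R^o) (1 : R^o) (cmap c \o g : R^o -> E) (V (g t) c) by near: t.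
    have bt : ball (cmap c (g t0)) r (cmap c (g t)) by near: t.
    (* The projection fixes the centre of the ball and does not increase the sup norm, so the
       projected point stays in the ball, hence in the image of the chart over [D]. *)
    have bbt : ball (cmap c (g t0)) r (base_part k (cmap c (g t))).
      move: bt; rewrite -ball_normE /= => bt; rewrite -bg -linearB.
      exact: le_lt_trans (norm_base_part _) bt.
    rewrite mxE; case: ltnP => kj; first by rewrite normr0 mulr_ge0.
    have [x [cx Dx] xE] := rU _ bbt.
    have Yx : Y x by apply: (slice_mem sc cx); rewrite xE normal_base_part.
    have [_ /(_ c sc cx j kj) V0] := tanY Yx Dx.
    have := lip _ _ bt bbt j; rewrite -xE !cK// V0 subr0 xE.
    have -> : cmap c (g t) - base_part k (cmap c (g t)) = h t.
      by rewrite -{1}(base_normalD k (cmap c (g t))) addrC addKr.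
    by [].
  - by rewrite /h -bg normal_base_part.
move=> h0; near=> t.
have [ct _] : cdom c (g t) /\
  is_derive (t : R^o) (1 : R^o) (cmap c \o g : R^o -> E) (V (g t) c) by near: t.
by apply: (slice_mem sc ct); near: t.
Unshelve. all: by end_near. Qed.

End Flows.


(** * Tubes and strata *)

Section ControlData.
Variables (R : realType) (n : nat) (M : topologicalType).
Variable A : set (chart M 'rV[R]_n).
Hypothesis hM : smooth_manifold A.
Variables (C : set M) (S : set (set M)) (dim : set M -> nat).
Hypothesis hS : stratified_subset A C S dim.
Hypothesis hC : closed C.
Hypothesis hdim : dimension_setting S dim.
Variable tub : set M -> tub_data R n M.
Hypothesis htub : tub_collection A S dim tub.
Hypothesis hadj : tub_adjusted A S dim tub.
Hypothesis htan : tub_tangential A S dim tub.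
Hypothesis hpre : tub_pre_commutative A S dim tub.
Hypothesis hcom : tub_commutative A S dim tub.

Local Notation TT := (T_ A dim tub).
Local Notation m := (m_ A dim tub).
Local Notation rho := (rho_ A dim tub).
Local Notation above := (above S dim).
Local Notation VV := (V_ tub).

Let chA := smooth_manifold_charted hM.
Let emb X (SX : S X) : embedded_submanifold A X (dim X) := ss_submanifold hS SX.

Lemma tub_induced X : S X -> induced_embedding A X (dim X) (above (dim X)) (VV X) (tub_Phi (tub X)).
Proof. by move=> /htub[]. Qed.

Lemma tub_distance X : S X -> distance_function A X (dim X) (tub_dist (tub X)).
Proof. by move=> /htub[]. Qed.

Lemma tub_vector_field X : S X -> vector_field A (above (dim X)) (VV X).
Proof. by move=> /htub[_ []]. Qed.

Lemma T_open X : S X -> open (TT X).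
Proof. by move=> SX; exact: tube_open (tub_induced SX). Qed.

Lemma T_above X : S X -> TT X `<=` above (dim X).
Proof. by move=> SX; exact: tube_sub (tub_induced SX). Qed.

Lemma sub_T X : S X -> X `<=` TT X.
Proof. by move=> SX; exact: (sub_tube (tub_induced SX)). Qed.

Lemma m_T X t p : S X -> TT X p -> TT X (m X t p).
Proof. by move=> SX; move=> tp; exact: (tube_scale_tube chA (tub_induced SX)). Qed.

Lemma m1 X p : S X -> TT X p -> m X 1 p = p.
Proof. by move=> SX; move=> tp; exact: (tube_scale1 chA (tub_induced SX)). Qed.

Lemma m0_mem X p : S X -> TT X p -> X (m X 0 p).
Proof. by move=> SX; move=> tp; exact: (tube_scale0_mem chA (tub_induced SX)). Qed.

Lemma m_fix X t p : S X -> X p -> m X t p = p.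
Proof. by move=> SX; move=> Xp; exact: (tube_scale_fix chA (tub_induced SX)). Qed.

Lemma m_mem_inv X t p : S X -> t != 0 -> TT X p -> X (m X t p) -> X p.
Proof. by move=> SX; exact: (tube_scale_mem_inv chA (tub_induced SX)). Qed.

Lemma smooth_m X : S X -> smooth_map (prod_atlas A (real_atlas R)) A
  [set pt | TT X pt.1] (fun pt => m X pt.2 pt.1).
Proof. by move=> SX; exact: (smooth_map_tube_scale chA (emb SX) (tub_induced SX)). Qed.

Lemma m_velocity X p : S X -> TT X p -> forall t,
  velocity A (fun s => m X (expR s) p) t (VV X (m X (expR t) p)).
Proof. by move=> SX; move=> tp; exact: (tube_velocity chA (tub_induced SX)). Qed.

Lemma rho_ge0 X p : S X -> TT X p -> 0 <= rho X p.
Proof. by move=> SX; move=> tp; exact: (tube_pullback_ge0 (tub_induced SX) (tub_distance SX)). Qed.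

Lemma rho_eq0 X p : S X -> TT X p -> rho X p = 0 <-> X p.
Proof. by move=> SX; move=> tp; exact: (tube_pullback_eq0 (tub_induced SX) (tub_distance SX)). Qed.

Lemma rho_scale X t p : S X -> 0 <= t -> TT X p -> rho X (m X t p) = t ^+ 2 * rho X p.
Proof. by move=> SX; move=> t0 tp; exact: (tube_pullback_scale chA (tub_induced SX) (tub_distance SX)). Qed.

Lemma smooth_rho X : S X -> smooth_map A (real_atlas R) (TT X) (rho X).
Proof. by move=> SX; exact: (smooth_map_tube_pullback chA (tub_induced SX) (tub_distance SX)). Qed.

Lemma strata_eq X Y p : S X -> S Y -> X p -> Y p -> X = Y.
Proof. by move=> SX SY Xp Yp; apply: (ss_disjoint hS) => //; exists p. Qed.

Lemma stratum_of p : C p -> exists2 X, S X & X p.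
Proof. by rewrite (ss_cover hS) => -[X SX Xp]; exists X. Qed.

Lemma stratum_sub X : S X -> X `<=` C.
Proof. by move=> SX p Xp; rewrite (ss_cover hS); exists X. Qed.

(** The tube of [X] meets [Y] but lies in [above (dim X)], which omits all strata of smaller
    dimension. *)
Lemma dim_le X Y : S X -> S Y -> strat_le X Y -> (dim X <= dim Y)%N.
Proof.
move=> SX SY; have [_ h _ _] := hadj; move=> /(h X Y SX SY)[p [Tp Yp]].
by rewrite leqNgt; apply/negP => dYX; apply: (T_above SX Tp); exists Y.
Qed.

Lemma tubes_same_dim X Y p : S X -> S Y -> dim X = dim Y -> TT X p -> TT Y p -> X = Y.
Proof.
move=> SX SY dXY TXp TYp; apply: contrapT => nXY.
have [_ _ h _] := hadj.
have : (closure (TT X) `&` closure (TT Y) `&` above (dim X)) p.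
  by split; [split; exact: subset_closure|exact: T_above TXp].
by rewrite (h _ _ SX SY nXY dXY).
Qed.

Lemma tubes_lt X Y p : S X -> S Y -> (dim X < dim Y)%N -> TT X p -> TT Y p ->
  strat_lt X Y.
Proof.
move=> SX SY d TXp TYp; have [h _ _ _] := hadj.
have : strat_comparable X Y by apply/(h _ _ SX SY); exists p.
case=> [le|/(dim_le SY SX)]; last by rewrite leqNgt d.
by split=> // e; rewrite e ltnn in d.
Qed.

Lemma tube_stratum X Z p : S X -> S Z -> TT X p -> Z p -> X = Z \/ strat_lt X Z.
Proof.
move=> SX SZ TXp Zp; have [_ h _ _] := hadj.
have [->|ne] := pselect (X = Z); [by left|right].
by split=> //; apply/(h _ _ SX SZ); exists p.
Qed.

(** Either [W] is [X], whose points are fixed, or [X < W] and tangentiality makes [W] locally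
    invariant under the flow of the field of [X]. *)
Lemma near_stratum X W p t : S X -> S W -> TT X p -> W (m X (expR t) p) ->
  \forall s \near t, W (m X (expR s) p).
Proof.
move=> SX SW TXp Wq; have Tq s := m_T (expR s) SX TXp.
have [e|lt] := tube_stratum SX SW (Tq t) Wq.
  subst W; have Xp : X p by apply: m_mem_inv Wq => //; rewrite gt_eqF// expR_gt0.
  by apply: filterE => s; rewrite m_fix.
apply: (@tangent_submanifold_locally_invariant R n M A chA (above (dim X)) (VV X) _
  W (TT X) (dim W)) => //.
- exact: tub_vector_field.
- exact: emb.
- exact: T_open.
- exact: T_above.
- by move=> y Wy Ty; exact: htan.
- exact: m_velocity.
Qed.

(* At a limit time the point lies in some stratum [W], which is locally invariant
   too, so [W = Z]. *)
Lemma m_stratum X Z s p : S X -> S Z -> TT X p -> Z p -> 0 < s -> Z (m X s p).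
Proof.
move=> SX SZ TXp Zp s0.
pose P : set R := [set t | Z (m X (expR t) p)].
suff PT : P = setT by have : P (ln s) by [rewrite PT]; rewrite /P /= lnK// posrE.
apply: clopen_real.
- by exists 0; rewrite /P /= expR0 m1.
- by rewrite openE => t Pt; exact: near_stratum.
- move=> t clt.
  have cg : {for t, continuous (fun s => m X (expR s) p)} by have [] := m_velocity SX TXp t.
  have clq : closure Z (m X (expR t) p).
    move=> B /cg Bn; have [s' [Ps' Bs']] := clt _ Bn.
    by exists (m X (expR s') p).
  have Cq : C (m X (expR t) p).
    by apply: hC; apply: closureS clq; exact: stratum_sub.
  have [W SW Wq] := stratum_of Cq.
  have [s' [Ps' Ws']] := clt _ (near_stratum SX SW TXp Wq).
  by rewrite /P /= (strata_eq SZ SW Ps' Ws').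
Qed.

Let cE := finite_coordinates_rV R n.
Let cR := finite_coordinates_real R.
Let chR := charted_real R.
Let chAR := charted_prod cE cR chA chR.

Lemma m_continuous X p t : S X -> TT X p -> {for t, continuous (fun s => m X s p)}.
Proof.
move=> SX TXp.
have h := smooth_map_continuous chAR chA (smooth_m SX) (p := (p, t)) TXp.
have k : {for t, continuous (fun s : R => (p, s))}.
  have k1 : {for t, continuous (fun=> p : M)} by exact: cvg_cst.
  have k2 : {for t, continuous (fun s : R => s)} by exact: cvg_id.
  exact: (cvg_pair k1 k2).
exact: (continuous_comp k h).
Qed.

Lemma sublevel_closed X a p : S X -> 0 <= a -> above (dim X) p ->
  closure [set q | TT X q /\ rho X q <= a] p -> TT X p /\ rho X p <= a.
Proof.
move=> SX a0 ap clp; have [_ _ _ h] := hadj.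
by have [_] := h _ _ SX a0; apply; split.
Qed.

Lemma above_le d d' : (d <= d')%N -> above d' `<=` above d.
Proof.
move=> dd p h [X [SX dX] Xp]; apply: h; exists X => //.
by split=> //; exact: leq_trans dd.
Qed.

(* [rho X] is constant along the curve, which therefore stays in a closed sublevel
   set and cannot leave the tube of [X]. *)
Lemma m_upper_invariant X Y t p : S X -> S Y -> strat_lt X Y -> TT X p -> TT Y p ->
  0 <= t -> TT X (m Y t p).
Proof.
move=> SX SY ltXY TXp TYp t0.
(* The absolute value turns the half-line of times into the whole line, so that connectedness
   applies and time 0 is included. *)
pose ab (s : R) : R := `|s|.
have ab0 s : 0 <= ab s by exact: normr_ge0.
pose P : set R := [set s | TT X (m Y (ab s) p)].
have cg (s : R) : {for s, continuous (fun s : R => m Y (ab s) p)}.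
  have h : {for s, continuous ab} by exact: (@norm_continuous R R^o).
  exact: (continuous_comp h (m_continuous (t := ab s) SY TYp)).
suff PT : P = setT by have : P t by [rewrite PT]; rewrite /P /= /ab ger0_norm.
apply: clopen_real.
- by exists 1; rewrite /P /= /ab normr1 m1.
- rewrite openE => s Ps; apply: cg; apply: open_nbhs_nbhs; split=> //; exact: T_open.
- move=> s cls.
  have : TT X (m Y (ab s) p) /\ rho X (m Y (ab s) p) <= rho X p.
    apply: sublevel_closed => //; first exact: rho_ge0.
      apply: (above_le (dim_le SX SY ltXY.1)); apply: T_above => //; exact: m_T.
    move=> B /cg Bn; have [s' [Ps' Bs']] := cls _ Bn.
    exists (m Y (ab s') p); split=> //; split=> //.
    by have [_ ->] := hpre SX SY ltXY (ab0 s') TYp TXp Ps'.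
  by case.
Qed.

Lemma m_upper_rho X Y t p : S X -> S Y -> strat_lt X Y -> TT X p -> TT Y p ->
  0 <= t -> rho X (m Y t p) = rho X p /\ m X 0 (m Y t p) = m X 0 p.
Proof.
move=> SX SY ltXY TXp TYp t0.
by have [] := hpre SX SY ltXY t0 TYp TXp (m_upper_invariant SX SY ltXY TXp TYp t0).
Qed.

(** Again a curve on which a distance is constant, now [rho Y]. Its sublevel sets are closed only in
    [above (dim Y)]; the curve stays there because it stays in the stratum of [p], which explains
    the assumptions [C p] and [0 < s]. *)
Lemma m_lower_invariant X Y s p : S X -> S Y -> strat_lt X Y -> C p ->
  TT X p -> TT Y p -> 0 < s -> TT Y (m X s p) /\ rho Y (m X s p) = rho Y p.
Proof.
move=> SX SY ltXY Cp TXp TYp s0.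
have [_ hr] := hcom SX SY ltXY.
suff TY : TT Y (m X s p) by split=> //; exact: hr.
pose P : set R := [set t | TT Y (m X (expR t) p)].
suff PT : P = setT by have : P (ln s) by [rewrite PT]; rewrite /P /= lnK// posrE.
have cg t : {for t, continuous (fun s => m X (expR s) p)} by have [] := m_velocity SX TXp t.
have [Z SZ Zp] := stratum_of Cp.
apply: clopen_real.
- by exists 0; rewrite /P /= expR0 m1.
- rewrite openE => t Pt; apply: cg; apply: open_nbhs_nbhs; split=> //; exact: T_open.
- move=> t clt.
  have : TT Y (m X (expR t) p) /\ rho Y (m X (expR t) p) <= rho Y p.
    apply: sublevel_closed => //; first exact: rho_ge0.
      have Zq := m_stratum SX SZ TXp Zp (expR_gt0 t).
      move=> [W [SW dW] Wq]; apply: (T_above SY TYp); exists W => //.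
      by rewrite (strata_eq SW SZ Wq Zq).
    move=> B /cg Bn; have [s' [Ps' Bs']] := clt _ Bn.
    exists (m X (expR s') p); split=> //; split=> //.
    by rewrite hr// expR_gt0.
  by case.
Qed.

End ControlData.


(** * Locally finite radii *)

Section Radii.
Variables (R : realType) (n : nat) (M : topologicalType).
Variable A : set (chart M 'rV[R]_n).
Hypothesis hM : smooth_manifold A.

Lemma manifold_compact_nbhs (p : M) : exists2 K, compact K & nbhs p K.
Proof.
have [hA kA _] := smooth_manifold_charted hM; have [c Ac cp] := kA p.
have [oc oic cK cc ci] := hA _ Ac.
have /nbhs_ballP[r /= r0 rP] : nbhs (cmap c p) (cmap c @` cdom c).
  by apply: open_nbhs_nbhs; split=> //; exists p.
have r2 : 0 < r / 2 by rewrite divr_gt0.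
have sub : closed_ball (cmap c p) (r / 2) `<=` cmap c @` cdom c.
  by apply: subset_trans rP; apply: closed_ball_subset => //; rewrite ltr_pdivrMr// ltr_pMr// ltr1n.
exists (cinv c @` closed_ball (cmap c p) (r / 2)).
  apply: continuous_compact.
    apply: continuous_in_subspaceT => y; rewrite inE => /sub[q cq <-]; exact: ci.
  apply: bounded_closed_compact; last exact: closed_ball_closed.
  rewrite closed_ballE//; exists (`|cmap c p| + r / 2); split; first exact: num_real.
  move=> b hb y; rewrite /closed_ball_ /= => yb.
  apply: le_trans (ltW hb); rewrite -(subrK (cmap c p) y) addrC.
  by apply: (le_trans (ler_normD _ _)); rewrite lerD2l distrC.
have : \forall q \near p, cdom c q /\ ball (cmap c p) (r / 2) (cmap c q).
  apply: filterI; first exact: open_nbhs_nbhs.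
  by apply: cc => //; exact: nbhsx_ballx.
apply: filterS => q [cq bq]; exists (cmap c q); last exact: cK.
exact: subset_closed_ball.
Qed.

Lemma manifold_basis_compact (B : set (set M)) (O : set M) p : basis B -> open O -> O p ->
  exists U, [/\ B U, U p, compact (closure U) & closure U `<=` O].
Proof.
move=> [oB bB] oO Op; have [K cK Kp] := manifold_compact_nbhs p.
have hT := sm_hausdorff hM.
have KO : nbhs p (K `&` O) by apply: filterI => //; exact: open_nbhs_nbhs.
have [W Wp WKO] := compact_regular hT cK Kp KO.
have [U [BU Up] UW] := bB _ _ Wp.
have cUW : closure U `<=` K `&` O by apply: subset_trans WKO; exact: closureS.
exists U; split=> //.
  by apply: subclosed_compact cK _; [exact: closed_closure|move=> x /cUW[]].
by move=> x /cUW[].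
Qed.

Variables (C : set M) (S : set (set M)) (dim : set M -> nat).
Hypothesis hS : stratified_subset A C S dim.
Hypothesis hdim : dimension_setting S dim.
Variable tub : set M -> tub_data R n M.
Hypothesis htub : tub_collection A S dim tub.
Hypothesis hadj : tub_adjusted A S dim tub.

Local Notation TT := (T_ A dim tub).
Local Notation m := (m_ A dim tub).
Local Notation rho := (rho_ A dim tub).
Local Notation above := (above S dim).

Lemma rho_continuous X p : S X -> TT X p -> {for p, continuous (rho X)}.
Proof.
move=> SX; apply: smooth_map_continuous (smooth_rho hM htub SX).
- exact: smooth_manifold_charted.
- exact: charted_real.
Qed.

Lemma tube_mem_dim X p : S X -> X p -> ~ above (dim X).+1 p.
Proof. by move=> SX Xp; apply; exists X. Qed.

(** On [closure U] the function [rho X] has no zero, since [above (dim X).+1] omits [X]. The part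
    where it is at most 1 is compact because the sublevel set is closed in [above (dim X)], so there
    it has a positive minimum; half of it is a strict bound, also where [rho X] exceeds 1. *)
Lemma rho_bounded_below X (U : set M) : S X -> compact (closure U) ->
  closure U `<=` above (dim X).+1 -> exists2 d : R, 0 < d &
  forall p, closure U p -> TT X p -> d < rho X p.
Proof.
move=> SX cU Ua.
pose Q := [set q | TT X q /\ rho X q <= 1].
have cQ p : closure U p -> closure Q p -> Q p.
  by move=> /Ua ap; apply: (sublevel_closed hadj SX ler01); apply: above_le ap.
have [[p0 [Up0 Qp0]]|N] := pselect (exists p, closure U p /\ Q p).
  have cUQ : compact (closure U `&` Q).
    rewrite (_ : _ `&` Q = closure U `&` closure Q).
      by apply: compact_closedI => //; exact: closed_closure.
    by apply/seteqP; split=> p [Up Qp]; split=> //; [exact: subset_closure|exact: cQ].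
  have [c] : exists2 c, c \in closure U `&` Q & forall t, t \in closure U `&` Q -> rho X c <= rho X t.
    apply: compact_EVT_min => //; first by exists p0.
    by apply: continuous_in_subspaceT => p; rewrite inE => -[_ [Tp _]]; exact: rho_continuous.
  rewrite inE => -[Uc [Tc rc]] cmin.
  have r0 : 0 < rho X c.
    rewrite lt_neqAle (rho_ge0 htub)// andbT eq_sym; apply/eqP => /(rho_eq0 htub SX Tc) Xc.
    exact: tube_mem_dim (Ua _ Uc).
  exists (rho X c / 2); first by rewrite divr_gt0.
  have rlt : rho X c / 2 < rho X c by rewrite ltr_pdivrMr// ltr_pMr// ltr1n.
  move=> p Up Tp; have [r1|r1] := leP (rho X p) 1.
    by apply: lt_le_trans rlt _; apply: cmin; rewrite inE.
  by apply: lt_trans rlt _; exact: le_lt_trans r1.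
exists 1 => // p Up Tp; rewrite ltNge; apply/negP => r1; apply: N.
by exists p.
Qed.

(** Each stratum picks a basic open set that meets it and meets only finitely many strata, and
    inherits the number of this set. Strata with equal number share the set and all meet it, so the
    numbering is finite-to-one. *)
Lemma strata_index (B : set (set M)) (f : set M -> nat) : basis B ->
  {in B &, injective f} -> exists idx : set M -> nat,
  forall k, finite_set [set X | S X /\ (idx X <= k)%N].
Proof.
move=> [oB bB] fi.
have h X : exists U, S X -> [/\ B U, U `&` X !=set0 & finite_set [set Y | S Y /\ Y `&` U !=set0]].
  have [SX|NSX] := pselect (S X); last by exists set0.
  have [p Xp] := ss_nonempty hS SX.
  have [W [oW Wp fW]] := ss_locally_finite hS (stratum_sub hS SX Xp).
  have [U [BU Up] UW] := bB p W (open_nbhs_nbhs (conj oW Wp)).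
  exists U => _; split=> //; first by exists p.
  apply: sub_finite_set fW => Y [SY [q [Yq Uq]]]; split=> //; exists q; split=> //; exact: UW.
have [u hu] := choice h.
exists (f \o u); elim=> [|k IH].
  have [[X0 [SX0 X00]]|N] := pselect (exists X, S X /\ f (u X) = 0%N).
    have [B0 _ fin] := hu X0 SX0.
    apply: sub_finite_set fin => X [SX]; rewrite leqn0 => /eqP /= fX.
    have [BX [q [Uq Xq]] _] := hu X SX; split=> //; exists q; split=> //.
    by rewrite (fi (u X0) (u X)) ?inE// X00 fX.
  rewrite (_ : mkset _ = set0)//; apply/seteqP; split=> // X [SX].
  by rewrite leqn0 => /eqP fX; apply: N; exists X.
have [[X0 [SX0 X00]]|N] := pselect (exists X, S X /\ f (u X) = k.+1).
  have [B0 _ fin] := hu X0 SX0.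
  have : finite_set ([set X | S X /\ (f (u X) <= k)%N] `|` [set Y | S Y /\ Y `&` u X0 !=set0]).
    by rewrite finite_setU.
  apply: sub_finite_set => X [SX]; rewrite leq_eqVlt => /orP[/eqP /= fX|]; last by left.
  right; have [BX [q [Uq Xq]] _] := hu X SX; split=> //; exists q; split=> //.
  by rewrite (fi (u X0) (u X)) ?inE// X00 fX.
apply: sub_finite_set IH => X [SX]; rewrite leq_eqVlt => /orP[/eqP /= fX|//].
by exfalso; apply: N; exists X.
Qed.

(** Injectivity of [f] leaves at most one basic set for each value, so only finitely many lower
    bounds enter the minimum. *)
Lemma uniform_lower_bound (B : set (set M)) (f : set M -> nat) X k :
  {in B &, injective f} -> S X -> exists2 d : R, 0 < d &
  forall U, B U -> (f U <= k)%N -> compact (closure U) ->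
    closure U `<=` above (dim X).+1 -> forall p, closure U p -> TT X p -> d < rho X p.
Proof.
move=> fi SX.
have step j : exists2 d : R, 0 < d &
    forall U, B U -> f U = j -> compact (closure U) ->
    closure U `<=` above (dim X).+1 -> forall p, closure U p -> TT X p -> d < rho X p.
  have [[U0 [BU0 fU0 c0 a0]]|N] := pselect (exists U, [/\ B U, f U = j,
      compact (closure U) & closure U `<=` above (dim X).+1]).
    have [d d0 hd] := rho_bounded_below SX c0 a0.
    exists d => // U BU fU _ _; rewrite (fi U U0) ?inE//.
    by rewrite fU0.
  by exists 1 => // U BU fU cU aU; exfalso; apply: N; exists U.
elim: k => [|k [d d0 hd]].
  have [d d0 hd] := step 0%N; exists d => // U BU; rewrite leqn0 => /eqP.
  exact: hd.
have [d' d'0 hd'] := step k.+1.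
exists (Num.min d d'); first by rewrite lt_min d0.
move=> U BU; rewrite leq_eqVlt => /orP[/eqP fU|fU] cU aU p Up Tp; rewrite gt_min.
  by rewrite (hd' U)// orbT.
by rewrite (hd U).
Qed.

(* The radii shrink along an enumeration of the strata, which makes the closed
   tubes of radius [2 * eps X], [X] of dimension [d], locally finite in [above d]. *)
Lemma radii_exist : exists eps : set M -> R,
  (forall X, S X -> 0 < eps X) /\
  forall d p, above d p -> (forall X, S X -> dim X = d -> ~ TT X p) ->
    exists W : set M, [/\ open W, W p, W `<=` above d &
      forall X q, S X -> dim X = d -> W q -> TT X q -> 2 * eps X < rho X q].
Proof.
have [B /countable_injP[f fi] bB] := sm_second_countable hM.
have [idx fidx] := strata_index bB fi.
have h X : exists e : R, S X -> 0 < e /\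
    forall U, B U -> (f U <= idx X)%N -> compact (closure U) ->
    closure U `<=` above (dim X).+1 -> forall p, closure U p -> TT X p -> 2 * e < rho X p.
  have [SX|NSX] := pselect (S X); last by exists 0.
  have [d d0 hd] := uniform_lower_bound (idx X) fi SX.
  exists (d / 2) => _; split; first by rewrite divr_gt0.
  by rewrite mulrCA divff// mulr1.
have [eps heps] := choice h.
exists eps; split=> [X SX|d p ap nT]; first by have [] := heps X SX.
(* [p] lies off the strata of dimension [d] too, as these are inside their tubes. Hence a basic
   neighbourhood with compact closure in [above d.+1] exists, and on it the bounds defining the
   radii apply. *)
have ap1 : above d.+1 p.
  move=> [X [SX]]; rewrite ltnS leq_eqVlt => /orP[/eqP dX|dX] Xp.
    by apply: (nT X) => //; exact: (sub_T htub SX).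
  by apply: ap; exists X.
have oa d' : open (above d') by have [] := hdim.
have [U [BU Up cU Ua]] := manifold_basis_compact bB (oa d.+1) ap1.
(* A stratum whose index exceeds [f U] has a radius chosen so that its closed tube misses [U]. Only
   the finitely many strata in [F] remain, and their closed tubes do not contain [p], so they can be
   cut out. *)
pose F := [set X | (S X /\ (idx X <= f U)%N) /\ dim X = d].
have fF : finite_set F by apply: sub_finite_set (fidx (f U)) => X [].
pose Q X := closure [set q | TT X q /\ rho X q <= 2 * eps X].
have cQ : closed (\bigcup_(X in F) Q X).
  by apply: closed_bigcup => // X _; exact: closed_closure.
exists (U `&` above d `&` ~` (\bigcup_(X in F) Q X)); split.
- apply: openI; last exact: closed_openC.
  by apply: openI => //; have [oB _] := bB; exact: oB.
- split=> // -[X [[SX _] dX] Qp].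
  have e0 : 0 <= 2 * eps X by rewrite mulr_ge0// ltW//; have [] := heps X SX.
  rewrite -dX in ap; have [Tp _] := sublevel_closed hadj SX e0 ap Qp.
  exact: (nT X).
- by move=> q [[]].
- move=> X q SX dX [[Uq _] nQ] Tq; have [_ hX] := heps X SX.
  have [le|lt] := leqP (idx X) (f U).
    rewrite ltNge; apply/negP => r; apply: nQ; exists X => //.
    by apply: subset_closure.
  apply: (hX U) => //; [exact: ltnW|by rewrite dX|exact: subset_closure].
Qed.

End Radii.


(** * The retraction *)

Section Retraction.
Variables (R : realType) (n : nat) (M : topologicalType).
Variable A : set (chart M 'rV[R]_n).
Hypothesis hM : smooth_manifold A.
Variables (C : set M) (S : set (set M)) (dim : set M -> nat).
Hypothesis hS : stratified_subset A C S dim.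
Hypothesis hC : closed C.
Hypothesis hdim : dimension_setting S dim.
Variable tub : set M -> tub_data R n M.
Hypothesis htub : tub_collection A S dim tub.
Hypothesis hadj : tub_adjusted A S dim tub.
Hypothesis htan : tub_tangential A S dim tub.
Hypothesis hpre : tub_pre_commutative A S dim tub.
Hypothesis hcom : tub_commutative A S dim tub.
Variable S' : set (set M).
Hypothesis hS' : S' `<=` S.
Variable eps : set M -> R.
Hypothesis eps_gt0 : forall X, S X -> 0 < eps X.

Local Notation TT := (T_ A dim tub).
Local Notation m := (m_ A dim tub).
Local Notation rho := (rho_ A dim tub).
Local Notation above := (above S dim).
Local Notation C' := (\bigcup_(X in S') X).

Hypothesis eps_locally_finite :
  forall d p, above d p -> (forall X, S X -> dim X = d -> ~ TT X p) ->
    exists W : set M, [/\ open W, W p, W `<=` above d &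
      forall X q, S X -> dim X = d -> W q -> TT X q -> 2 * eps X < rho X q].

Let chA := smooth_manifold_charted hM.
Let cE := finite_coordinates_rV R n.
Let cR := finite_coordinates_real R.
Let chR := charted_real R.
Let chAR := charted_prod cE cR chA chR.
Let cER := finite_coordinates_prod cE cR.
Let wA := charted_weak chA.
Let wR := charted_weak chR.
Let wAR := charted_weak chAR.
Local Notation AR := (prod_atlas A (real_atlas R)).

(* [collapse d] moves a point of the tube of [X] by [m X (factor X a p)]; at [a = 1]
   it maps [rho X <= eps X] to [X] and fixes [2 * eps X <= rho X]. *)
Definition factor X (a : R) (p : M) : R :=
  1 - a + a * smooth_step ((eps X)^-1 * rho X p - 1).

Definition collapse d (pa : M * R) : M :=
  xget pa.1 [set q | exists X, [/\ S' X, dim X = d, TT X pa.1 &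
    q = m X (factor X pa.2 pa.1) pa.1]].

Lemma collapse_in X p a : S' X -> TT X p -> collapse (dim X) (p, a) = m X (factor X a p) p.
Proof.
move=> SX Tp; apply: xget_subset1; first by exists X.
move=> _ _ [Y [SY dY TY ->]] [Z [SZ dZ TZ ->]].
by rewrite (tubes_same_dim htub hadj (hS' SY) (hS' SZ) _ TY TZ)// dY.
Qed.

Lemma collapse_out d p a : (forall X, S' X -> dim X = d -> ~ TT X p) ->
  collapse d (p, a) = p.
Proof. by move=> h; apply: xgetPN => q [X [SX dX TX _]]; exact: (h X). Qed.

Lemma collapseP d p a : (exists X, [/\ S' X, dim X = d, TT X p &
   collapse d (p, a) = m X (factor X a p) p]) \/ collapse d (p, a) = p.
Proof.
have [[X [SX dX TX]]|N] := pselect (exists X, [/\ S' X, dim X = d & TT X p]).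
  by left; exists X; split=> //; rewrite -dX collapse_in.
by right; apply: collapse_out => X SX dX TX; apply: N; exists X.
Qed.

Lemma factor_itv X a p : 0 <= a <= 1 -> 0 <= factor X a p <= 1.
Proof.
move=> /andP[a0 a1]; rewrite /factor.
have /andP[s0 s1] := smooth_step_itv ((eps X)^-1 * rho X p - 1).
set s := smooth_step _ in s0 s1 *.
apply/andP; split; first by rewrite addr_ge0 ?subr_ge0// mulr_ge0.
by rewrite -lerBrDl opprB addrCA subrr addr0 ler_piMr.
Qed.

Lemma factor_far X a p : S X -> 2 * eps X <= rho X p -> factor X a p = 1.
Proof.
move=> SX r; rewrite /factor smooth_step1 ?mulr1 ?subrK//.
rewrite lerBrDr -[1 + 1]/(2 : R) ler_pdivlMl ?eps_gt0//.
by rewrite mulrC.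
Qed.

Lemma factor0 X p : factor X 0 p = 1.
Proof. by rewrite /factor subr0 mul0r addr0. Qed.

Lemma factor1_near X p : S X -> rho X p <= eps X -> factor X 1 p = 0.
Proof.
move=> SX r; rewrite /factor subrr add0r mul1r smooth_step0//.
by rewrite subr_le0 ler_pdivrMl ?eps_gt0// mulr1.
Qed.

Lemma collapse0 d p : collapse d (p, 0) = p.
Proof.
have [[X [SX dX TX ->]]|//] := collapseP d p 0.
by rewrite factor0; apply: (m1 hM htub) => //; exact: hS'.
Qed.

Lemma open_above d : open (above d).
Proof. by have [h _] := hdim. Qed.

Lemma open_cylinder (O : set M) : open O -> open (O `*` [set: R]).
Proof. by move=> oO; apply: open_setX => //; exact: openT. Qed.

Lemma smooth_factor X : S X ->
  smooth_map AR (real_atlas R) (TT X `*` [set: R]) (fun pa => factor X pa.2 pa.1).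
Proof.
move=> SX; have oD := open_cylinder (T_open htub SX).
have sfst := smooth_map_restrict chAR oD (@subsetT _ _) (smooth_map_fst cE cR chA chR).
have ssnd := smooth_map_restrict chAR oD (@subsetT _ _) (smooth_map_snd cE cR chA chR).
have sr : smooth_map AR (real_atlas R) (TT X `*` [set: R]) (rho X \o fst).
  by apply: (smooth_map_comp cE cR wAR wA wR sfst (smooth_rho hM htub SX)) => -[p a] [].
have sp := smooth_map_pair cER cR cR wAR wR wR ssnd sr.
pose kappa (x : R^o * R^o) : R^o := 1 - x.1 + x.1 * smooth_step ((eps X)^-1 * x.2 - 1).
have sk : smooth_on setT kappa.
  move=> k.
  pose P := (R^o * R^o)%type; have oT : open (setT : set P) by exact: openT.
  have s1 := @smooth_on_fst R R^o R^o setT k; have s2 := @smooth_on_snd R R^o R^o setT k.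
  have cc (a : R^o) : Ck k (setT : set P) (fun=> a) by exact: Ck_cst.
  pose inner : P -> R^o := (fun x : P => ((eps X)^-1 : R^o) *: (x.2 : R^o)) \+ (fun=> -1).
  have c1 : Ck k setT inner by apply: Ck_add => //; exact: Ck_scale.
  have c2 : Ck k setT ((@smooth_step R : R^o -> R^o) \o inner).
    by apply: (Ck_comp cR oT _ c1 (@smooth_on_smooth_step R k)).
  have c3 := Ck_scale oT s1 c2.
  have c4 := Ck_add oT (Ck_add oT (cc 1) (Ck_scale oT (cc (-1)) s1)) c3.
  apply: Ck_ext oT _ c4 => x _.
  by rewrite /kappa /= scaleN1r.
have wRR := weak_atlas_prod cR cR wR wR.
exact: (smooth_map_comp (finite_coordinates_prod cR cR) cR wAR wRR wR sp
  (smooth_map_real_fun2 sk)).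
Qed.

(** At most one stratum of dimension [d] acts near a given point. In the tube of a stratum of [S']
    the map is a scaling with smooth factor; in the tube of another stratum it is the identity, by
    disjointness; off all tubes it is the identity near the point, by the choice of the radii. *)
Lemma smooth_collapse d : smooth_map AR A (above d `*` [set: R]) (collapse d).
Proof.
apply: (smooth_map_local wAR) => -[p a] [/= ap _].
have [[X [SX dX TX]]|N] := pselect (exists X, [/\ S X, dim X = d & TT X p]).
  have oD := open_cylinder (T_open htub SX).
  have sfst := smooth_map_restrict chAR oD (@subsetT _ _) (smooth_map_fst cE cR chA chR).
  have sub : TT X `*` [set: R] `<=` above d `*` [set: R].
    by move=> [q b] [Tq _]; split=> //; rewrite -dX; exact: (T_above htub SX).
  have [SX'|NSX'] := pselect (S' X); last first.
    exists (TT X `*` setT), fst; split=> // -[q b] [/= Tq _].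
    apply: collapse_out => Y SY dY TY; apply: NSX'.
    by rewrite (tubes_same_dim htub hadj SX (hS' SY) _ Tq TY)// dX.
  have sp := smooth_map_pair cER cE cR wAR wA wR sfst (smooth_factor SX).
  have sm : smooth_map AR A (TT X `*` [set: R])
     ((fun pt => m X pt.2 pt.1) \o (fun pa => (pa.1, factor X pa.2 pa.1))).
    by apply: (smooth_map_comp cER cE wAR wAR wA sp (smooth_m hM hS htub SX)) => -[q b] [].
  exists (TT X `*` setT), (fun pa => m X (factor X pa.2 pa.1) pa.1); split=> //.
  by move=> [q b] [/= Tq _]; rewrite -dX collapse_in.
have [|W [oW Wp Wa Wfar]] := eps_locally_finite ap.
  by move=> X SX dX TX; apply: N; exists X.
exists (W `*` setT), fst; split=> //.
- by move=> [q b] [/= /Wa].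
- exact: (smooth_map_restrict chAR (open_cylinder oW) (@subsetT _ _) (smooth_map_fst cE cR chA chR)).
- move=> [q b] [/= Wq _]; have [[X [SX dX TX ->]]|//] := collapseP d q b.
  have SX1 := hS' SX; rewrite factor_far//; first exact: (m1 hM htub).
  by apply: ltW; exact: Wfar.
Qed.

Lemma collapse_above d p a : above d p -> above d (collapse d (p, a)).
Proof.
move=> ap; have [[X [SX dX TX ->]]|->//] := collapseP d p a.
by have SX1 := hS' SX; rewrite -dX; apply: (T_above htub SX1); exact: (m_T hM htub).
Qed.

(** Stage [j] takes place for [s] between [j / (n + 1)] and [(j + 1) / (n + 1)]; dimensions run from
    0 to [n], so the [n.+1] stages fill the unit interval. *)
Definition schedule (j : nat) (s : R) : R := smooth_step (n.+1%:R * s - j%:R).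

(** Composition and time run in opposite directions: the highest dimension is applied first and
    moves last. A finished stage of lower dimension is thus an outer map, which can absorb what the
    later stages do. *)
Fixpoint flow d (ps : M * R) : M :=
  match d with
  | 0 => collapse 0 (ps.1, schedule 0 ps.2)
  | d'.+1 => flow d' (collapse d (ps.1, schedule d ps.2), ps.2)
  end.

Lemma schedule_itv j s : 0 <= schedule j s <= 1.
Proof. exact: smooth_step_itv. Qed.

Lemma smooth_schedule j : smooth_map (real_atlas R) (real_atlas R) setT (schedule j).
Proof.
apply: smooth_map_real_fun => k.
apply: (@Ck_comp _ _ _ R^o R^o setT setT (@smooth_step R)
   (fun s : R^o => n.+1%:R * s - j%:R)) => //; [exact: openT| |exact: (@smooth_on_smooth_step R k)].
apply: (@Ck_add _ _ R^o R^o setT (fun s : R^o => (n.+1%:R : R^o) *: s) (fun=> - j%:R));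
  [exact: openT| |exact: Ck_cst].
by apply: Ck_scale; [exact: openT|exact: Ck_cst|exact: smooth_on_real_id].
Qed.

(** [collapse d.+1] preserves [above d.+1], which is contained in [above d], so the stages compose.
    This says nothing at strata of dimension below [d]; there [flow_core] takes over. *)
Lemma smooth_flow d : smooth_map AR A (above d `*` [set: R]) (flow d).
Proof.
have stage j : smooth_map AR A (above j `*` [set: R])
    (fun ps => collapse j (ps.1, schedule j ps.2)).
  have oD := open_cylinder (open_above j).
  have sfst := smooth_map_restrict chAR oD (@subsetT _ _) (smooth_map_fst cE cR chA chR).
  have ssnd := smooth_map_restrict chAR oD (@subsetT _ _) (smooth_map_snd cE cR chA chR).
  have ss := smooth_map_comp cR cR wAR wR wR ssnd (smooth_schedule j) (fun _ _ => I).
  have sp := smooth_map_pair cER cE cR wAR wA wR sfst ss.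
  by apply: (smooth_map_comp cER cE wAR wAR wA sp (@smooth_collapse j)) => -[p a] [].
elim: d => [|d IH]; first exact: stage.
have oD := open_cylinder (open_above d.+1).
have ssnd := smooth_map_restrict chAR oD (@subsetT _ _) (smooth_map_snd cE cR chA chR).
have sp := smooth_map_pair cER cE cR wAR wA wR (stage d.+1) ssnd.
apply: (smooth_map_comp cER cE wAR wAR wA sp IH) => -[p a] [/= ap _].
by split=> //=; apply: (above_le (leqnSn d)); exact: collapse_above.
Qed.

(** * The neighbourhood and its invariance *)

Definition core X : set M := [set p | TT X p /\ rho X p < eps X].

Definition core_nbhd : set M := \bigcup_(X in S') core X.

Lemma core_open X : S X -> open (core X).
Proof.
move=> SX; rewrite (_ : core X = TT X `&` rho X @^-1` [set r | r < eps X]); last first.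
  by apply/seteqP; split=> p [].
apply: open_preimage_in; [exact: (T_open htub)|exact: open_lt|].
by move=> p; exact: (rho_continuous hM htub SX).
Qed.

Lemma core_nbhd_open : open core_nbhd.
Proof. by apply: bigcup_open => X /hS'; exact: core_open. Qed.

Lemma sub_core X : S X -> X `<=` core X.
Proof.
move=> SX p Xp; have Tp := sub_T htub SX Xp; split=> //.
by rewrite ((rho_eq0 htub SX Tp).2 Xp) eps_gt0.
Qed.

Lemma sub_core_nbhd : C' `<=` core_nbhd.
Proof. by move=> p [X SX Xp]; exists X => //; apply: sub_core => //; exact: hS'. Qed.

Lemma core_above X : S X -> core X `<=` above (dim X).
Proof. by move=> SX p [Tp _]; exact: (T_above htub SX). Qed.

(** Positive scaling factors preserve every stratum. Only the factor 0 can leave [Z], and then the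
    point lands on the stratum of [S'] that is being collapsed to. *)
Lemma collapse_stratum d p a Z : S Z -> Z p -> 0 <= a <= 1 ->
  Z (collapse d (p, a)) \/ C' (collapse d (p, a)).
Proof.
move=> SZ Zp a01; have [[X [SX dX TX ->]]|->] := collapseP d p a; last by left.
have SX1 := hS' SX; have /andP[f0 _] := factor_itv X p a01.
move: f0; rewrite le_eqVlt => /orP[/eqP <-|f0].
  by right; exists X => //; exact: (m0_mem hM htub).
by left; exact: (m_stratum hM hS hC htub hadj htan).
Qed.

Lemma collapse_C d p a : C p -> 0 <= a <= 1 -> C (collapse d (p, a)).
Proof.
move=> Cp a01; have [Z SZ Zp] := stratum_of hS Cp.
have [Zq|[X SX Xq]] := collapse_stratum d SZ Zp a01; first exact: (stratum_sub hS SZ).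
exact: (stratum_sub hS (hS' SX)).
Qed.

Lemma collapse_C' d p a : C' p -> 0 <= a <= 1 -> C' (collapse d (p, a)).
Proof.
move=> [Z SZ Zp] a01; have [Zq|//] := collapse_stratum d (hS' SZ) Zp a01.
by exists Z.
Qed.

(** A stratum of dimension [d] whose tube meets [core X] lies above [X], so by pre-commutativity its
    scalings move points within the fibres of [m X 0] and at constant [rho X]. *)
Lemma collapse_core d X p a : S X -> (dim X < d)%N -> core X p -> 0 <= a <= 1 ->
  core X (collapse d (p, a)) /\ m X 0 (collapse d (p, a)) = m X 0 p.
Proof.
move=> SX dXd [Tp rp] a01; have [[Y [SY dY TY ->]]|->//] := collapseP d p a.
have SY1 := hS' SY; have /andP[f0 _] := factor_itv Y p a01.
have lt : strat_lt X Y by apply: (tubes_lt htub hadj SX SY1 _ Tp TY); rewrite dY.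
have Tq := m_upper_invariant hM hS htub hadj hpre SX SY1 lt Tp TY f0.
have [rq mq] := m_upper_rho hM hS htub hadj hpre SX SY1 lt Tp TY f0.
by split=> //; split=> //; rewrite rq.
Qed.

(** The point lies in some [core X] and is moved by some [Y]. If [Y] is of higher dimension, [rho X]
    is constant by pre-commutativity; if lower, [rho X] is constant by commutativity unless the
    factor is 0, when the point lands on [Y]; if [Y = X], then [rho X] is multiplied by the square
    of a number at most 1. *)
Lemma collapse_nbhd d p a : C p -> core_nbhd p -> 0 <= a <= 1 ->
  core_nbhd (collapse d (p, a)).
Proof.
move=> Cp [X SX [Tp rp]] a01; have [[Y [SY dY TY ->]]|->] := collapseP d p a; last by exists X.
have SX1 := hS' SX; have SY1 := hS' SY.
have /andP[f0 f1] := factor_itv Y p a01.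
have [lt|lt|e] := ltngtP (dim X) (dim Y).
- have ltXY := tubes_lt htub hadj SX1 SY1 lt Tp TY.
  exists X => //; split.
    exact: (m_upper_invariant hM hS htub hadj hpre SX1 SY1 ltXY Tp TY f0).
  by have [-> _] := m_upper_rho hM hS htub hadj hpre SX1 SY1 ltXY Tp TY f0.
- have ltYX := tubes_lt htub hadj SY1 SX1 lt TY Tp.
  move: f0; rewrite le_eqVlt => /orP[/eqP <-|f0].
    by apply: sub_core_nbhd; exists Y => //; exact: (m0_mem hM htub).
  have [Tq rq] := m_lower_invariant hM hS hC htub hadj htan hcom SY1 SX1 ltYX Cp TY Tp f0.
  by exists X => //; split=> //; rewrite rq.
- have XY := tubes_same_dim htub hadj SX1 SY1 e Tp TY; subst Y.
  exists X => //; split; first exact: (m_T hM htub).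
  rewrite (rho_scale hM htub)//; apply: le_lt_trans rp.
  by rewrite ler_piMl ?(rho_ge0 htub)// expr_le1.
Qed.

Lemma flow_C d p s : C p -> C (flow d (p, s)).
Proof.
elim: d p => [|d IH] p Cp /=; first by apply: collapse_C => //; exact: schedule_itv.
by apply: IH; apply: collapse_C => //; exact: schedule_itv.
Qed.

Lemma flow_C' d p s : C' p -> C' (flow d (p, s)).
Proof.
elim: d p => [|d IH] p Cp /=; first by apply: collapse_C' => //; exact: schedule_itv.
by apply: IH; apply: collapse_C' => //; exact: schedule_itv.
Qed.

Lemma flow_nbhd d p s : C p -> core_nbhd p -> core_nbhd (flow d (p, s)).
Proof.
elim: d p => [|d IH] p Cp Up /=; first by apply: collapse_nbhd => //; exact: schedule_itv.
apply: IH; first by apply: collapse_C => //; exact: schedule_itv.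
by apply: collapse_nbhd => //; exact: schedule_itv.
Qed.

Lemma flow_start d p : flow d (p, 0) = p.
Proof.
have s0 j : schedule j 0 = 0 by rewrite /schedule mulr0 sub0r smooth_step0// oppr_le0.
by elim: d p => [|d IH] p /=; rewrite s0 collapse0.
Qed.

Lemma collapse_core_end X p : S' X -> core X p -> collapse (dim X) (p, 1) = m X 0 p.
Proof.
move=> SX [Tp rp]; rewrite (collapse_in 1 SX Tp).
by rewrite (factor1_near (hS' SX) (ltW rp)).
Qed.

(** The innermost map of [flow (dim X)] is the stage of [X]. Once finished, it is [m X 0] on
    [core X], so the result depends only on the fibre of the point. *)
Lemma core_fiber_flow X p q s : S' X -> core X p -> core X q -> m X 0 q = m X 0 p ->
  schedule (dim X) s = 1 -> flow (dim X) (q, s) = flow (dim X) (p, s).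
Proof.
move=> SX Xp Xq mq s1.
have e : collapse (dim X) (q, 1) = collapse (dim X) (p, 1).
  by rewrite (collapse_core_end SX Xp) (collapse_core_end SX Xq).
by move: s1 e; case: (dim X) => [|d] /= -> ->.
Qed.

(* Once the stratum [X] has been collapsed to, the stages of higher dimension are
   invisible on [core X]; before that, they have not started. *)
Lemma flow_core X d p s : S' X -> (dim X <= d)%N -> core X p ->
  flow d (p, s) = flow (dim X) (p, s).
Proof.
move=> SX dX Xp; have SX1 := hS' SX.
(* The threshold [s = (dim X + 1) / (n + 1)] is at once the end of the stage of [X] and the start of
   the next one. *)
have [lt|ge] := ltP (n.+1%:R * s) (dim X).+1%:R.
  have s0 j : (dim X < j)%N -> schedule j s = 0.
    move=> dj; rewrite /schedule smooth_step0// subr_le0.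
    by apply: le_trans (ltW lt) _; rewrite ler_nat.
  elim: d dX => [|d IH]; first by rewrite leqn0 => /eqP ->.
  by rewrite leq_eqVlt => /orP[/eqP -> //|dX] /=; rewrite s0// collapse0 IH.
have s1 : schedule (dim X) s = 1.
  by rewrite /schedule smooth_step1// lerBrDr nat1r.
(* The induction peels off the innermost stage, which moves the point; hence the claim is
   generalised to all [q] of [core X] in the same fibre of [m X 0] as [p]. *)
suff h q : core X q -> m X 0 q = m X 0 p -> flow d (q, s) = flow (dim X) (p, s) by exact: h.
elim: d dX q => [|d IH].
  rewrite leqn0 => /eqP dX0 q Xq mq; rewrite -dX0; exact: core_fiber_flow.
rewrite leq_eqVlt => /orP[/eqP dXd|dX] q Xq mq.
  by rewrite -dXd; exact: core_fiber_flow.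
have [Xq' mq'] := collapse_core SX1 dX Xq (schedule_itv d.+1 s).
by apply: IH => //; rewrite mq'.
Qed.

Lemma dim_le_n X : S X -> (dim X <= n)%N.
Proof. by move=> SX; have [] := ss_submanifold hS SX. Qed.

(** At time 1 all stages are finished. On [core X] only those of dimension at most [dim X] count:
    the one of dimension [dim X] lands on [X], and the lower ones preserve [C']. *)
Lemma flow_end p : core_nbhd p -> C' (flow n (p, 1)).
Proof.
move=> [X SX Xp]; have SX1 := hS' SX; rewrite (flow_core _ SX (dim_le_n SX1) Xp).
have [Tp rp] := Xp.
have s1 : schedule (dim X) 1 = 1.
  by rewrite /schedule smooth_step1// mulr1 lerBrDr nat1r ler_nat ltnS dim_le_n.
have e : C' (collapse (dim X) (p, 1)).
  by rewrite (collapse_core_end SX Xp); exists X => //; exact: (m0_mem hM htub).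
by move: s1 e; case: (dim X) => [|d] /= -> // /flow_C'.
Qed.

Lemma flow_retraction :
  smooth_retraction_near A C C' (core_nbhd `&` C) (flow n).
Proof.
have sF X : S' X -> smooth_map AR A (core X `*` [set: R]) (flow (dim X)).
  move=> SX; have SX1 := hS' SX.
  apply: (smooth_map_restrict chAR (open_cylinder (core_open SX1)) _ (@smooth_flow (dim X))).
  by move=> [q b] [Xq _]; split=> //; exact: core_above.
(* Points of [core X] may lie on strata of dimension below [n], which [smooth_flow] at [n] does not
   reach. There [flow n] coincides with [flow (dim X)], which is smooth on the open set [core X]
   because this set lies in [above (dim X)]. *)
have sF' : smooth_map AR A (core_nbhd `*` [set: R]) (flow n).
  apply: (smooth_map_local wAR) => -[p t] [/= [X SX Xp] _].
  exists (core X `*` setT), (flow (dim X)); split=> //; last 2 first.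
  - exact: sF.
  - by move=> [q s] [/= Xq _]; apply: flow_core => //; exact: dim_le_n (hS' SX).
  - by move=> [q s] [/= Xq _]; split=> //; exists X.
split.
- by exists core_nbhd => //; exact: core_nbhd_open.
- by move=> p C'p; split; [exact: sub_core_nbhd|case: C'p => X /hS' SX; exact: (stratum_sub hS)].
- split.
  + apply: continuous_in_subspaceT => -[p t]; rewrite inE => -[[/= Up _] _].
    exact: (smooth_map_continuous chAR chA sF').
  + by move=> p t [Up Cp] _; split; [exact: flow_nbhd|exact: flow_C].
  + by move=> p _; exact: flow_start.
  + by move=> p t C'p _; exact: flow_C'.
  + by move=> p [Up _]; exact: flow_end.
- move=> [p t] [[/= Up _] _]; exists (core_nbhd `*` setT), (flow n); split=> //.
  exact: open_cylinder core_nbhd_open.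
Qed.

(** * Equivariance of the retraction *)

Section Equivariance.
Variables (k : nat) (G : topGroupCarrierType) (B : set (chart G 'rV[R]_k)).
Variable act : G -> M -> M.
Hypothesis hB : lie_group B.
Hypothesis hact : smooth_action B A act.
Hypothesis hinv : strata_invariant S act.
Hypothesis heq : tub_equivariant A S dim tub act.

Lemma act_inv g p : act (g^-1)%g (act g p) = p.
Proof. by have [h1 hM' _] := hact; rewrite -hM' mulVg h1. Qed.

Lemma T_act X g p : S X -> TT X (act g p) <-> TT X p.
Proof.
move=> SX; split=> [Tg|Tp]; last by have [_ /(_ p Tp)[]] := heq SX g.
by rewrite -(act_inv g p); have [_ /(_ _ Tg)[]] := heq SX (g^-1)%g.
Qed.

Lemma rho_act X g p : S X -> TT X p -> rho X (act g p) = rho X p.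
Proof. by move=> SX Tp; have [_ /(_ p Tp)[]] := heq SX g. Qed.

Lemma smooth_act g : smooth_map A A setT (act g).
Proof.
have chB := smooth_manifold_charted (lg_manifold hB).
have wB := charted_weak chB; have cB := finite_coordinates_rV R k.
have [_ _ sa] := hact.
have s := smooth_map_pair cE cB cE wA wB wA (smooth_map_cst g chA chB) (smooth_map_id chA).
have wBA := weak_atlas_prod cB cE wB wA.
exact: (smooth_map_comp (finite_coordinates_prod cB cE) cE wA wBA wA s sa (fun _ _ => I)).
Qed.

Lemma act_continuous g : continuous (act g).
Proof. by move=> p; exact: (smooth_map_continuous chA chA (smooth_act g)). Qed.

Lemma above_act d g p : above d p -> above d (act g p).
Proof.
move=> ap [X [SX dX] Xp]; apply: ap; exists X => //.
by rewrite -(act_inv g p); exact: hinv.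
Qed.

Lemma velocity_act X g (gam : R -> M) : S X ->
  integral_curve A (above (dim X)) (V_ tub X) gam ->
  integral_curve A (above (dim X)) (V_ tub X) (act g \o gam).
Proof.
move=> SX ig t; have [ag [cg vg]] := ig t; split; first exact: above_act.
split; first by apply: continuous_comp => //; exact: act_continuous.
move=> d Ad dg.
have [hA kA _] := chA; have [c Ac cgt] := kA (gam t).
have [oc _ cK _ _] := hA _ Ac.
have [hd _] := heq SX g.
rewrite (hd _ ag c d Ac Ad cgt dg).
have [W [oW Wg sW sm]] := smooth_map_in_charts cE cE wA wA (smooth_act g) I Ac cgt Ad dg.
have [dc dcE] := vg c Ac cgt.
have d1 : differentiable (cmap c \o gam : R^o -> 'rV[R]_n) (t : R^o) by exact/derivable1_diffP.
have d2 : differentiable (cmap d \o act g \o cinv c) ((cmap c \o gam) t).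
  by have [h _] := sm 1%N; exact: h.
have near_c : \forall s \near t, cdom c (gam s) by apply: cg; exact: open_nbhs_nbhs.
apply: (@near_eq_is_derive _ R^o _ ((cmap d \o act g \o cinv c) \o (cmap c \o gam))).
  by apply: filterS near_c => s cs /=; rewrite cK.
apply: DeriveDef; first exact/derivable1_diffP/differentiable_comp.
by rewrite (derive_comp (1 : R^o) d1 d2) dcE.
Qed.

(** Invariance is given for the vector field only. For [t > 0] the point [m X t p] is reached along
    an integral curve at time [ln t], and [act g] maps this curve to the one through [act g p], by
    uniqueness. *)
Lemma m_act X g t p : S X -> TT X p -> 0 <= t -> m X t (act g p) = act g (m X t p).
Proof.
move=> SX Tp t0; have Tg := (T_act g p SX).2 Tp.
have curve q : TT X q -> integral_curve A (above (dim X)) (V_ tub X) (fun s => m X (expR s) q).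
  move=> Tq s; split; first by apply: (T_above htub SX); exact: (m_T hM htub).
  exact: (m_velocity hM htub SX Tq).
have e := integral_curve_unique chA (open_above (dim X)) (tub_vector_field htub SX)
  (sm_hausdorff hM) (curve _ Tg) (velocity_act g SX (curve _ Tp)).
have pos s : 0 < s -> m X s (act g p) = act g (m X s p).
  move=> s0; have : (fun s => m X (expR s) (act g p)) = (act g \o (fun s => m X (expR s) p)).
    by apply: e; rewrite /= expR0 !(m1 hM htub).
  by move=> /(congr1 (fun f => f (ln s))) /=; rewrite lnK// posrE.
move: t0; rewrite le_eqVlt => /orP[/eqP <-|]; last exact: pos.
(* The time 0 is not reached along integral curves; it is a limit of positive times, at which the
   equation already holds. *)
have cl : closed [set s : R | m X s (act g p) = act g (m X s p)].
  apply: (closed_agreement (sm_hausdorff hM)) => s; first exact: (m_continuous hM hS htub).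
  apply: continuous_comp; [exact: (m_continuous hM hS htub)|exact: act_continuous].
apply: cl => D /nbhs_ballP[r /= r0 rD]; exists (r / 2); split; first by apply: pos; rewrite divr_gt0.
apply: rD; rewrite -ball_normE /= sub0r normrN ger0_norm ?divr_ge0 ?ltW//.
by rewrite ltr_pdivrMr// ltr_pMr// ltr1n.
Qed.

Lemma collapse_act d g p a : 0 <= a <= 1 ->
  collapse d (act g p, a) = act g (collapse d (p, a)).
Proof.
move=> a01; have [[X [SX dX TX e]]|N] := pselect (exists X, [/\ S' X, dim X = d, TT X p & True]).
  have SX1 := hS' SX; have Tg := (T_act g p SX1).2 TX.
  rewrite -dX !collapse_in//.
  have -> : factor X a (act g p) = factor X a p by rewrite /factor rho_act.
  by rewrite m_act//; have /andP[] := factor_itv X p a01.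
rewrite !collapse_out// => X SX dX TX; apply: N; exists X => //.
by split=> //; apply/(T_act g p (hS' SX)).
Qed.

Lemma flow_act d g p s : flow d (act g p, s) = act g (flow d (p, s)).
Proof.
elim: d p => [|d IH] p /=; first by rewrite collapse_act// schedule_itv.
by rewrite collapse_act ?schedule_itv// IH.
Qed.

Lemma core_nbhd_act g p : core_nbhd p -> core_nbhd (act g p).
Proof.
move=> [X SX [Tp rp]]; have SX1 := hS' SX; exists X => //.
by split; [exact/T_act|rewrite rho_act].
Qed.

Lemma C_act g p : C p -> C (act g p).
Proof.
move=> Cp; have [X SX Xp] := stratum_of hS Cp.
by apply: (stratum_sub hS SX); exact: hinv.
Qed.

End Equivariance.
End Retraction.

Unset Implicit Arguments.

Theorem mainTheorem4 (R : realType) (n : nat) (M : topologicalType)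
    (A : set (chart M 'rV[R]_n)) (hM : smooth_manifold A)
    (C : set M) (S : set (set M)) (dim : set M -> nat)
    (hS : stratified_subset A C S dim) (hC : closed C)
    (hdim : dimension_setting S dim)
    (tub : set M -> tub_data R n M)
    (htub : tub_collection A S dim tub)
    (hadj : tub_adjusted A S dim tub)
    (htan : tub_tangential A S dim tub)
    (hpre : tub_pre_commutative A S dim tub)
    (hcom : tub_commutative A S dim tub)
    (S' : set (set M)) (hS' : S' `<=` S)
    (hC' : closed_in C (\bigcup_(X in S') X)) :
  (exists (U : set M) (F : M * R -> M),
     smooth_retraction_near A C (\bigcup_(X in S') X) U F) /\
  (forall (k : nat) (G : topGroupCarrierType) (B : set (chart G 'rV[R]_k))
     (act : G -> M -> M),
     lie_group B -> compact [set: G] -> smooth_action B A act ->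
     strata_invariant S act -> tub_equivariant A S dim tub act ->
     exists (U : set M) (F : M * R -> M),
       [/\ smooth_retraction_near A C (\bigcup_(X in S') X) U F,
           (forall g p, U p -> U (act g p)) &
           (forall g p t, U p -> 0 <= t <= 1 ->
              F (act g p, t) = act g (F (p, t)))]).
Proof.
have [eps [eps_gt0 eps_lf]] := radii_exist hM hS hdim htub hadj.
have ret := flow_retraction hM hS hC hdim htub hadj htan hpre hcom hS' eps_gt0 eps_lf.
split=> [|k G B act hB _ hact hinv heq].
  by exists (core_nbhd A dim tub S' eps `&` C), (flow A dim tub S' eps n).
(* The retraction of the first part is already equivariant: its values are built from the scalings
   [m X] and the invariant functions [rho X]. *)
exists (core_nbhd A dim tub S' eps `&` C), (flow A dim tub S' eps n); split=> //.
- move=> g p [Up Cp]; split; last exact: (C_act hS hinv).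
  exact: (core_nbhd_act hS' hact heq).
- by move=> g p t _ _; exact: (flow_act hM hS hdim htub hadj hS' eps hB hact hinv heq).
Qed.
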